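(* Let $L:\mathbb R\times\mathbb R^n\times\mathbb R^n\to\mathbb R$ satisfy conditions (C1), (C2), (C3) of the context, let $A$ be an $m\times n$ matrix, $b\in\mathbb R^m$, $S=\{x\in\mathbb R^n: Ax\le b\}$, and let $\hat x(\cdot)\in AC([0,1],\mathbb R^n)$ be the solution of the problem $$\int_0^1 L(t,x(t),\dot x(t))\,dt\to\inf,\qquad x(0)=0,\quad Ax(1)\le b .$$ Let $a\in S$ and let the constants $r_0,c,\Lambda_0,\Lambda_1,T_0,\beta,\eta,\bar\gamma,\Lambda_2,\varrho$ be as defined in the context. Then for almost every $t\in[0,1]$ $$|\dot{\hat x}(t)|\le \ell=\max\left\{\varrho,\ \sqrt{\frac{2}{\mu}(\Lambda_0+\beta)},\ \frac{\Lambda_1+\sqrt{\Lambda_1^2+4\mu\Lambda_0}}{2}\right\}.$$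
   Context: Notation: $|\cdot|$ is the Euclidean norm, $\langle\cdot,\cdot\rangle$ the inner product, $B_n$ the closed unit ball of $\mathbb R^n$, $AC([0,1],\mathbb R^n)$ the absolutely continuous functions. $L=L(t,x,u)$; $\nabla_u L$ and $\nabla_{(t,x)}L$ are the gradients in $u$ and in $(t,x)$. ''Solution'' means a global minimizer over $x(\cdot)\in AC([0,1],\mathbb R^n)$ satisfying the end-point constraints. Conditions. (C1) $L$ is continuously differentiable and $L(t,x,u)\ge\theta(|u|)>0$ for all $t,x,u$, where $\theta:[0,\infty)\to\mathbb R$ satisfies $\lim_{r\to\infty} r/\theta(r)=0$. (C2) There is a constant $\mu>0$ such that $L(t,x,u)+\langle\nabla_uL(t,x,u),v-u\rangle+\frac{\mu}{2}|v-u|^2\le L(t,x,v)$ for all $t,x,u,v$. (C3) There are constants $\xi>0$, $\delta>0$ such that $|\nabla_{(t,x)}L(t,x,u)|\le\xi L(t,x,u)+\delta$ for all $t,x,u$. Constants. Let $r_0>0$ be such that $\theta(r)/r\ge1$ for all $r\ge r_0$; let $a\in S$ and $c=r_0+\int_0^1L(t,ta,a)\,dt$; $\Omega=[0,1]\times cB_n$; $$\Lambda_0=\max_{(t,x)\in\Omega}L(t,x,0),\quad \Lambda_1=\max_{(t,x)\in\Omega}|\nabla_uL(t,x,0)|,$$ $$\sigma(r)=\max_{(t,x)\in\Omega,\ |u|\le r}\big(\langle\nabla_uL(t,x,u),u\rangle-L(t,x,u)\big).$$ The function $\sigma(r)$ tends to infinity as $r\to\infty$; let $0<T_0<1$ be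 such that $\beta:=\sigma((c+1)/T_0)>\delta/\xi$. Put $$\eta=\sup_{r\ge0}\frac{r}{\theta(r)+\beta},\quad \bar\gamma=e^{\eta\xi(c+T_0\beta)},\quad \Lambda_2=\max_{(t,x)\in\Omega,\ |u|=\bar\gamma+1}L(t,x,u).$$ Let $\varrho>0$ be such that $$\frac{r}{\left(\frac{\mu}{2}r^2-\Lambda_1r-\Lambda_0\right)+\beta}<\frac{1}{\Lambda_2+\beta}\quad\text{whenever } r\ge\varrho .$$ *)

(* Defs.v *)
From mathcomp Require Import all_boot all_order all_algebra.
From mathcomp Require Import all_classical all_reals all_analysis.

Set Implicit Arguments.
Unset Strict Implicit.
Unset Printing Implicit Defensive.

Import Order.TTheory GRing.Theory Num.Theory.
Import numFieldNormedType.Exports.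

Local Open Scope classical_set_scope.
Local Open Scope ring_scope.

(* Points of R^n are row vectors.  The library norm `|u| on 'rV[R]_n is the
   sup norm (it is only used for the topology), hence dotv and enorm. *)
Definition dotv (R : realType) (n : nat) (u v : 'rV[R]_n) : R :=
  \sum_(i < n) u 0 i * v 0 i.

Definition enorm (R : realType) (n : nat) (u : 'rV[R]_n) : R :=
  Num.sqrt (dotv u u).

Definition grad (R : realType) (n : nat) (f : 'rV[R]_n -> R) (u : 'rV[R]_n) :
    'rV[R]_n :=
  \row_(i < n) 'D_(delta_mx 0 i) f u.

Definition grad_u (R : realType) (n : nat) (L : R -> 'rV[R]_n -> 'rV[R]_n -> R)
    (t : R) (x u : 'rV[R]_n) : 'rV[R]_n :=
  grad (L t x) u.

Definition grad_tx (R : realType) (n : nat)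
    (L : R -> 'rV[R]_n -> 'rV[R]_n -> R) (t : R) (x u : 'rV[R]_n) :
    'rV[R]_(1 + n) :=
  row_mx (derive1 (fun s : R => L s x u) t)%:M (grad (fun y => L t y u) x).

(* For finite-dimensional V, continuity of p |-> 'd f p v for every v is
   continuity of p |-> 'd f p in operator norm. *)
Definition continuously_differentiable (R : realType) (V : normedModType R)
    (f : V -> R) : Prop :=
  (forall p : V, differentiable f p) /\
  (forall v : V, continuous (fun p : V => 'd f p v)).

(* Only the values of theta on [0, +oo[ matter. *)
Definition condC1 (R : realType) (n : nat)
    (L : R -> 'rV[R]_n -> 'rV[R]_n -> R) (theta : R -> R) : Prop :=
  [/\ continuously_differentiable
        (fun p : R * 'rV[R]_n * 'rV[R]_n => L p.1.1 p.1.2 p.2),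
      forall (t : R) (x u : 'rV[R]_n),
        theta (enorm u) <= L t x u /\ 0 < theta (enorm u)
    & r / theta r @[r --> +oo] --> (0 : R)].

Definition condC2 (R : realType) (n : nat)
    (L : R -> 'rV[R]_n -> 'rV[R]_n -> R) (mu : R) : Prop :=
  0 < mu /\
  forall (t : R) (x u v : 'rV[R]_n),
    L t x u + dotv (grad_u L t x u) (v - u) + mu / 2 * enorm (v - u) ^+ 2
      <= L t x v.

Definition condC3 (R : realType) (n : nat)
    (L : R -> 'rV[R]_n -> 'rV[R]_n -> R) (xi delta : R) : Prop :=
  [/\ 0 < xi, 0 < delta &
    forall (t : R) (x u : 'rV[R]_n),
      enorm (grad_tx L t x u) <= xi * L t x u + delta].

(* Degenerate intervals are allowed: they contribute 0 to both sums. *)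
Definition absolutely_continuous01 (R : realType) (n : nat)
    (x : R -> 'rV[R]_n) : Prop :=
  forall e : R, 0 < e -> exists2 d : R, 0 < d &
    forall (N : nat) (s t : 'I_N -> R),
      (forall i, 0 <= s i /\ s i <= t i /\ t i <= 1) ->
      trivIset [set: 'I_N] (fun i => `]s i, t i[%classic) ->
      \sum_(i < N) (t i - s i) < d ->
      \sum_(i < N) enorm (x (t i) - x (s i)) < e.

Definition polyhedron (R : realType) (m n : nat) (A : 'M[R]_(m, n))
    (b : 'cV[R]_m) : set 'rV[R]_n :=
  [set x | forall i : 'I_m, (A *m x^T) i 0 <= b i 0].

(* An absolutely continuous x is differentiable almost everywhere on [0,1]; the
   value of derive1 x on the exceptional null set is irrelevant.  The cost is
   extended-real valued, hence defined for every x when L is positive. *)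
Definition cost (R : realType) (n : nat) (L : R -> 'rV[R]_n -> 'rV[R]_n -> R)
    (x : R -> 'rV[R]_n) : \bar R :=
  (\int[@lebesgue_measure R]_(t in `[0%R, 1%R]) (L t (x t) (derive1 x t))%:E)%E.

Definition admissible (R : realType) (m n : nat) (A : 'M[R]_(m, n))
    (b : 'cV[R]_m) (x : R -> 'rV[R]_n) : Prop :=
  [/\ absolutely_continuous01 x, x 0 = 0 & polyhedron A b (x 1)].

Definition solution (R : realType) (m n : nat)
    (L : R -> 'rV[R]_n -> 'rV[R]_n -> R) (A : 'M[R]_(m, n)) (b : 'cV[R]_m)
    (x : R -> 'rV[R]_n) : Prop :=
  admissible A b x /\
  forall y : R -> 'rV[R]_n, admissible A b y -> (cost L x <= cost L y)%E.

Definition is_max (R : realType) (S : set R) (M : R) : Prop :=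
  S M /\ ubound S M.

Definition Omega (R : realType) (n : nat) (c : R) : set (R * 'rV[R]_n) :=
  `[0, 1]%classic `*` [set x | enorm x <= c].
Arguments Omega {R n} c.

(* Main.v *)
Require Import Defs.
From HB Require Import structures.
From mathcomp Require Import all_boot all_order all_algebra.
From mathcomp Require Import all_classical all_reals all_analysis.
From mathcomp Require Import measurable_realfun.
From mathcomp Require Import ring lra.

(** Let [g] be the derivative of the minimizer, which is thus the primitive of
    [g]. Varying [g] by bounded functions of mean zero supported where [g] is
    bounded gives the Euler-Lagrange equation in integrated form: almost
    everywhere, [grad_u L t (x t) (g t) = q t], where the momentum [q] is a
    constant plus the integral of [grad_x L] along the path ([euler_lagrange]).
    Strong convexity makes [grad_u L t y] a bijection with a continuous inverse,
    so [g] agrees almost everywhere with a continuous velocity [u], and [x] and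
    [q] are continuously differentiable inside (0,1) ([regular_extremal]). The
    Hamiltonian [p = <q, u> - L] is the largest value of [<q, v> - L(t, x, v)]
    over all velocities [v], hence differentiable, with [p' = - L_t], although
    [u] is merely continuous ([extremal_hamiltonian]).

    The cost of the minimizer is at most that of the segment from 0 to [a]. This
    gives [\int |u| <= c], and keeps the path in [Omega c]. Where [p > beta] the
    definition of [sigma] forces [|u| > (c + 1) / T0]; hence [p <= beta]
    somewhere, and an interval on which [p > beta] has length at most [T0]. On
    such an interval [L + beta <= <q, u> <= |q| |u| <= eta |q| (L + beta)], so
    [condC3] bounds both [|q'|] and [|p'|] by [k |q|] with
    [k = eta xi (L + beta)], and the integral of [k] is at most [ln gamma].
    A Gronwall argument from the end of the interval where [p <= beta] yields
    [p - beta <= (gamma - 1) |q|] ([hamiltonian_excursion]). Comparing [p] with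
    [<q, v> - L(t, x, v)] for [v] parallel to [q] and of length [gamma + 1]
    then gives [|q| <= Lambda2 + beta] ([momentum_le]). So
    [L + beta <= (Lambda2 + beta) |u|], while the quadratic lower bound for [L]
    and the choice of [rho] exclude this when [|u| >= rho] ([speed_le_high]).
    At the other times [p <= beta], and strong convexity between [u] and 0 gives
    [mu / 2 |u|^2 <= Lambda0 + beta] ([speed_le_low]). *)

Import Order.TTheory GRing.Theory Num.Theory.
Import numFieldNormedType.Exports.

Local Open Scope classical_set_scope.
Local Open Scope ring_scope.

Set Implicit Arguments.
Unset Strict Implicit.
Unset Printing Implicit Defensive.

(** * Absolutely continuous functions and their total variation *)

(** Absolute continuity with families indexed by any finite type: [ac01_variation]
    applies it to a family indexed by pairs (interval, cell of a partition of it). *)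
Definition ac01 (R : realType) (f : R -> R) : Prop :=
  forall e : R, 0 < e -> exists2 d : R, 0 < d &
    forall (J : finType) (s t : J -> R),
      (forall i, 0 <= s i /\ s i <= t i /\ t i <= 1) ->
      trivIset [set: J] (fun i => `]s i, t i[%classic) ->
      \sum_i (t i - s i) < d ->
      \sum_i `|f (t i) - f (s i)| < e.

Lemma ac01_finType (R : realType) (f : R -> R) :
  (forall e : R, 0 < e -> exists2 d : R, 0 < d &
    forall (N : nat) (s t : 'I_N -> R),
      (forall i, 0 <= s i /\ s i <= t i /\ t i <= 1) ->
      trivIset [set: 'I_N] (fun i => `]s i, t i[%classic) ->
      \sum_i (t i - s i) < d ->
      \sum_i `|f (t i) - f (s i)| < e) -> ac01 f.
Proof.
move=> H e e0; have [d d0 {}H] := H e e0; exists d => // J s t st tr sd.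
have /= := H #|J| (s \o enum_val) (t \o enum_val).
rewrite (reindex _ (onW_bij _ (@enum_val_bij J))); apply.
- by move=> i; exact: st.
- by move=> i j _ _ /(tr _ _ I I)/enum_val_inj.
- by move: sd; rewrite (reindex _ (onW_bij _ (@enum_val_bij J))).
Qed.

Lemma itv_partition_nth_lt (R : realType) (a b : R) p i j : itv_partition a b p ->
  (i < j <= size p)%N -> nth b (a :: p) i < nth b (a :: p) j.
Proof.
move=> [pp _] /andP[ij jp].
have := @sorted_ltn_nth _ <%R (@lt_trans _ R) b (a :: p) pp i j.
by apply => //; rewrite inE /= ltnS// ltnW// (leq_trans ij).
Qed.

Lemma itv_partition_cell_inj (R : realType) (a b x : R) p i j :
  itv_partition a b p -> (i < size p)%N -> (j < size p)%N ->
  x \in `]nth b (a :: p) i, nth b (a :: p) i.+1[ ->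
  x \in `]nth b (a :: p) j, nth b (a :: p) j.+1[ -> i = j.
Proof.
move=> pp; wlog : i j / (i <= j)%N => [wl ip jp xi xj|].
  by have [ij|/ltnW ji] := leqP i j; [exact: wl|apply/esym/wl].
rewrite leq_eqVlt => /predU1P[->//|ij] ip jp.
rewrite !in_itv => /andP[_ xi] /andP[xj _].
suff : nth b (a :: p) i.+1 <= nth b (a :: p) j by move=> /(lt_le_trans xi) /(lt_trans xj);
  rewrite ltxx.
move: ij; rewrite leq_eqVlt => /predU1P[->//|ij].
by apply/ltW/(itv_partition_nth_lt pp); rewrite ij ltnW.
Qed.

(** Partitioning each interval of a disjoint family gives a disjoint family of
    the same total length, so the modulus of absolute continuity of [f] also
    controls the sum of the variations. *)
Lemma ac01_variation (R : realType) (f : R -> R) (e d : R) :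
  (forall (J : finType) (s t : J -> R),
      (forall i, 0 <= s i /\ s i <= t i /\ t i <= 1) ->
      trivIset [set: J] (fun i => `]s i, t i[%classic) ->
      \sum_i (t i - s i) < d ->
      \sum_i `|f (t i) - f (s i)| < e) ->
  forall (J : finType) (s t : J -> R) (p : J -> seq R),
      (forall i, 0 <= s i /\ s i <= t i /\ t i <= 1) ->
      trivIset [set: J] (fun i => `]s i, t i[%classic) ->
      (forall i, itv_partition (s i) (t i) (p i)) ->
      \sum_i (t i - s i) < d ->
      \sum_i variation (s i) (t i) f (p i) < e.
Proof.
move=> H J s t p st tr pp sd.
pose T := {i : J & 'I_(size (p i))}.
pose s' (k : T) := nth (t (tag k)) (s (tag k) :: p (tag k)) (tagged k).
pose t' (k : T) := nth (t (tag k)) (s (tag k) :: p (tag k)) (tagged k).+1.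
have sumE (F : forall i : J, nat -> R) :
    \sum_(k : T) F (tag k) (tagged k) = \sum_i \sum_(0 <= j < size (p i)) F i j.
  rewrite (eq_bigr (fun i => \sum_(j < size (p i)) F i j)); last first.
    by move=> i _; rewrite big_mkord.
  by rewrite sig_big_dep.
have inst (k : T) : s (tag k) <= s' k /\ t' k <= t (tag k).
  split; first by apply: itv_partition_nth_ge => //; rewrite ltnS ltnW.
  by apply: itv_partition_nth_le => //; rewrite ltnS.
have s't' k : s' k < t' k.
  by apply: itv_partition_nth_lt (pp _) _; rewrite ltnSn /=.
have := H T s' t' _ _ _.
rewrite (sumE (fun i j => `|f (nth (t i) (s i :: p i) j.+1) - f (nth (t i) (s i :: p i) j)|)).
apply.
- move=> k; have [sk tk] := inst k; have [s0 [_ t1]] := st (tag k).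
  by split; [exact: le_trans sk|split; [exact: ltW|exact: le_trans t1]].
- move=> [i a] [j b] _ _ [x [/= xa xb]].
  have ij : i = j.
    apply: (tr _ _ I I); exists x; move: xa xb; rewrite /= !in_itv/=.
    have /= [sk tk] := inst (existT _ i a).
    have /= [sk' tk'] := inst (existT _ j b).
    by move=> /andP[? ?] /andP[? ?]; split; apply/andP; split; lra.
  subst j; congr existT; apply/val_inj.
  exact: (itv_partition_cell_inj (pp i) (ltn_ord a) (ltn_ord b) xa xb).
- rewrite (sumE (fun i j => nth (t i) (s i :: p i) j.+1 - nth (t i) (s i :: p i) j)).
  rewrite (eq_bigr (fun i => t i - s i))// => i _.
  rewrite telescope_sumr// /=; congr (_ - _).
  exact: (itv_partition_nth_size _ (pp i)).
Qed.

(** Total variation inherits absolute continuity: choose partitions almost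
    realizing the total variations and apply [ac01_variation] with [e / 2]. *)
Lemma ac01_total_variation (R : realType) (f : R -> R) : ac01 f ->
  forall e : R, 0 < e -> exists2 d : R, 0 < d &
    forall (J : finType) (s t : J -> R),
      (forall i, 0 <= s i /\ s i <= t i /\ t i <= 1) ->
      trivIset [set: J] (fun i => `]s i, t i[%classic) ->
      \sum_i (t i - s i) < d ->
      (\sum_i total_variation (s i) (t i) f <= e%:E)%E.
Proof.
move=> H e e0; have e20 : 0 < e / 2 by lra.
have [d d0 /ac01_variation {}H] := H _ e20; exists d => // J s t st tr sd.
have TVfin i : total_variation (s i) (t i) f \is a fin_num.
  have [s0 [sti t1]] := st i.
  rewrite ge0_fin_numE ?total_variation_ge0//.
  apply: (@le_lt_trans _ _ (e / 2)%:E); last exact: ltry.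
  apply: ge_ereal_sup => _ [_ [p pp <-] <-]; rewrite lee_fin.
  have := H 'I_1 (fun=> s i) (fun=> t i) (fun=> p).
  rewrite !big_ord1 => /(_ _ _ _ _)/ltW; apply => //.
    by move=> j k _ _ _; rewrite !ord1.
  apply: le_lt_trans sd; rewrite (bigD1 i)//= lerDl sumr_ge0// => j _.
  by have := st j; rewrite subr_ge0 => -[_ []].
(* The error [e / 2] is shared between the intervals; the [+ 1] covers an empty family. *)
pose n := #|J|%:R + 1 : R.
have n0 : 0 < n by rewrite ltr_wpDl.
have /choice[p pP] : forall i, exists p, itv_partition (s i) (t i) p /\
    fine (total_variation (s i) (t i) f) <= variation (s i) (t i) f p + e / 2 / n.
  move=> i; have en0 : 0 < e / 2 / n by rewrite divr_gt0.
  have [_ [_ [p pp <-] <-]] := ub_ereal_sup_adherent en0 (TVfin i).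
  rewrite -/(total_variation (s i) (t i) f) => lt; exists p; split => //.
  rewrite -lerBlDr -lee_fin EFinB fineK//; exact: ltW.
have -> : (\sum_i total_variation (s i) (t i) f =
  (\sum_i fine (total_variation (s i) (t i) f))%:E)%E.
  by rewrite -sumEFin; apply: eq_bigr => i _; rewrite fineK.
rewrite lee_fin.
apply: (@le_trans _ _ (\sum_i (variation (s i) (t i) f (p i) + e / 2 / n))).
  by apply: ler_sum => i _; exact: (pP i).2.
rewrite big_split/= sumr_const.
have -> : e / 2 / n *+ #|J| = e / 2 * (#|J|%:R / n).
  by rewrite -mulr_natr mulrAC mulrA.
have h1 : #|J|%:R / n <= 1 by rewrite ler_pdivrMr// mul1r lerDl.
have h2 : e / 2 * (#|J|%:R / n) <= e / 2 by rewrite ler_piMr// ltW.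
have h3 := H _ s t p st tr (fun i => (pP i).1) sd.
by lra.
Qed.

(** Cut [0, 1] into [N] pieces shorter than the modulus of absolute continuity
    for [e = 1]; each has total variation at most 1. *)
Lemma ac01_bounded_variation (R : realType) (f : R -> R) : ac01 f ->
  bounded_variation 0 1 f.
Proof.
move=> /ac01_total_variation /(_ 1 ltr01)[d d0 H].
have TV1 s t : 0 <= s -> s <= t -> t <= 1 -> t - s < d ->
    (total_variation s t f <= 1%:E)%E.
  move=> s0 st t1 ts.
  have := H 'I_1 (fun=> s) (fun=> t).
  rewrite !big_ord1 => /(_ _ _ _); apply => //.
  by move=> j k _ _ _; rewrite !ord1.
pose N := (Num.truncn d^-1).+1.
have N0 : (0 : R) < N%:R by rewrite ltr0n.
have dN : N%:R^-1 < d.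
  by rewrite invf_plt ?posrE// truncnS_gt.
have TVn k : (k <= N)%N -> (total_variation 0 (k%:R / N%:R) f < +oo)%E.
  elim: k => [_|k ih kN]; first by rewrite mul0r total_variationxx ltry.
  have le1 : k%:R / N%:R <= k.+1%:R / N%:R :> R by rewrite ler_pM2r ?invr_gt0// ler_nat.
  have ge0 : 0 <= k%:R / N%:R :> R by rewrite divr_ge0// ltW.
  rewrite (total_variationD _ ge0 le1) lte_add_pinfty ?ih ?(ltnW kN)//.
  apply: (@le_lt_trans _ _ 1%:E); last exact: ltry.
  apply: TV1 => //; first by rewrite ler_pdivrMr// mul1r ler_nat.
  by rewrite -mulrBl -natrB ?leqnSn// subSnn mul1r.
apply/bounded_variationP => //; rewrite ge0_fin_numE ?total_variation_ge0//.
by have := TVn N (leqnn N); rewrite divff// gt_eqF.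
Qed.

(** * Densities of monotone absolutely continuous functions *)

Lemma bounded_open_interval (R : realType) (X : set R) : open X ->
  is_interval X -> has_lbound X -> has_ubound X ->
  exists a b : R, a <= b /\ X = `]a, b[%classic.
Proof.
move=> oX iX lX uX; have [->|/set0P X0] := eqVneq X set0.
  by exists 0, 0; split => //; rewrite set_itvoo0.
exists (inf X), (sup X); split.
  by case: X0 => x Xx; apply: (@le_trans _ _ x); [exact: ge_inf|exact: ub_le_sup].
have := interval_bounded_interior iX lX uX.
move/interior_id : oX => -> {1}->.
by apply/seteqP; split => x /=; rewrite in_itv.
Qed.

Lemma stieltjes_oc (R : realType) (F : cumulative R R) (a b : R) : a <= b ->
  lebesgue_stieltjes_measure F (`]a, b]%classic : set (measurableTypeR R)) = (F b - F a)%:E.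
Proof.
move=> ab; rewrite /lebesgue_stieltjes_measure /measure_extension.
rewrite measurable_mu_extE/=; last exact: is_ocitv.
by rewrite wlength_itv_bnd.
Qed.

(** The Stieltjes measure of [F] is absolutely continuous with respect to
    Lebesgue measure: a null set is covered by an open set of small measure,
    which is a disjoint union of open intervals, on which the increments of [F]
    have a small sum. The Radon-Nikodym derivative is the density. *)
Lemma nondecreasing_density (R : realType) (F : R -> R) :
  {homo F : x y / x <= y} ->
  (forall e : R, 0 < e -> exists2 d : R, 0 < d &
    forall (N : nat) (s t : 'I_N -> R),
      (forall i, s i <= t i) ->
      trivIset [set: 'I_N] (fun i => `]s i, t i[%classic) ->
      \sum_i (t i - s i) < d ->
      \sum_i (F (t i) - F (s i)) <= e) ->
  exists2 g : R -> R, (@lebesgue_measure R).-integrable `[0, 1] (EFin \o g) &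
    forall t, 0 <= t <= 1 -> F t - F 0 = \int[@lebesgue_measure R]_(x in `[0, t]) g x.
Proof.
move=> ndF HF.
have rcF x : F @ at_right x --> F x.
  apply/cvgrPdist_le => e e0; have [d d0 H] := HF e e0.
  near=> y.
  have xy : x < y by near: y; exact: nbhs_right_gt.
  rewrite distrC ger0_norm ?subr_ge0 ?ndF ?(ltW xy)//.
  have := H 1%N (fun=> x) (fun=> y); rewrite !big_ord1; apply => //.
  - by move=> i j _ _ _; rewrite !ord1.
  - by rewrite ltrBlDl; near: y; apply: nbhs_right_lt; rewrite ltrDl.
pose FC : cumulative R R := HB.pack F (isCumulative.Build R _ R F ndF rcF).
pose mu := lebesgue_stieltjes_measure FC : {measure set (measurableTypeR R) -> \bar R}.
have mD : measurable (`]0, 1]%classic : set (measurableTypeR R)) by exact: measurable_itv.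
have muD : (mu (`]0%R, 1%R]%classic : set R) < +oo)%E.
  by rewrite /mu/= stieltjes_oc// ltry.
pose nu : {finite_measure set (measurableTypeR R) -> \bar R} := mfrestr mD muD.
have numu : nu `<< (@lebesgue_measure R).
  apply/null_content_dominatesP => A mA A0.
  rewrite /nu /= /mfrestr /mrestr.
  apply/eqP; rewrite eq_le measure_ge0 andbT; apply/lee_addgt0Pr => e e0; rewrite add0e.
  have [d d0 {}HF] := HF e e0.
  have [|U [oU AU Ud]] := @lebesgue_regularity_outer R A d mA _ d0.
    by rewrite A0 ltry.
  (* Intersecting with a bounded open set makes all components bounded. *)
  pose W := U `&` `](-1), 2[%classic.
  have oW : open W by apply: openI => //; exact: itv_open.
  have AW : A `&` `]0, 1] `<=` W.
    move=> x [Ax]; rewrite /= in_itv/= => /andP[x0 x1]; split; first exact: AU.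
    by rewrite /= in_itv/=; apply/andP; split; lra.
  have mU V : open V -> measurable (V : set (measurableTypeR R)) by exact: open_measurable.
  have Wd : (lebesgue_measure W < d%:E)%E.
    apply: le_lt_trans Ud.
    apply: (@le_trans _ _ (lebesgue_measure U)).
      by apply: le_measure; rewrite ?inE; [exact: mU|exact: mU|exact: subIsetl].
    rewrite -[in leLHS](setDUK AU) measureU ?A0 ?add0e//.
      by apply: measurableD => //; exact: mU.
    by rewrite setDIK.
  pose J := open_disjoint_itv oW.
  have /choice[a /choice[b ab]] : forall k, exists a b : R, a <= b /\ J k = `]a, b[%classic.
    move=> k; have JW : J k `<=` W.
      by rewrite (open_disjoint_itv_bigcup oW) => x Jx; exists k.
    apply: bounded_open_interval.
    - exact: open_disjoint_itv_open.
    - exact: open_disjoint_itv_is_interval.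
    - by exists (-1) => x /JW[_ /=]; rewrite in_itv/= => /andP[/ltW].
    - by exists 2 => x /JW[_ /=]; rewrite in_itv/= => /andP[_ /ltW].
  have trJ : trivIset setT J by exact: open_disjoint_itv_trivIset.
  have mJ k : measurable (J k : set (measurableTypeR R)).
    by apply: mU; exact: open_disjoint_itv_open.
  apply: (@le_trans _ _ (mu W)).
    by apply: le_measure => //; rewrite inE; [exact: measurableI|exact: mU].
  rewrite (open_disjoint_itv_bigcup oW) measure_bigcup//; last first.
  apply: lime_le.
    by apply: is_cvg_nneseries => k _ _; exact: measure_ge0.
  apply: nearW => n; rewrite big_mkord/= big_mkcond/=; under eq_bigr do rewrite in_setT.
  apply: (@le_trans _ _ (\sum_(k < n) (F (b k) - F (a k))%:E)%E).
    apply: lee_sum => k _; have [abk Jk] := ab k.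
    rewrite -(stieltjes_oc FC)//; apply: le_measure; rewrite ?inE//.
    by rewrite -/(J k) Jk; apply: subset_itvl; rewrite bnd_simp.
  rewrite sumEFin lee_fin; apply: HF.
  - by move=> i; have [] := ab i.
  - move=> i j _ _; rewrite -(ab i).2 -(ab j).2 => /(trJ _ _ I I) ij.
    exact/val_inj.
  - rewrite -lte_fin -sumEFin; apply: le_lt_trans Wd.
    have -> : (\sum_(i < n) (b i - a i)%:E = \sum_(i < n) lebesgue_measure (J i))%E.
      apply: eq_bigr => i _; have [abi ->] := ab i.
      rewrite lebesgue_measure_itv/= lte_fin; case: ltP => // bai.
      by rewrite (_ : b i = a i) ?subrr//; apply/eqP; rewrite eq_le bai.
    rewrite -(@measure_bigsetU _ _ _ (@lebesgue_measure R) J)//; last first.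
    apply: le_measure; rewrite ?inE; [exact: bigsetU_measurable|exact: mU|].
    rewrite [X in _ `<=` X](open_disjoint_itv_bigcup oW).
    by rewrite -(bigcup_mkord n J) => x [k _ Jx]; exists k.
have [g [g0 gfin gi gE]] := radon_nikodym_sigma_finite numu.
have gE' : EFin \o (fine \o g) = g by apply/funext => x /=; rewrite fineK.
exists (fine \o g).
  rewrite gE'; apply: integrableS gi => //.
move=> t /andP[t0 t1].
have /(congr1 fine) := gE `]0, t]%classic (measurable_itv _).
rewrite {1}/nu /= /mfrestr /mrestr.
rewrite (_ : `]0, t] `&` `]0, 1] = `]0, t]%classic); last first.
  apply/setIidPl; apply: subset_itvl; rewrite bnd_simp//.
rewrite (stieltjes_oc FC)//= => ->.
rewrite /Rintegral; congr fine.
rewrite integral_itv_obnd_cbnd; last first.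
  by apply: (measurable_funS measurableT) => //; exact: (measurable_int _ gi).
by apply: eq_integral => x _ /=; rewrite fineK.
Unshelve. all: by end_near. Qed.

(** * Primitives of integrable functions on the unit interval *)

(** Functions on [0, 1] are extended to the line by precomposition with this
    retraction, which preserves monotonicity and continuity. *)
Definition clamp (R : realType) (t : R) : R := Num.max 0 (Num.min t 1).

Lemma clamp_ge0 (R : realType) (t : R) : 0 <= clamp t.
Proof. by rewrite /clamp le_max lexx. Qed.

Lemma clamp_le1 (R : realType) (t : R) : clamp t <= 1.
Proof. by rewrite /clamp ge_max ler01 ge_min lexx orbT. Qed.

Lemma clamp_id (R : realType) (t : R) : 0 <= t <= 1 -> clamp t = t.
Proof. by move=> /andP[t0 t1]; rewrite /clamp min_l// max_r. Qed.

Lemma le_clamp (R : realType) (s t : R) : s <= t -> clamp s <= clamp t.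
Proof. by move=> st; rewrite /clamp; case: (leP s 1); case: (leP t 1); rewrite /Num.max/=;
  do ?case: ifPn; lra. Qed.

Lemma clamp_sub (R : realType) (s t : R) : s <= t -> clamp t - clamp s <= t - s.
Proof. by move=> st; rewrite /clamp; case: (leP s 1); case: (leP t 1); rewrite /Num.max/=;
  do ?case: ifPn; lra. Qed.

Lemma clamp_itv (R : realType) (s t x : R) : clamp s < x < clamp t -> s < x < t.
Proof.
rewrite /clamp; case: (leP s 1); case: (leP t 1); rewrite /Num.max/=; do ?case: ifPn; lra.
Qed.

Section primitives.
Variable R : realType.
Notation mu := (@lebesgue_measure R).
Implicit Types f g : R -> R.

Definition prim g (t : R) : R := \int[mu]_(x in `[0, t]) g x.

Definition intg01 g := mu.-integrable (`[0%R, 1%R]%classic : set R) (EFin \o g).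

Let mI : measurable (`[0%R, 1%R]%classic : set (measurableTypeR R)).
Proof. exact: measurable_itv. Qed.

Lemma prim0 g : prim g 0 = 0.
Proof. by rewrite /prim set_itv1 Rintegral_set1. Qed.

Lemma intg01S g (i : interval R) : intg01 g -> [set` i] `<=` `[0%R, 1%R]%classic ->
  mu.-integrable [set` i] (EFin \o g).
Proof. by move=> gi si; apply: integrableS gi => //; exact: measurable_itv. Qed.

Lemma prim_sub g (s t : R) : intg01 g -> 0 <= s -> s <= t -> t <= 1 ->
  prim g t - prim g s = \int[mu]_(x in `]s, t]) g x.
Proof.
move=> gi s0 st t1; rewrite /prim Rintegral_itvB ?bnd_simp//.
by apply: intg01S => //; apply: subset_itvl; rewrite bnd_simp.
Qed.

Lemma intg01D f g : intg01 f -> intg01 g -> intg01 (fun x => f x + g x).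
Proof. by move=> fi gi; have := integrableD mI fi gi; exact. Qed.

Lemma intg01B f g : intg01 f -> intg01 g -> intg01 (fun x => f x - g x).
Proof. by move=> fi gi; have := integrableB mI fi gi; exact. Qed.

Lemma intg01Z r g : intg01 g -> intg01 (fun x => r * g x).
Proof. by move=> gi; have := integrableZl mI r gi; exact. Qed.

Lemma intg01_abs g : intg01 g -> intg01 (fun x => `|g x|).
Proof. by move=> gi; have := integrable_abse gi; exact. Qed.

Lemma intg01_measurable g : intg01 g -> measurable_fun (`[0%R, 1%R]%classic : set R) g.
Proof. by move=> /measurable_int /measurable_EFinP. Qed.

Lemma intg01_le f g : measurable_fun (`[0%R, 1%R]%classic : set R) f ->
  intg01 g -> (forall t, 0 <= t <= 1 -> `|f t| <= `|g t|) -> intg01 f.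
Proof.
move=> mf gi fg; apply: (le_integrable mI _ _ gi); first exact/measurable_EFinP.
by move=> t /=; rewrite in_itv/= => t01; rewrite lee_fin fg.
Qed.

Lemma intg01_continuous f : {within `[0, 1], continuous f} -> intg01 f.
Proof. by move=> cf; apply: continuous_compact_integrable => //; exact: segment_compact. Qed.

Lemma intg01_cst r : intg01 (fun=> r).
Proof. by apply/intg01_continuous/continuous_subspaceT => x; exact: cst_continuous. Qed.

Lemma primB f g t : intg01 f -> intg01 g -> 0 <= t <= 1 ->
  prim (fun x => f x - g x) t = prim f t - prim g t.
Proof.
move=> fi gi /andP[t0 t1]; rewrite /prim RintegralB//.
- by apply: intg01S => //; apply: subset_itvl; rewrite bnd_simp.
- by apply: intg01S => //; apply: subset_itvl; rewrite bnd_simp.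
Qed.

Lemma primD f g t : intg01 f -> intg01 g -> 0 <= t <= 1 ->
  prim (fun x => f x + g x) t = prim f t + prim g t.
Proof.
move=> fi gi /andP[t0 t1]; rewrite /prim RintegralD//.
- by apply: intg01S => //; apply: subset_itvl; rewrite bnd_simp.
- by apply: intg01S => //; apply: subset_itvl; rewrite bnd_simp.
Qed.

Lemma primZ r f t : intg01 f -> 0 <= t <= 1 ->
  prim (fun x => r * f x) t = r * prim f t.
Proof.
move=> fi /andP[t0 t1]; rewrite /prim RintegralZl//.
by apply: intg01S => //; apply: subset_itvl; rewrite bnd_simp.
Qed.

(** [f] is the difference of its total variation function and of
    (total variation - [f]); both are nondecreasing and absolutely continuous,
    so [nondecreasing_density] applies to each. *)
Lemma ac01_prim f : ac01 f ->
  exists2 g, intg01 g & forall t, 0 <= t <= 1 -> f t - f 0 = prim g t.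
Proof.
move=> acf; have /ac01_total_variation acTV := acf.
have TVfin s t : 0 <= s -> s <= t -> t <= 1 -> total_variation s t f \is a fin_num.
  move=> s0 st t1; apply/bounded_variationP => //.
  apply: (bounded_variationl st t1); apply: (bounded_variationr s0); first exact: le_trans t1.
  exact: ac01_bounded_variation.
pose F1 t := fine (total_variation 0 (clamp t) f).
pose F2 t := F1 t - f (clamp t).
have F1B s t : s <= t -> F1 t - F1 s = fine (total_variation (clamp s) (clamp t) f).
  move=> st; rewrite /F1 (total_variationD _ (clamp_ge0 s) (le_clamp st)).
  rewrite fineD ?TVfin ?clamp_ge0 ?clamp_le1 ?le_clamp//.
  by rewrite addrAC subrr add0r.
have TVge s t : s <= t -> `|f (clamp t) - f (clamp s)| <= fine (total_variation (clamp s) (clamp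
  t) f).
  move=> st; rewrite -lee_fin fineK ?TVfin ?clamp_ge0 ?clamp_le1 ?le_clamp//.
  by apply: total_variation_ge; exact: le_clamp.
have key e : 0 < e -> exists2 d : R, 0 < d &
    forall (N : nat) (s t : 'I_N -> R),
      (forall i, s i <= t i) ->
      trivIset [set: 'I_N] (fun i => `]s i, t i[%classic) ->
      \sum_i (t i - s i) < d ->
      \sum_i (F1 (t i) - F1 (s i)) <= e.
  move=> e0; have [d d0 H] := acTV e e0; exists d => // N s t st tr sd.
  rewrite -lee_fin -sumEFin; under eq_bigr do rewrite F1B//.
  under eq_bigr do rewrite fineK ?TVfin ?clamp_ge0 ?clamp_le1 ?le_clamp//.
  have := H _ (fun i => clamp (s i)) (fun i => clamp (t i)); apply.
  - by move=> i /=; rewrite clamp_ge0 clamp_le1 le_clamp.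
  - move=> i j _ _ [x [/= xi xj]]; apply: (tr _ _ I I); exists x.
    by move: xi xj; rewrite /= !in_itv/= => /clamp_itv -> /clamp_itv ->.
  - by apply: le_lt_trans sd; apply: ler_sum => i _; exact: clamp_sub.
have [g1 g1i g1E] : exists2 g, intg01 g & forall t, 0 <= t <= 1 -> F1 t - F1 0 = prim g t.
  apply: nondecreasing_density => // s t st.
  by rewrite -subr_ge0 F1B// (le_trans _ (TVge _ _ st)).
have [g2 g2i g2E] : exists2 g, intg01 g & forall t, 0 <= t <= 1 -> F2 t - F2 0 = prim g t.
  apply: nondecreasing_density => [s t st|e e0].
    have := TVge _ _ st; have := F1B _ _ st; rewrite /F2.
    by rewrite ler_norml => FE /andP[_]; rewrite -FE; lra.
  have [d d0 H] := key (e / 2) ltac:(lra); exists d => // N s t st tr sd.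
  have {}H := H N s t st tr sd.
  apply: (@le_trans _ _ (\sum_i (F1 (t i) - F1 (s i)) * 2)); last first.
    by rewrite -mulr_suml; lra.
  apply: ler_sum => i _; have := TVge _ _ (st i); rewrite /F2.
  have := F1B _ _ (st i); rewrite ler_norml => FE /andP[]; rewrite -FE; lra.
exists (fun x => g1 x - g2 x); first exact: intg01B.
move=> t t01; rewrite primB// -g1E// -g2E// /F2 !clamp_id//; last by rewrite lexx ler01.
lra.
Qed.

(** Approximate [g] in mean by a continuous, hence bounded, function; the
    bounded part contributes at most its bound times the total length. *)
Lemma prim_ac01 g : intg01 g -> ac01 (prim g).
Proof.
move=> gi e e0.
have [|h [ch hi hcvg]] := approximation_continuous_integrable mI _ gi.
  by rewrite /= lebesgue_measure_itv/= lte_fin ltr01 ltry.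
have e20 : 0 < e / 2 by lra.
have /fine_cvgP[_ /cvgrPdist_lt /(_ _ e20)[n _ /(_ n (leqnn n))]] := hcvg.
rewrite sub0r normrN /= -/(Rintegral _ _ _) => hn.
set k := fun z => `|g z - h n z|.
have ki : intg01 k by apply/intg01_abs/intg01B => //; exact: hi.
have kE : \int[mu]_(z in `[0, 1]) k z < e / 2.
  by apply: le_lt_trans hn; exact: ler_norm.
have [M M0 hM] : exists2 M : R, 0 < M & forall x, 0 <= x <= 1 -> `|h n x| <= M.
  have [|x _ hx] := @EVT_max R (fun x => `|h n x|) 0 1 ler01.
    apply: continuous_subspaceT => x; apply: continuous_comp; first exact: ch.
    exact: norm_continuous.
  exists (`|h n x| + 1); first by rewrite ltr_wpDl.
  by move=> y y01; rewrite (le_trans (hx y _))//= lerDl.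
exists (e / 2 / M); first by rewrite divr_gt0.
move=> J s t st tr sd.
have sub i : `]s i, t i] `<=` (`[0, 1]%classic : set R).
  have [s0 [_ t1]] := st i.
  by move=> x /=; rewrite !in_itv/= => /andP[sx xt]; apply/andP; split; lra.
have subo i : `]s i, t i[ `<=` (`[0, 1]%classic : set R).
  apply: subset_trans (sub i); apply: subset_itvl; rewrite bnd_simp//.
have step i : `|prim g (t i) - prim g (s i)| <=
    \int[mu]_(x in `]s i, t i[) k x + M * (t i - s i).
  have [s0 [sti t1]] := st i; rewrite prim_sub//.
  have gi' : mu.-integrable `]s i, t i] (EFin \o g) by exact: intg01S.
  have ki' : mu.-integrable `]s i, t i] (EFin \o k) by exact: intg01S.
  have Mi' : mu.-integrable `]s i, t i] (EFin \o fun=> M).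
    by apply: intg01S => //; exact: intg01_cst.
  apply: (le_trans (le_normr_Rintegral _ _)) => //.
  apply: (@le_trans _ _ (\int[mu]_(x in `]s i, t i]) (k x + M))).
    apply: le_Rintegral => //.
    - by apply: intg01S => //; exact: intg01_abs.
    - by apply: intg01S => //; apply: intg01D => //; exact: intg01_cst.
    - move=> x /sub; rewrite /= in_itv/= => /hM; rewrite /k => hx.
      by rewrite -{1}(subrK (h n x) (g x)) (le_trans (ler_normD _ _))// lerD2l.
  rewrite RintegralD// Rintegral_cst//= lebesgue_measure_itv/= lte_fin.
  have -> : \int[mu]_(x in `]s i, t i[) k x = \int[mu]_(x in `]s i, t i]) k x.
    by rewrite Rintegral_itv_bndo_bndc//; exact: intg01S.
  rewrite lerD2l; case: ltP => [_|_]/=; first by [].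
  by rewrite mulr0 mulr_ge0 ?subr_ge0// ltW.
apply: (@le_lt_trans _ _ (\sum_i (\int[mu]_(x in `]s i, t i[) k x + M * (t i - s i)))).
  by apply: ler_sum => i _; exact: step.
rewrite big_split/= -mulr_sumr.
have : M * (\sum_i (t i - s i)) < e / 2.
  by rewrite mulrC -ltr_pdivlMr.
suff : \sum_i \int[mu]_(x in `]s i, t i[) k x <= \int[mu]_(z in `[0, 1]) k z.
  by move=> kM eM; rewrite (splitr e); apply: ler_ltD => //; exact: le_trans kM (ltW kE).
pose D := \big[setU/set0]_(i <- enum J) `]s i, t i[%classic.
have mD : measurable (D : set R).
  by apply: bigsetU_measurable => i _; exact: measurable_itv.
have DI : D `<=` `[0, 1]%classic.
  by rewrite /D; apply: (big_ind (fun A => A `<=` `[0, 1]%classic)) => // A B AI BI;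
    rewrite subUset.
have mk : measurable_fun (`[0%R, 1%R]%classic : set R) (EFin \o k).
  exact: measurable_int ki.
have k0 (x : measurableTypeR R) : D x -> (0 <= (EFin \o k) x)%E by move=> _;
  rewrite /= lee_fin normr_ge0.
have trD : trivIset [set` enum J] (fun i : J => `]s i, t i[%classic).
  by move=> i j _ _ ij; exact: (tr _ _ I I).
have DE := ge0_integral_bigsetU mu (fun i => measurable_itv _) (enum_uniq _) trD (measurable_funS
  mI DI mk) k0.
have -> : \sum_i \int[mu]_(x in `]s i, t i[) k x = \int[mu]_(x in D) k x.
  apply: EFin_inj; rewrite [RHS]fineK; last first.
    by apply: integrable_fin_num => //; apply: integrableS ki.
  rewrite -sumEFin DE big_enum/=; apply: eq_bigr => i _.
  by rewrite fineK//; apply: integrable_fin_num => //; exact: intg01S.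
apply: fine_le.
- by apply: integrable_fin_num => //; apply: integrableS ki.
- exact: integrable_fin_num.
- apply: (ge0_subset_integral mu mD mI mk _ DI) => x _; by rewrite /= lee_fin normr_ge0.
Qed.

(** Almost every point is a Lebesgue point of [g], extended by 0 outside [0, 1]. *)
Lemma prim_derive_ae g : intg01 g ->
  {ae mu, forall t : R, 0 < t < 1 -> is_derive t 1 (prim g) (g t)}.
Proof.
move=> gi.
have /lebesgue_differentiation := integrable_locally_restrict mI gi.
set h := g \_ _ => H.
have hE y : 0 <= y <= 1 -> h y = g y.
  by move=> y01; rewrite /h patchE mem_set//= in_itv.
apply: filterS H; first exact: (ae_filter_ringOfSetsType mu).
move=> t hpt /andP[t0 t1].
have hi : mu.-integrable [set` Interval (BLeft 0) (BRight (1:R))] (EFin \o h).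
  apply: eq_integrable gi => //= y; rewrite inE/= in_itv/= => y01.
  by rewrite hE.
have [dh h't] := FTC1_lebesgue_pt t1 hi t0 hpt.
have dF : is_derive t 1 (fun y : R => \int[mu]_(t in `[0, y]) h t) (g t).
  by apply: DeriveDef => //; rewrite -derive1E h't hE// !ltW.
apply: near_eq_is_derive dF.
near=> y; rewrite /prim; apply: eq_Rintegral => x; rewrite inE/= in_itv/= => /andP[x0 xy].
rewrite hE// x0 (le_trans xy)// ltW//; near: y.
exact: lt_nbhsl.
Unshelve. all: by end_near. Qed.

End primitives.

(** * Euclidean vectors *)

Section euclid.
Variables (R : realType) (n : nat).
Implicit Types u v w : 'rV[R]_n.

Lemma dotvC u v : dotv u v = dotv v u.
Proof. by apply: eq_bigr => i _; rewrite mulrC. Qed.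

Lemma dotvDl u v w : dotv (u + v) w = dotv u w + dotv v w.
Proof. by rewrite /dotv -big_split; apply: eq_bigr => i _; rewrite !mxE mulrDl. Qed.

Lemma dotvZl r u w : dotv (r *: u) w = r * dotv u w.
Proof. by rewrite /dotv mulr_sumr; apply: eq_bigr => i _; rewrite !mxE mulrA. Qed.

Lemma dotvNl u w : dotv (- u) w = - dotv u w.
Proof. by rewrite -scaleN1r dotvZl mulN1r. Qed.

Lemma dotvBl u v w : dotv (u - v) w = dotv u w - dotv v w.
Proof. by rewrite dotvDl dotvNl. Qed.

Lemma dotvDr u v w : dotv w (u + v) = dotv w u + dotv w v.
Proof. by rewrite dotvC dotvDl !(dotvC w). Qed.

Lemma dotvZr r u w : dotv w (r *: u) = r * dotv w u.
Proof. by rewrite dotvC dotvZl (dotvC w). Qed.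

Lemma dotvBr u v w : dotv w (u - v) = dotv w u - dotv w v.
Proof. by rewrite dotvC dotvBl !(dotvC w). Qed.

Lemma dotv0r u : dotv u 0 = 0.
Proof. by rewrite /dotv big1// => i _; rewrite mxE mulr0. Qed.

Lemma dotvv_ge0 u : 0 <= dotv u u.
Proof. by apply: sumr_ge0 => i _; rewrite -expr2 sqr_ge0. Qed.

Lemma enorm_ge0 u : 0 <= enorm u.
Proof. exact: sqrtr_ge0. Qed.

Lemma enorm_sqr u : enorm u ^+ 2 = dotv u u.
Proof. by rewrite sqr_sqrtr// dotvv_ge0. Qed.

Lemma enorm0 : enorm (0 : 'rV[R]_n) = 0.
Proof. by rewrite /enorm dotv0r sqrtr0. Qed.

Lemma enormZ r u : enorm (r *: u) = `|r| * enorm u.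
Proof. by rewrite /enorm dotvZl dotvZr mulrA -expr2 sqrtrM ?sqr_ge0// sqrtr_sqr. Qed.

Lemma enormN u : enorm (- u) = enorm u.
Proof. by rewrite -scaleN1r enormZ normrN normr1 mul1r. Qed.

Lemma dotv_eq0 u : dotv u u = 0 -> u = 0.
Proof.
move=> /eqP; rewrite psumr_eq0; last by move=> i _; rewrite -expr2 sqr_ge0.
move=> /allP u0; apply/rowP => i; rewrite mxE.
have /implyP/(_ isT) := u0 i (mem_index_enum _).
by rewrite -expr2 sqrf_eq0 => /eqP.
Qed.

(** Cauchy-Schwarz, from the nonnegative square of
    [dotv v v *: u - dotv u v *: v]. *)
Lemma dotv_le u v : dotv u v <= enorm u * enorm v.
Proof.
have [v0|v0] := eqVneq (dotv v v) 0.
  by rewrite (dotv_eq0 v0) dotv0r enorm0 mulr0.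
have vv : 0 < dotv v v by rewrite lt_def v0 dotvv_ge0.
have := dotvv_ge0 (dotv v v *: u - dotv u v *: v).
rewrite !(dotvBl, dotvBr, dotvZl, dotvZr) (dotvC v u).
set a := dotv u u; set b := dotv u v; set d := dotv v v => H.
have {}H : 0 <= d * (d * a - b ^+ 2).
  by rewrite (le_trans H)// le_eqVlt; apply/orP; left; apply/eqP; ring.
rewrite pmulr_rge0// subr_ge0 in H.
rewrite /enorm -sqrtrM ?dotvv_ge0// (le_trans (ler_norm _))//.
by rewrite -sqrtr_sqr ler_wsqrtr// mulrC.
Qed.

Lemma coord_le_enorm u i : `|u 0 i| <= enorm u.
Proof.
rewrite -sqrtr_sqr /enorm ler_wsqrtr// /dotv (bigD1 i)//= expr2 lerDl.
by apply: sumr_ge0 => j _; rewrite -expr2 sqr_ge0.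
Qed.

Lemma enorm_le_sum u : enorm u <= \sum_i `|u 0 i|.
Proof.
have S0 : 0 <= \sum_i `|u 0 i| by exact: sumr_ge0.
rewrite -(ler_pXn2r (ltn0Sn 1)) ?nnegrE ?enorm_ge0// enorm_sqr /dotv expr2 mulr_suml.
apply: ler_sum => i _.
rewrite (le_trans (ler_norm _))// !normrM ler_wpM2l//.
by rewrite (bigD1 i)//= lerDl sumr_ge0.
Qed.

Lemma norm_le_enorm u : `|u| <= enorm u.
Proof.
rewrite [leLHS]mx_normrE; apply/bigmax_leP; split; first exact: enorm_ge0.
by move=> [i j] _ /=; rewrite (ord1 i) coord_le_enorm.
Qed.

End euclid.

(** * Absolutely continuous curves *)

Section vector_ac.
Variables (R : realType) (n : nat).
Notation mu := (@lebesgue_measure R).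
Implicit Types x g : R -> 'rV[R]_n.

Lemma ac_coord x i : absolutely_continuous01 x -> ac01 (fun t => x t 0 i).
Proof.
move=> acx; apply: ac01_finType => e e0; have [d d0 H] := acx e e0.
exists d => // N s t st tr sd; apply: le_lt_trans (H N s t st tr sd).
apply: ler_sum => j _; have := coord_le_enorm (x (t j) - x (s j)) i.
by rewrite !mxE.
Qed.

Lemma ac_of_coord x : (forall i, ac01 (fun t => x t 0 i)) -> absolutely_continuous01 x.
Proof.
move=> acx e e0; pose N1 : R := n%:R + 1.
have N10 : 0 < N1 by rewrite ltr_wpDl.
have /choice[d dP] : forall i, exists d : R, 0 < d /\
    forall (J : finType) (s t : J -> R),
      (forall i, 0 <= s i /\ s i <= t i /\ t i <= 1) ->
      trivIset [set: J] (fun i => `]s i, t i[%classic) ->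
      \sum_i (t i - s i) < d ->
      \sum_j `|x (t j) 0 i - x (s j) 0 i| < e / N1.
  by move=> i; have [|d d0 H] := acx i (e / N1); [rewrite divr_gt0|exists d].
exists (\big[Num.min/1]_i d i).
  by apply: (big_ind (fun z => 0 < z)) => // [y z y0 z0|i _]; [rewrite lt_min y0|have [] := dP i].
move=> N s t st tr sd.
apply: (@le_lt_trans _ _ (\sum_i \sum_(j < N) `|x (t j) 0 i - x (s j) 0 i|)).
  rewrite exchange_big/=; apply: ler_sum => j _.
  by rewrite (le_trans (enorm_le_sum _))//; apply: ler_sum => i _; rewrite !mxE.
apply: (@le_lt_trans _ _ (\sum_(i < n) (e / N1))).
  apply: ler_sum => i _; apply/ltW/(dP i).2 => //.
  by apply: lt_le_trans sd _; exact: bigmin_le.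
rewrite sumr_const card_ord -[_ *+ n]mulr_natl mulrA ltr_pdivrMr//.
by rewrite mulrC ltr_pM2l// ltrDl.
Qed.

Definition vprim g (t : R) : 'rV[R]_n := \row_i prim (fun s => g s 0 i) t.

Definition vintg01 g := forall i, intg01 (fun t => g t 0 i).

Lemma vprim0 g : vprim g 0 = 0.
Proof. by apply/rowP => i; rewrite !mxE prim0. Qed.

Lemma ac_vprim x : absolutely_continuous01 x ->
  exists2 g, vintg01 g & forall t, 0 <= t <= 1 -> x t = x 0 + vprim g t.
Proof.
move=> acx.
have /choice[g gP] : forall i, exists g : R -> R, intg01 g /\
    forall t, 0 <= t <= 1 -> x t 0 i - x 0 0 i = prim g t.
  by move=> i; have [g ? ?] := ac01_prim (ac_coord i acx); exists g.
have gE i : (fun t => (\row_i g i t) 0 i) = g i by apply/funext => t; rewrite mxE.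
exists (fun t => \row_i g i t) => [i|t t01]; first by rewrite gE; exact: (gP i).1.
apply/rowP => i; rewrite !mxE gE -(gP i).2//; ring.
Qed.

Lemma vprim_ac g v0 x : vintg01 g -> (forall t, 0 <= t <= 1 -> x t = v0 + vprim g t) ->
  absolutely_continuous01 x.
Proof.
move=> gi xE; apply: ac_of_coord => i e e0.
have [d d0 H] := prim_ac01 (gi i) e0; exists d => // J s t st tr sd.
apply: le_lt_trans (H J s t st tr sd); apply: ler_sum => j _.
have [s0 [sj t1]] := st j.
rewrite !xE ?s0 ?t1 ?(le_trans s0)// ?(le_trans _ t1)// !mxE.
by rewrite opprD addrACA subrr add0r.
Qed.

Lemma vprim_derive_ae g v0 x : vintg01 g -> (forall t, 0 <= t <= 1 -> x t = v0 + vprim g t) ->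
  {ae mu, forall t : R, 0 < t < 1 -> derive1 x t = g t}.
Proof.
move=> gi xE.
have aeF : Filter (almost_everywhere mu) by exact: (ae_filter_ringOfSetsType mu).
have : {ae mu, forall t : R, forall i, 0 < t < 1 ->
  is_derive t 1 (prim (fun s => g s 0 i)) (g t 0 i)}.
  by apply: filter_forall => i; exact: prim_derive_ae.
apply: filterS => t Ht t01.
have xd i : is_derive t 1 (fun s => x s 0 i) (g t 0 i).
  have := Ht i t01.
  have dc : is_derive t 1 (fun=> v0 0 i : R) 0 by exact: is_derive_cst.
  move=> dp; have := is_deriveD dc dp; rewrite add0r.
  apply: near_eq_is_derive; near=> s.
  have s01 : 0 <= s <= 1.
    apply/andP; split; apply/ltW; near: s; [apply: lt_nbhsr|apply: lt_nbhsl]; by case/andP: t01.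
  by rewrite xE// !mxE.
rewrite derive1E derive_mx; last by apply/derivable_mxP => i j; rewrite (ord1 i); have [] := xd j.
apply/rowP => i; rewrite mxE.
by have [_] := xd i.
Unshelve. all: by end_near. Qed.

End vector_ac.

(** * Integrals of functions that agree almost everywhere *)

Section lower_integral.
Import HBNNSimple.
Context d (T : measurableType d) (R : realType) (mu : {measure set T -> \bar R}).
Local Open Scope ereal_scope.

(** The integral of a nonnegative function is a supremum over the simple
    functions below it, and a simple function may be set to 0 on a null set
    without changing its integral. The argument covers non-measurable integrands,
    such as that of the cost of a curve whose derivative is arbitrary on a null
    set. *)
Lemma ge0_integral_le_ae (f k : T -> \bar R) (N : set T) : measurable N -> mu N = 0 ->
  (forall t, 0 <= f t) -> (forall t, 0 <= k t) ->
  (forall t, ~ N t -> f t <= k t) -> \int[mu]_t f t <= \int[mu]_t k t.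
Proof.
move=> mN N0 f0 k0 fk; rewrite !ge0_integralTE//.
apply: ge_ereal_sup => _ [h hf <-].
have mNc := measurableC mN.
pose h' := proj_nnsfun h mNc.
have -> : sintegral mu h = sintegral mu h'.
  have := integral_nnsfun mu measurableT h; rewrite patch_setT => <-.
  rewrite (ge0_negligible_integral mN)//; last 2 first.
    - exact/measurable_EFinP.
    - by move=> t _; rewrite lee_fin.
  by rewrite setTD integral_nnsfun// mrestrict.
apply: ereal_sup_ubound; exists h' => // t.
rewrite /h' -mrestrict patchE; case: ifPn => [|_]; last exact: k0.
by rewrite inE => Nt; exact: le_trans (hf t) (fk t Nt).
Qed.

Lemma ge0_integral_eq_ae (D : set T) (f k : T -> \bar R) :
  (forall t, D t -> 0 <= f t) -> (forall t, D t -> 0 <= k t) ->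
  {ae mu, forall t, D t -> f t = k t} -> \int[mu]_(t in D) f t = \int[mu]_(t in D) k t.
Proof.
move=> f0 k0 [N [mN N0 NE]]; rewrite !(integral_mkcond D).
have fkE t : ~ N t -> (f \_ D) t = (k \_ D) t.
  move=> Nt; rewrite !patchE; case: ifPn => //; rewrite inE => Dt.
  by apply: contrapT => fkt; apply: Nt; apply: NE => /(_ Dt).
have p0 (g : T -> \bar R) : (forall t, D t -> 0 <= g t) -> forall t, 0 <= (g \_ D) t.
  by move=> g0 t; rewrite patchE; case: ifPn => //; rewrite inE => /g0.
by apply/eqP; rewrite eq_le; apply/andP; split; apply: (ge0_integral_le_ae mN N0);
  do ?[exact: p0]; move=> t /fkE ->.
Qed.

End lower_integral.

(** * Measurability along a curve *)

Section measurable_comp.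
Variables (R : realType) (n : nat).

(** The preimage of an open set under a continuous [F] is a countable union of
    balls with rational centres and radii [1 / k], and membership in a ball is a
    condition on each coordinate. *)
Lemma measurable_continuous_comp d (T : measurableType d) (D : set T)
  (F : R * 'rV[R]_n * 'rV[R]_n -> R) (a : T -> R) (b c : T -> 'rV[R]_n) :
  continuous F -> measurable D -> measurable_fun D a ->
  (forall i, measurable_fun D (fun t => b t 0 i)) ->
  (forall i, measurable_fun D (fun t => c t 0 i)) ->
  measurable_fun D (fun t => F (a t, b t, c t)).
Proof.
move=> cF mD ma mb mc; apply: (measurability (@RGenOInfty.G R)).
  exact: RGenOInfty.measurableE.
move=> _ [_ [r ->] <-].
pose U := F @^-1` `]r, +oo[%classic.
have oU : open U by apply: open_comp => [x _|]; [exact: cF|rewrite set_itvE; exact: open_gt].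
pose pt (q : rat * 'rV[rat]_n * 'rV[rat]_n) : R * 'rV[R]_n * 'rV[R]_n :=
  (ratr q.1.1, map_mx ratr q.1.2, map_mx ratr q.2).
pose B (q : rat * 'rV[rat]_n * 'rV[rat]_n * nat) := ball (pt q.1) (q.2.+1%:R^-1 : R).
pose S q : set T := if `[< B q `<=` U >] then D `&` [set t | B q (a t, b t, c t)] else set0.
rewrite (_ : _ `&` _ = \bigcup_q S q); last first.
  apply/seteqP; split => t /=; last first.
    move=> [q _]; rewrite /S; case: ifPn => // /asboolP BU [Dt Bt]; split => //.
    by have := BU _ Bt.
  move=> [Dt Ft].
  have : nbhs (a t, b t, c t) U by apply: open_nbhs_nbhs; split.
  rewrite -nbhs_ballE => -[e /= e0 eU].
  pose k := Num.truncn (2 / e).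
  have k0 : (0 : R) < k.+1%:R^-1 by rewrite invr_gt0 ltr0n.
  (* A ball of this radius around a nearby rational point lies in the ball of radius [e]. *)
  have ke : k.+1%:R^-1 + k.+1%:R^-1 < e.
    rewrite -mulr2n -[_ *+ 2]mulr_natl ltr_pdivrMr ?ltr0n// mulrC -ltr_pdivrMr//.
    exact: truncnS_gt.
  have app0 (y z : R) : 0 < z -> exists q : rat, ball (ratr q : R) z y.
    move=> z0; have [q] := @rat_in_itvoo _ (y - z) (y + z) ltac:(lra).
    rewrite in_itv/= => qy; exists q; rewrite /ball/= ltr_distlC.
    by move: qy => /andP[? ?]; apply/andP; split; lra.
  have app y := app0 y _ k0.
  have appv (y : 'rV[R]_n) : exists q : 'rV[rat]_n, ball (map_mx ratr q : 'rV[R]_n) k.+1%:R^-1 y.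
    have /choice[q qP] := fun i => app (y 0 i).
    exists (\row_i q i); split => // i j; rewrite !mxE (ord1 i); exact: qP.
  have [q1 q1P] := app (a t); have [q2 q2P] := appv (b t); have [q3 q3P] := appv (c t).
  have Bt : B (q1, q2, q3, k) (a t, b t, c t) by split => //; split.
  exists (q1, q2, q3, k) => //; rewrite /S; case: ifPn => [_|/asboolP[]]; first by split.
  move=> p Bp; apply: eU; apply: le_ball (ltW ke) _ _.
  by apply: ball_triangle Bp; apply: ball_sym.
apply: countable_bigcupT_measurable => [|q]; first exact: countableP.
rewrite /S; case: ifPn => // _.
have mball (y : R) e (f : T -> R) : measurable_fun D f ->
  measurable (D `&` [set t | ball y e (f t)]).
  by move=> mf; apply: (mf mD _ (measurable_ball y e)).
have mballv (y : 'rV[R]_n) e (f : T -> 'rV[R]_n) : 0 < e ->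
    (forall i, measurable_fun D (fun t => f t 0 i)) ->
    measurable (D `&` [set t | ball y e (f t)]).
  move=> e0 mf.
  rewrite (_ : _ `&` _ = D `&` \bigcap_(i in [set: 'I_n]) (D `&` [set t | ball (y 0 i) e (f t 0
    i)])).
    apply: measurableI => //; apply: fin_bigcap_measurable => // i _.
    exact: mball (mf i).
  apply/seteqP; split => t /=.
    by move=> [Dt [_ H]]; split => // i _; split => //; exact: H.
  move=> [Dt H]; split => //; split => // i j; rewrite (ord1 i).
  by have [] := H j I.
have e0 : (0 : R) < q.2.+1%:R^-1 by rewrite invr_gt0 ltr0n.
rewrite (_ : _ `&` _ = (D `&` [set t | ball (pt q.1).1.1 (q.2.+1%:R^-1) (a t)]) `&`
   ((D `&` [set t | ball (pt q.1).1.2 (q.2.+1%:R^-1) (b t)]) `&`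
   (D `&` [set t | ball (pt q.1).2 (q.2.+1%:R^-1) (c t)]))).
  by apply: measurableI; [exact: mball|apply: measurableI; apply: mballv].
apply/seteqP; split => t /=.
  by move=> [Dt [[h1 h2] h3]].
by move=> [[Dt h1] [[_ h2] [_ h3]]].
Qed.

End measurable_comp.

(** * Integration by parts and the du Bois-Reymond lemma *)

Section by_parts.
Variable R : realType.
Notation mu := (@lebesgue_measure R).
Notation I01 := (`[0%R, 1%R]%classic : set R).
Implicit Types f g a b h l : R -> R.

Lemma measurable_I01 : measurable (I01 : set (measurableTypeR R)).
Proof. exact: measurable_itv. Qed.

(** [measurable_I01] is about the Borel sets on which Lebesgue measure is
    defined, this one about the default measurable structure of [R]. *)
Lemma measurable_I01' : measurable I01.
Proof. exact: measurable_itv. Qed.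

Lemma prim_bounded g t : intg01 g -> 0 <= t <= 1 -> `|prim g t| <= prim (fun s => `|g s|) 1.
Proof.
move=> gi /andP[t0 t1].
have si : `[0%R, t] `<=` I01 by apply: subset_itvl; rewrite bnd_simp.
apply: le_trans (le_normr_Rintegral _ _) _ => //; first exact: intg01S.
rewrite /prim; apply: fine_le.
- by apply: integrable_fin_num => //; apply: intg01S => //; exact: intg01_abs.
- by apply: integrable_fin_num => //; exact: intg01_abs.
- apply: (ge0_subset_integral mu _ measurable_I01) => //.
  exact: measurable_int (intg01_abs gi).
Qed.

Lemma prim_continuous g : intg01 g -> {within `[0, 1], continuous (prim g)}.
Proof. by move=> gi; exact: parameterized_integral_continuous. Qed.

Lemma within_continuous_measurable f : {within `[0, 1], continuous f} -> measurable_fun I01 f.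
Proof. by move=> cf; apply: subspace_continuous_measurable_fun => //; exact: measurable_itv. Qed.

Lemma intg01_bounded f M : measurable_fun I01 f ->
  (forall t, 0 <= t <= 1 -> `|f t| <= M) -> intg01 f.
Proof.
move=> mf fM; apply: (intg01_le mf (intg01_cst M)) => t t01.
by rewrite (le_trans (fM t t01))// ler_norm.
Qed.

Lemma intg01_mul_bounded f g M : measurable_fun I01 f -> intg01 g ->
  (forall t, 0 <= t <= 1 -> `|f t| <= M) -> intg01 (fun t => f t * g t).
Proof.
move=> mf gi fM; apply: (@intg01_le _ _ (fun t => M * g t)); last 2 first.
- exact: intg01Z.
- move=> t t01; rewrite !normrM ler_wpM2r//.
  by rewrite (le_trans (fM t t01))// ler_norm.
- exact: measurable_funM mf (intg01_measurable gi).
Qed.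

Lemma ac01_mul f g M : ac01 f -> ac01 g ->
  (forall t, 0 <= t <= 1 -> `|f t| <= M) -> (forall t, 0 <= t <= 1 -> `|g t| <= M) ->
  ac01 (fun t => f t * g t).
Proof.
move=> acf acg fM gM e e0.
have M0 : 0 <= M by rewrite (le_trans _ (fM 0 _))// lexx ler01.
pose e' := e / (2 * (M + 1)).
have M1 : 0 < M + 1 by rewrite ltr_wpDl.
have e'0 : 0 < e' by rewrite divr_gt0// mulr_gt0.
have [d1 d10 H1] := acf e' e'0; have [d2 d20 H2] := acg e' e'0.
exists (Num.min d1 d2); first by rewrite lt_min d10.
move=> J s t st tr; rewrite lt_min => /andP[sd1 sd2].
have {}H1 := H1 J s t st tr sd1; have {}H2 := H2 J s t st tr sd2.
apply: (@le_lt_trans _ _ (\sum_i (M * `|g (t i) - g (s i)| + M * `|f (t i) - f (s i)|))).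
  apply: ler_sum => i _; have [s0 [sti t1]] := st i.
  rewrite (_ : f (t i) * g (t i) - f (s i) * g (s i) =
    f (t i) * (g (t i) - g (s i)) + g (s i) * (f (t i) - f (s i))); last by ring.
  rewrite (le_trans (ler_normD _ _))// !normrM lerD// ler_wpM2r//.
    by apply: fM; rewrite t1 (le_trans s0).
  by apply: gM; rewrite s0 (le_trans sti).
rewrite big_split/= -!mulr_sumr -mulrDr.
set A := \sum_i _ in H2 *; set B := \sum_i _ in H1 *.
have eE : e = 2 * (M + 1) * e' by rewrite /e' mulrC divfK// gt_eqF// mulr_gt0.
have AB : A + B < 2 * e' by rewrite mulr2n mulrDl mul1r ltrD.
have AB0 : 0 <= A + B by rewrite addr_ge0// sumr_ge0.
apply: (@le_lt_trans _ _ ((M + 1) * (A + B))).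
  by rewrite ler_wpM2r// lerDl.
apply: (@lt_le_trans _ _ ((M + 1) * (2 * e'))); first by rewrite ltr_pM2l.
by rewrite le_eqVlt eE mulrCA mulrA eqxx.
Qed.

Lemma ae_I01_oo : {ae mu, forall t : R, I01 t -> 0 < t < 1}.
Proof.
exists [set 0; 1]; split.
- by apply: measurableU; exact: measurable_set1.
- by apply: countable_lebesgue_measure0; apply: finite_set_countable; rewrite finite_setU; split;
  exact: finite_set1.
- move=> t /= nt; apply: contrapT => /not_orP[t0 t1]; apply: nt.
  rewrite in_itv/= => /andP[]; rewrite !le_eqVlt => /predU1P[//|->].
    by move=> ?; exfalso; exact: t0.
  by move=> /predU1P[?|->//]; exfalso; exact: t1.
Qed.

(** The product of the two primitives is absolutely continuous, and its
    derivative is almost everywhere the integrand on the left. *)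
Lemma prim_by_parts a b : intg01 a -> intg01 b ->
  prim (fun t => a t * prim b t + prim a t * b t) 1 = prim a 1 * prim b 1.
Proof.
move=> ai bi.
pose M := Num.max (prim (fun s => `|a s|) 1) (prim (fun s => `|b s|) 1).
have aM t : 0 <= t <= 1 -> `|prim a t| <= M.
  by move=> t01; rewrite (le_trans (prim_bounded ai t01))// le_max lexx.
have bM t : 0 <= t <= 1 -> `|prim b t| <= M.
  by move=> t01; rewrite (le_trans (prim_bounded bi t01))// le_max lexx orbT.
have [c ci cE] := ac01_prim (ac01_mul (prim_ac01 ai) (prim_ac01 bi) aM bM).
have := cE 1; rewrite !prim0 mul0r subr0 => ->; last by rewrite ler01 lexx.
have mp g : intg01 g -> measurable_fun I01 (prim g).
  by move=> gi; exact: (within_continuous_measurable (prim_continuous gi)).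
have di : intg01 (fun t => a t * prim b t + prim a t * b t).
  apply: intg01D; last by apply: intg01_mul_bounded bi aM; exact: mp.
  under eq_fun do rewrite mulrC.
  by apply: intg01_mul_bounded ai bM; exact: mp.
have aeF : Filter (almost_everywhere mu) by exact: (ae_filter_ringOfSetsType mu).
have ae_c : {ae mu, forall t : R, 0 < t < 1 -> a t * prim b t + prim a t * b t = c t}.
  have Ha := prim_derive_ae ai; have Hb := prim_derive_ae bi; have Hc := prim_derive_ae ci.
  apply: filterS3 Ha Hb Hc => t Ha Hb Hc t01.
  have da := Ha t01; have db := Hb t01; have dc := Hc t01.
  have dm := is_deriveM da db.
  have : is_derive t 1 (prim c) (prim a t *: b t + prim b t *: a t).
    apply: near_eq_is_derive dm; near=> s.
    have s01 : 0 <= s <= 1.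
      apply/andP; split; apply/ltW; near: s; [apply: lt_nbhsr|apply: lt_nbhsl]; by case/andP: t01.
    by rewrite -cE// !prim0 mul0r subr0.
  move=> dc'; have [_ <-] := dc; have [_ ->] := dc'.
  by rewrite addrC mulrC [X in _ + X]mulrC mulrC [X in _ + X]mulrC; congr (_ + _);
    rewrite /GRing.scale/= mulrC.
rewrite /prim /Rintegral; congr fine; apply: ae_eq_integral.
- exact: measurable_I01.
- exact: measurable_int di.
- exact: measurable_int ci.
- apply: filterS2 ae_I01_oo ae_c => t t01 tc It; congr EFin; apply: tc.
  exact: t01.
Unshelve. all: by end_near. Qed.

(** The test functions live on the sets [E N], where [h] is bounded, since [h]
    itself need not be integrable. Put [H = h - prim l]. Integrating by parts,
    the hypothesis says that [H] is orthogonal to every bounded [psi] of mean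
    zero supported in some [E N]. Fix [E N0] of positive measure, let [m] be the
    mean of [H] over it and [K = H - m]. Testing with [K] on [E N], corrected by
    a multiple of the indicator of [E N0] to have mean zero, gives
    [\int_(E N) K^2 = 0]. *)
Lemma du_bois_reymond l h (E : nat -> set R) :
  intg01 l -> measurable_fun I01 h ->
  (forall N, measurable (E N : set (measurableTypeR R))) ->
  (forall N M, (N <= M)%N -> E N `<=` E M) ->
  (forall t, 0 <= t <= 1 -> exists N, E N t) ->
  (forall N, E N `<=` I01) ->
  (forall N, exists M, forall t, E N t -> `|h t| <= M) ->
  (forall N (psi : R -> R) (M : R), measurable_fun I01 psi -> (forall t, 0 <= t <= 1 ->
    `|psi t| <= M) ->
     (forall t, ~ E N t -> psi t = 0) -> prim psi 1 = 0 ->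
     prim (fun t => l t * prim psi t + h t * psi t) 1 = 0) ->
  exists m, {ae mu, forall t, I01 t -> h t = m + prim l t}.
Proof.
move=> li mh mE ndE covE EI hb var.
have aeF : Filter (almost_everywhere mu) by exact: (ae_filter_ringOfSetsType mu).
have T1 : (0 : R) <= (1 : R) <= 1 by rewrite ler01 lexx.
have mpl : measurable_fun I01 (prim l).
  exact: (within_continuous_measurable (prim_continuous li)).
pose H t := h t - prim l t.
have mH : measurable_fun I01 H by exact: measurable_funB mh mpl.
have mind N : measurable_fun I01 (\1_(E N) : R -> R).
  by apply: measurable_indic; exact: mE.
have ind1 N t : E N t -> \1_(E N) t = 1 :> R by move=> Et; rewrite indicE mem_set.
have ind0 N t : ~ E N t -> \1_(E N) t = 0 :> R by move=> Et; rewrite indicE memNset.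
have Hb N : exists2 M, 0 <= M & forall t, E N t -> `|H t| <= M.
  have [M hM] := hb N; exists (`|M| + prim (fun s => `|l s|) 1).
    by rewrite addr_ge0// (le_trans _ (prim_bounded li T1)).
  move=> t Et; rewrite (le_trans (ler_normB _ _))// lerD//.
    by rewrite (le_trans (hM t Et))// ler_norm.
  by apply: prim_bounded => //; have := EI N t Et; rewrite /= in_itv.
have key N (psi : R -> R) (M : R) : measurable_fun I01 psi -> (forall t, 0 <= t <= 1 ->
  `|psi t| <= M) ->
     (forall t, ~ E N t -> psi t = 0) -> prim psi 1 = 0 ->
     prim (fun t => H t * psi t) 1 = 0.
  move=> mpsi psiM psi0 p0.
  have psii : intg01 psi by exact: intg01_bounded psiM.
  have mpp : measurable_fun I01 (prim psi).
    exact: (within_continuous_measurable (prim_continuous psii)).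
  have i1 : intg01 (fun t => l t * prim psi t).
    under eq_fun do rewrite mulrC.
    by apply: intg01_mul_bounded mpp li (fun t => prim_bounded psii).
  have i2 : intg01 (fun t => prim l t * psi t).
    by apply: intg01_mul_bounded mpl psii (fun t => prim_bounded li).
  have i3 : intg01 (fun t => h t * psi t).
    have [M' hM'] := hb N; apply: (@intg01_bounded _ (`|M'| * `|M|)).
      exact: measurable_funM mh mpsi.
    move=> t t01; have [Et|nEt] := pselect (E N t); last by rewrite psi0// mulr0 normr0.
    rewrite normrM ler_pM//; first by rewrite (le_trans (hM' t Et))// ler_norm.
    by rewrite (le_trans (psiM t t01))// ler_norm.
  have e1 := var N psi M mpsi psiM psi0 p0.
  have e2 := prim_by_parts li psii.
  rewrite (_ : (fun t => H t * psi t) = (fun t => (l t * prim psi t + h t * psi t) -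
    (l t * prim psi t + prim l t * psi t))); last by apply/funext => t; rewrite /H; ring.
  by rewrite primB// ?e1 ?e2 ?p0 ?mulr0 ?subr0//; exact: intg01D.
(* If all [E N] are null then so is [0, 1], and any constant will do. *)
have [[N0 E0]|allE0] := pselect (exists N, mu (E N) != 0); last first.
  exists 0; have : {ae mu, forall t, forall N, ~ E N t}.
    apply: ae_foralln => N; exists (E N); split => //.
      by apply: contrapT => EN; apply: allE0; exists N; apply/eqP.
    by move=> t /=; exact: contrapT.
  apply: filterS => t Ht It; have [|N Et] := covE t; first by move: It; rewrite /= in_itv.
  by case: (Ht N).
have prim_ind N : prim (\1_(E N) : R -> R) 1 = fine (mu (E N)).
  rewrite /prim /Rintegral integral_indic ?setIidl//; exact: mE.
pose e0 := fine (mu (E N0)).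
have e0gt : 0 < e0.
  rewrite /e0 fine_gt0// lt_def E0 measure_ge0/=.
  apply: (@le_lt_trans _ _ (mu I01)); first by apply: le_measure => //; rewrite inE;
    [exact: mE|exact: measurable_I01].
  by rewrite lebesgue_measure_itv/= lte_fin ltr01 ltry.
have intE N (f : R -> R) (M : R) : measurable_fun I01 f -> (forall t, E N t -> `|f t| <= M) ->
    measurable_fun I01 (fun t => \1_(E N) t * f t) /\
    forall t, 0 <= t <= 1 -> `|\1_(E N) t * f t| <= `|M|.
  move=> mf fM; split; first exact: measurable_funM (mind N) mf.
  move=> t t01; have [Et|nEt] := pselect (E N t).
    by rewrite ind1// mul1r (le_trans (fM t Et))// ler_norm.
  by rewrite ind0// mul0r normr0.
have intEi N (f : R -> R) (M : R) : measurable_fun I01 f -> (forall t, E N t -> `|f t| <= M) ->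
    intg01 (fun t => \1_(E N) t * f t).
  by move=> mf fM; have [m1 b1] := intE N f M mf fM; exact: intg01_bounded b1.
have [B0 B00 HB0] := Hb N0.
pose m := prim (fun t => \1_(E N0) t * H t) 1 / e0.
pose K t := H t - m.
have mK : measurable_fun I01 K by apply: measurable_funB mH _; exact: measurable_cst.
have indi N : intg01 (\1_(E N) : R -> R).
  apply: (@intg01_bounded _ 1); first exact: mind.
  by move=> t _; rewrite indicE; case: (_ \in _); rewrite ?normr1 ?normr0.
have K0 : prim (fun t => \1_(E N0) t * K t) 1 = 0.
  rewrite (_ : (fun t => _) = (fun t => \1_(E N0) t * H t - m * \1_(E N0) t)); last first.
    by apply/funext => t; rewrite /K; ring.
  rewrite primB//; [|exact: intEi HB0|exact: intg01Z].
  by rewrite primZ// prim_ind /m divfK ?subrr// gt_eqF.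
exists m.
suff : {ae mu, forall t, forall N, (N0 <= N)%N -> E N t -> K t = 0}.
  apply: filterS => t Ht It; have [|N Et] := covE t; first by move: It; rewrite /= in_itv.
  have := Ht (maxn N0 N) (leq_maxl _ _) (ndE _ _ (leq_maxr _ _) _ Et).
  by rewrite /K /H; lra.
apply: ae_foralln => N.
have [NN|] := boolP (N0 <= N)%N; last by move=> _; apply: aeW => t.
have [B B0' HB] := Hb N.
have KB t : E N t -> `|K t| <= B + `|m|.
  by move=> Et; rewrite (le_trans (ler_normB _ _))// lerD2r HB.
have [m1 b1] := intE N K _ mK KB.
have KB0 t : E N0 t -> `|K t| <= B + `|m| by move=> /(ndE _ _ NN); exact: KB.
pose k := prim (fun t => \1_(E N) t * K t) 1 / e0.
pose psi t := \1_(E N) t * K t - k * \1_(E N0) t.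
have i1 : intg01 (fun t => \1_(E N) t * K t) by exact: intEi KB.
have psi0 : prim psi 1 = 0.
  rewrite /psi primB//; last exact: intg01Z.
  by rewrite primZ// prim_ind /k divfK ?subrr// gt_eqF.
have psiM t : 0 <= t <= 1 -> `|psi t| <= `|B + `|m| | + `|k|.
  move=> t01; rewrite (le_trans (ler_normB _ _))// lerD// ?b1//.
  by rewrite normrM ler_piMr// indicE; case: (_ \in _); rewrite ?normr1 ?normr0.
have mpsi : measurable_fun I01 psi.
  by apply: measurable_funB m1 _; apply: measurable_funM (mind N0); exact: measurable_cst.
have psiE t : ~ E N t -> psi t = 0.
  move=> nEt; rewrite /psi ind0// mul0r ind0 ?mulr0 ?subrr//.
  by move=> /(ndE _ _ NN).
have Hpsi := key N psi _ mpsi psiM psiE psi0.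
have psii : intg01 psi by exact: intg01_bounded psiM.
have m2 : measurable_fun I01 (fun t => K t ^+ 2).
  by apply: measurable_funX.
have KB2 t : E N t -> `|K t ^+ 2| <= (B + `|m|) ^+ 2.
  move=> Et; rewrite normrX ler_pXn2r// ?nnegrE ?KB//.
  by rewrite addr_ge0.
have i2 : intg01 (fun t => \1_(E N) t * K t ^+ 2) by exact: intEi KB2.
have i3 : intg01 (fun t => \1_(E N0) t * K t) by exact: intEi KB0.
(* The correction term drops out because [K] has mean zero over [E N0]. *)
have Kpsi : prim (fun t => \1_(E N) t * K t ^+ 2) 1 = 0.
  rewrite (_ : (fun t => _) = (fun t => (H t * psi t - m * psi t) +
     k * (\1_(E N0) t * K t))); last first.
    by apply/funext => t; rewrite /psi /K; ring.
  have i4 : intg01 (fun t => H t * psi t).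
    rewrite (_ : (fun t => _) = (fun t => (\1_(E N) t * K t ^+ 2 - k * (\1_(E N0) t * K t))
     + m * psi t)); last by apply/funext => t; rewrite /psi /K; ring.
    by apply: intg01D; [apply: intg01B => //|]; exact: intg01Z.
  rewrite primD//; [|by apply: intg01B => //; exact: intg01Z|exact: intg01Z].
  rewrite primB//; last exact: intg01Z.
  by rewrite !primZ// Hpsi psi0 K0 !mulr0 subr0 addr0.
have nn t : 0 <= \1_(E N) t * K t ^+ 2 by rewrite mulr_ge0 ?sqr_ge0.
have := (ae_eq_integral_abs mu measurable_I01 (measurable_int _ i2)).1.
move=> /(_ _); case.
  transitivity (\int[mu]_(x in I01) (\1_(E N) x * K x ^+ 2)%:E)%E.
    by apply: eq_integral => t _ /=; rewrite ger0_norm.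
  have fi := integrable_fin_num measurable_I01 i2.
  by rewrite -[LHS]fineK//; congr EFin.
move=> Z [mZ Z0 ZE]; exists Z; split => // t /= nt; apply: ZE => /= Ht.
apply: nt => _ Et; have := Ht (EI _ _ Et); rewrite /= ind1// mul1r => -[] /eqP.
by rewrite sqrf_eq0 => /eqP.
Qed.

End by_parts.

(** * Consequences of the mean value theorem *)

Section real_calculus.
Variable R : realType.

Lemma is_derive_continuous (f : R -> R) (t d : R) : is_derive t 1 f d -> {for t, continuous f}.
Proof.
by move=> [df _]; apply/differentiable_continuous/derivable1_diffP.
Qed.

Lemma is_derive_scale (k s : R) : is_derive s 1 (fun s => k * s) k.
Proof.
have := @is_deriveZ _ _ _ id k s 1 1 (is_derive_id _ _).
by rewrite /GRing.scale/= mulr1.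
Qed.

Lemma derive_le0_le (f df : R -> R) (a b : R) : a <= b ->
  (forall s, a < s < b -> is_derive s 1 f (df s)) ->
  {within `[a, b], continuous f} ->
  (forall s, a < s < b -> df s <= 0) -> f b <= f a.
Proof.
rewrite le_eqVlt => /predU1P[->//|ab] fd fc d0.
have fd' s : s \in `]a, b[ -> is_derive s 1 f (df s) by rewrite in_itv/=; exact: fd.
have [c] := MVT ab fd' fc; rewrite in_itv/= => acb fE.
by rewrite -subr_le0 fE mulr_le0_ge0// ?d0// subr_ge0 ltW.
Qed.

Lemma derive_norm_le (f df : R -> R) (a b B : R) : a <= b ->
  (forall s, a < s < b -> is_derive s 1 f (df s)) ->
  {within `[a, b], continuous f} ->
  (forall s, a < s < b -> `|df s| <= B) -> `|f b - f a| <= B * (b - a).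
Proof.
rewrite le_eqVlt => /predU1P[->|ab] fd fc dB; first by rewrite !subrr normr0 mulr0.
have fd' s : s \in `]a, b[ -> is_derive s 1 f (df s) by rewrite in_itv/=; exact: fd.
have [c] := MVT ab fd' fc; rewrite in_itv/= => acb ->.
by rewrite normrM (gtr0_norm (_ : 0 < b - a)) ?subr_gt0// ler_pM2r ?subr_gt0// dB.
Qed.

Lemma gronwall (f df : R -> R) (k : R) :
  (forall s : R, is_derive s 1 f (df s)) -> (forall s, df s <= k * f s) ->
  f 1 <= expR k * f 0.
Proof.
move=> fd fk.
pose e s : R := expR (- k * s).
have ed s : is_derive s (1 : R) e (- k * e s).
  have d1 : is_derive s (1:R) (fun s : R => - k * s) (- k).
    exact: is_derive_scale.
  have := @is_derive1_comp _ expR (fun s : R => - k * s) s _ _ (is_derive_expR _) d1.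
  by rewrite mulrC.
have gd s : is_derive s (1 : R) (fun s => f s * e s) (f s * (- k * e s) + e s * df s).
  exact: is_deriveM (fd s) (ed s).
have := @derive_le0_le _ _ 0 1 ler01 (fun s _ => gd s).
have e0 : e 0 = 1 by rewrite /e mulr0 expR0.
have e1 : e 1 = (expR k)^-1 by rewrite /e mulr1 expRN.
rewrite e0 e1 mulr1 => H.
rewrite mulrC -ler_pdivrMr ?expR_gt0//; apply: H.
- by apply: continuous_subspaceT => s; exact: is_derive_continuous (gd s).
- move=> s _; have := fk s; have : 0 < e s by exact: expR_gt0.
  by rewrite -/(e s); nra.
Qed.

End real_calculus.

(** * Partial derivatives of the Lagrangian *)

Section lagrangian.
Variables (R : realType) (n : nat) (L : R -> 'rV[R]_n -> 'rV[R]_n -> R).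
Let F := fun p : R * 'rV[R]_n * 'rV[R]_n => L p.1.1 p.1.2 p.2.
Hypothesis hF : continuously_differentiable F.

Definition grad_x t x u : 'rV[R]_n := grad (fun y => L t y u) x.
Definition deriv_t t x u : R := derive1 (fun s : R => L s x u) t.

(** A constant of its own keeps the differential from being unfolded when
    rewriting. *)
Definition dL (p v : R * 'rV[R]_n * 'rV[R]_n) : R := 'd F p v.

Lemma tripleD (a a' : R) (b b' c c' : 'rV[R]_n) :
  (a, b, c) + (a', b', c') = (a + a', b + b', c + c').
Proof. by []. Qed.

Lemma tripleZ (k a : R) (b c : 'rV[R]_n) : k *: (a, b, c) = (k * a, k *: b, k *: c).
Proof. by []. Qed.

Lemma dLD p v w : dL p (v + w) = dL p v + dL p w.
Proof. by rewrite /dL linearD. Qed.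

Lemma dLZ p k v : dL p (k *: v) = k * dL p v.
Proof. by rewrite /dL linearZ. Qed.

Lemma dL0 p : dL p (0, 0, 0) = 0.
Proof. by rewrite /dL; exact: linear0. Qed.

Lemma dLE p v : dL p v = 'D_v F p.
Proof. by rewrite /dL -deriveE//; exact: hF.1. Qed.

Lemma dL_continuous v : continuous (fun p => dL p v).
Proof. exact: hF.2. Qed.

Lemma lagrangian_continuous : continuous F.
Proof. by move=> p; apply: differentiable_continuous; exact: (hF.1 p). Qed.

Lemma line_is_derive (p v : R * 'rV[R]_n * 'rV[R]_n) (s : R) :
  is_derive s 1 (fun s => F (p + s *: v)) (dL (p + s *: v) v).
Proof.
have dF := diff_derivable (v := v) (hF.1 (p + s *: v)).
have E : (fun h : R => h^-1 *: (((fun s => F (p + s *: v)) \o shift s) (h *: 1) - F (p + s *: v))) =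
  (fun h : R => h^-1 *: ((F \o shift (p + s *: v)) (h *: v) - F (p + s *: v))).
  apply/funext => h /=; congr (_ *: (F _ - _)).
  by rewrite [h *: 1]mulr1 scalerDl addrCA.
by apply: DeriveDef; rewrite ?dLE ?/derivable ?/derive E.
Qed.

Lemma line_bound (p v : R * 'rV[R]_n * 'rV[R]_n) (e B : R) : 0 <= e ->
  (forall s, 0 < s < e -> `|dL (p + s *: v) v| <= B) ->
  `|F (p + e *: v) - F p| <= B * e.
Proof.
move=> e0 H.
have := @derive_norm_le R (fun s => F (p + s *: v)) _ 0 e B e0 (fun s _ => line_is_derive p v s).
rewrite scale0r addr0 subr0; apply => //.
by apply: continuous_subspaceT => s; exact: is_derive_continuous (line_is_derive p v s).
Qed.

Lemma dotv_delta (w : 'rV[R]_n) i : dotv w (delta_mx 0 i) = w 0 i.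
Proof.
rewrite /dotv (bigD1 i)//= big1 ?addr0; first by rewrite mxE !eqxx mulr1.
by move=> j ji; rewrite mxE (negPf ji) andbF mulr0.
Qed.

Lemma dL_u t x u v : dL (t, x, u) (0, 0, v) = dotv (grad_u L t x u) v.
Proof.
have E w : dL (t, x, u) (0, 0, w) = 'D_w (L t x) u.
  have E1 : (fun h : R => h^-1 *: ((F \o shift (t, x, u)) (h *: ((0, 0,
    w) : R * 'rV[R]_n * 'rV[R]_n)) - F (t, x, u))) =
    (fun h => h^-1 *: ((L t x \o shift u) (h *: w) - L t x u)).
    by apply/funext => h; rewrite /F/= !scaler0 !add0r.
  by rewrite dLE /derive E1.
rewrite [in LHS](row_sum_delta v).
rewrite (big_morph (fun w => dL (t, x, u) (0, 0, w)) (id1 := 0) (op1 := +%R)); last 2 first.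
- by move=> y z; rewrite -dLD tripleD !addr0.
- exact: dL0.
apply: eq_bigr => i _; rewrite mxE -E mulrC -dLZ tripleZ mulr0 scaler0//.
Qed.

Lemma dL_x t x u v : dL (t, x, u) (0, v, 0) = dotv (grad_x t x u) v.
Proof.
have E w : dL (t, x, u) (0, w, 0) = 'D_w (fun y => L t y u) x.
  have E1 : (fun h : R => h^-1 *: ((F \o shift (t, x, u)) (h *: ((0, w,
    0) : R * 'rV[R]_n * 'rV[R]_n)) - F (t, x, u))) =
    (fun h => h^-1 *: (((fun y => L t y u) \o shift x) (h *: w) - L t x u)).
    by apply/funext => h; rewrite /F/= !scaler0 !add0r.
  by rewrite dLE /derive E1.
rewrite [in LHS](row_sum_delta v).
rewrite (big_morph (fun w => dL (t, x, u) (0, w, 0)) (id1 := 0) (op1 := +%R)); last 2 first.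
- by move=> y z; rewrite -dLD tripleD !addr0.
- exact: dL0.
apply: eq_bigr => i _; rewrite mxE -E mulrC -dLZ tripleZ mulr0 scaler0//.
Qed.

Lemma dL_t t x u s : dL (t, x, u) (s, 0, 0) = s * deriv_t t x u.
Proof.
have E : dL (t, x, u) (1, 0, 0) = deriv_t t x u.
  have E1 : (fun h : R => h^-1 *: ((F \o shift (t, x, u)) (h *: ((1, 0,
    0) : R * 'rV[R]_n * 'rV[R]_n)) - F (t, x, u))) =
    (fun h => h^-1 *: (((fun s => L s x u) \o shift t) (h *: 1) - L t x u)).
    by apply/funext => h; rewrite /F/= !scaler0 !add0r.
  by rewrite dLE /deriv_t derive1E /derive E1.
by rewrite -E -dLZ tripleZ mulr1 !scaler0.
Qed.

Lemma dL_split t x u s y v : dL (t, x, u) (s, y, v) =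
  s * deriv_t t x u + dotv (grad_x t x u) y + dotv (grad_u L t x u) v.
Proof. by rewrite -dL_t -dL_x -dL_u -!dLD !tripleD !addr0 !add0r. Qed.

Lemma grad_u_continuous i : continuous (fun p : R * 'rV[R]_n * 'rV[R]_n => grad_u L p.1.1 p.1.2
  p.2 0 i).
Proof.
rewrite (_ : (fun _ => _) = (fun p => dL p (0, 0, delta_mx 0 i))); first exact: dL_continuous.
by apply/funext => -[[t x] u]; rewrite dL_u /= dotv_delta.
Qed.

Lemma grad_x_continuous i : continuous (fun p : R * 'rV[R]_n * 'rV[R]_n => grad_x p.1.1 p.1.2 p.2
  0 i).
Proof.
rewrite (_ : (fun _ => _) = (fun p => dL p (0, delta_mx 0 i, 0))); first exact: dL_continuous.
by apply/funext => -[[t x] u]; rewrite dL_x /= dotv_delta.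
Qed.

Lemma deriv_t_continuous : continuous (fun p : R * 'rV[R]_n * 'rV[R]_n => deriv_t p.1.1 p.1.2 p.2).
Proof.
rewrite (_ : (fun _ => _) = (fun p => dL p (1, 0, 0))); first exact: dL_continuous.
by apply/funext => -[[t x] u]; rewrite dL_t mul1r.
Qed.

Lemma enorm_grad_tx t x u : enorm (grad_tx L t x u) ^+ 2 = deriv_t t x u ^+ 2 + enorm (grad_x t x
  u) ^+ 2.
Proof.
rewrite !enorm_sqr /dotv big_split_ord/= big_ord1; congr (_ + _).
  by rewrite /grad_tx row_mxEl mxE eqxx mulr1n expr2.
by apply: eq_bigr => i _; rewrite /grad_tx row_mxEr.
Qed.

Lemma deriv_t_le t x u : `|deriv_t t x u| <= enorm (grad_tx L t x u).
Proof.
rewrite -(ler_pXn2r (ltn0Sn 1)) ?nnegrE ?enorm_ge0// enorm_grad_tx.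
by rewrite -normrX ger0_norm ?sqr_ge0// lerDl sqr_ge0.
Qed.

Lemma grad_x_le t x u : enorm (grad_x t x u) <= enorm (grad_tx L t x u).
Proof.
rewrite -(ler_pXn2r (ltn0Sn 1)) ?nnegrE ?enorm_ge0// enorm_grad_tx.
by rewrite lerDr sqr_ge0.
Qed.

(** Along the segment from [x] to [x + y], the function [L + delta / xi]
    satisfies [f' <= xi |y| f] by [condC3]. *)
Lemma gronwall_x (xi delta : R) : condC3 L xi delta -> forall t x u y,
  L t (x + y) u + delta / xi <= expR (xi * enorm y) * (L t x u + delta / xi).
Proof.
move=> [xi0 delta0 C3] t x u y.
pose p : R * 'rV[R]_n * 'rV[R]_n := (t, x, u); pose v : R * 'rV[R]_n * 'rV[R]_n := (0, y, 0).
have pv s : p + s *: v = (t, x + s *: y, u) by rewrite /p /v tripleZ tripleD mulr0 scaler0 !addr0.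
have := @gronwall R (fun s => F (p + s *: v) + delta / xi) (fun s => dotv (grad_x t (x + s *: y)
  u) y)
  (xi * enorm y).
rewrite !pv scale1r scale0r addr0 /F/=; apply.
  move=> s; have d1 := line_is_derive p v s; rewrite pv dL_x in d1.
  have d2 : is_derive s (1 : R) (fun=> delta / xi) 0 by exact: is_derive_cst.
  by have := is_deriveD d1 d2; rewrite addr0.
move=> s; have -> : u + s *: 0 = u by rewrite scaler0 addr0.
have -> : t + s *: 0 = t by rewrite scaler0 addr0.
rewrite (le_trans (dotv_le _ _))//.
rewrite [leRHS]mulrAC mulrDr (mulrCA xi) divff ?gt_eqF// mulr1 ler_wpM2r ?enorm_ge0//.
exact: le_trans (grad_x_le _ _ _) (C3 _ _ _).
Qed.

Lemma compact_bound (h : R * 'rV[R]_n * 'rV[R]_n -> R) (r : R) : continuous h ->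
  exists M, forall t x u, `|t| <= r -> `|x| <= r -> `|u| <= r -> `|h (t, x, u)| <= M.
Proof.
move=> ch; have [r0|r0] := ltP r 0.
  exists 0 => t x u tr; exfalso; move: r0; rewrite ltNge => /negP; apply.
  exact: le_trans tr.
pose B := [set x : 'rV[R]_n | `|x| <= r].
have cB : compact B.
  apply: bounded_closed_compact.
    by exists r; split; [exact: num_real|move=> M rM x /= xr; exact: le_trans xr (ltW rM)].
  have -> : B = (fun x : 'rV[R]_n => `|x|) @^-1` [set y : R | y <= r] by [].
  by apply: closed_comp => [x _|]; [exact: norm_continuous|exact: closed_le].
have cA : compact ((`[- r, r]%classic `*` B) `*` B).
  by apply: compact_setX => //; apply: compact_setX => //; exact: segment_compact.
have [||p _ hp] := @compact_EVT_max _ R (fun p => `|h p|) _ _ cA.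
- by exists (0, 0, 0) => /=; rewrite /B/= !normr0 !in_itv/= oppr_le0 r0.
- by apply: continuous_subspaceT => p; apply: continuous_comp; [exact: ch|exact: norm_continuous].
exists `|h p| => t x u tr xr ur; apply: (hp (t, x, u)); rewrite inE; do !split => //=.
by rewrite in_itv/= -ler_norml.
Qed.

End lagrangian.

(** * The Euler-Lagrange equation *)

Section euler_lagrange.
Variables (R : realType) (n : nat) (L : R -> 'rV[R]_n -> 'rV[R]_n -> R).
Notation mu := (@lebesgue_measure R).
Notation I01 := (`[0%R, 1%R]%classic : set R).
Let F := fun p : R * 'rV[R]_n * 'rV[R]_n => L p.1.1 p.1.2 p.2.
Hypothesis hF : continuously_differentiable F.
Variables (xi delta : R).
Hypothesis C3 : condC3 L xi delta.
Hypothesis Lpos : forall t x u, 0 < L t x u.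
Variable g : R -> 'rV[R]_n.
Hypothesis gi : vintg01 g.
Notation X := (vprim g).
Hypothesis Li : intg01 (fun t => L t (X t) (g t)).

Lemma vprim_measurable i : measurable_fun I01 (fun t => X t 0 i).
Proof.
rewrite (_ : (fun t => _) = prim (fun s => g s 0 i)); last by apply/funext => t; rewrite mxE.
exact: (within_continuous_measurable (prim_continuous (gi i))).
Qed.

Lemma vprim_bounded : exists2 B, 0 <= B & forall t, 0 <= t <= 1 -> `|X t| <= B.
Proof.
exists (\sum_i prim (fun s => `|g s 0 i|) 1).
  apply: sumr_ge0 => i _; apply: le_trans (prim_bounded (gi i) (t := 1) _) => //.
  by rewrite ler01 lexx.
move=> t t01; rewrite (le_trans (norm_le_enorm _))// (le_trans (enorm_le_sum _))//.
by apply: ler_sum => i _; rewrite mxE; exact: prim_bounded.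
Qed.

Lemma along_measurable (H : R * 'rV[R]_n * 'rV[R]_n -> R) (y w : R -> 'rV[R]_n) : continuous H ->
  (forall i, measurable_fun I01 (fun t => y t 0 i)) ->
  (forall i, measurable_fun I01 (fun t => w t 0 i)) ->
  measurable_fun I01 (fun t => H (t, y t, w t)).
Proof.
move=> cH my mw; exact: measurable_continuous_comp.
Qed.

Lemma g_measurable i : measurable_fun I01 (fun t => g t 0 i).
Proof. exact: intg01_measurable. Qed.

(** The derivative [g] is merely integrable, so variations of the velocity are
    confined to the times where it is bounded; there the derivatives of [L] are
    bounded too. These sets exhaust [0, 1]. *)
Definition slow N : set R := [set t | I01 t /\ `|g t| <= N%:R].

Lemma slow_measurable N : measurable (slow N : set (measurableTypeR R)).
Proof.
have m1 : measurable_fun I01 (fun t => `|g t|).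
  apply: (@along_measurable (fun p => `|p.2|) g g); [|exact: g_measurable..].
  by move=> p; apply: continuous_comp; [exact: cvg_snd|exact: norm_continuous].
rewrite (_ : slow N = I01 `&` (fun t => `|g t|) @^-1` `]-oo, N%:R]%classic).
  by apply: m1; [exact: measurable_I01'|exact: measurable_itv].
by apply/seteqP; split => t /=; rewrite [_ \in `]-oo, _]]in_itv/=.
Qed.

Lemma enorm_delta i : enorm (delta_mx 0 i : 'rV[R]_n) = 1.
Proof. by rewrite /enorm dotv_delta mxE !eqxx sqrtr1. Qed.

(** Outside [slow N] only the position is varied, and there [condC3] with
    [gronwall_x] bounds the difference quotients by a multiple of
    [L + delta / xi], which is integrable along the minimizer. *)
Lemma shifted_L_le t x u (i : 'I_n) (phi Phi s : R) : `|phi| <= Phi -> 0 <= s <= 1 ->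
  `|dL L (t, x + s *: (phi *: delta_mx 0 i), u) (0, phi *: delta_mx 0 i, 0)| <=
  Phi * (xi * (expR (xi * Phi) * (L t x u + delta / xi))).
Proof.
move=> phiP /andP[s0 s1]; have [xi0 delta0 H3] := C3.
have Phi0 : 0 <= Phi by exact: le_trans phiP.
set y := s *: _.
rewrite (dL_x hF) dotvZr dotv_delta normrM ler_pM//.
apply: (le_trans (coord_le_enorm _ _)).
apply: (le_trans (grad_x_le _ _ _ _)); apply: (le_trans (H3 _ _ _)).
rewrite (_ : xi * _ + _ = xi * (L t (x + y) u + delta / xi)); last first.
  by rewrite mulrDr (mulrCA xi) divff ?gt_eqF// mulr1.
rewrite ler_wpM2l ?(ltW xi0)//; apply: (le_trans (gronwall_x hF C3 _ _ _ _)).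
rewrite ler_wpM2r//; first by apply: addr_ge0; [exact: ltW|apply: divr_ge0; exact: ltW].
rewrite ler_expR ler_wpM2l ?(ltW xi0)// /y !enormZ enorm_delta mulr1 (ger0_norm s0).
by rewrite (le_trans _ phiP)// ler_piMl.
Qed.

Hypothesis opt : forall g2 : R -> 'rV[R]_n, vintg01 g2 -> vprim g2 1 = vprim g 1 ->
  (\int[mu]_(t in I01) (L t (X t) (g t))%:E <= \int[mu]_(t in I01) (L t (vprim g2 t) (g2 t))%:E)%E.

(** The competitors are the primitives of [g + eps * psi] in the coordinate
    [i]; they keep the end point because [psi] has mean zero. The difference
    quotients [f k] of the integrand have nonnegative integrals and converge
    pointwise to the derivative of [L] in the direction [v t]. They are
    dominated by [G]: a constant on [slow N] by compactness, and a multiple of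
    [L + delta / xi] elsewhere by [shifted_L_le]. *)
Lemma first_variation_ge0 i N (psi : R -> R) (M : R) :
  measurable_fun I01 psi -> (forall t, 0 <= t <= 1 -> `|psi t| <= M) ->
  (forall t, ~ slow N t -> psi t = 0) -> prim psi 1 = 0 ->
  let h t := grad_x L t (X t) (g t) 0 i * prim psi t + grad_u L t (X t) (g t) 0 i * psi t in
  intg01 h /\ 0 <= prim h 1.
Proof.
move=> mpsi psiM psi0 p0 /=.
have T1 : (0 : R) <= (1 : R) <= 1 by rewrite ler01 lexx.
have [xi0 delta0 H3] := C3.
have M0 : 0 <= M by exact: le_trans (psiM 1 T1).
have psii : intg01 psi by exact: intg01_bounded psiM.
pose ei : 'rV[R]_n := delta_mx 0 i.
pose Phi := prim (fun s => `|psi s|) 1.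
have phiP t : 0 <= t <= 1 -> `|prim psi t| <= Phi by exact: prim_bounded.
have Phi0 : 0 <= Phi by exact: le_trans (phiP 1 T1).
pose p t : R * 'rV[R]_n * 'rV[R]_n := (t, X t, g t).
pose v t : R * 'rV[R]_n * 'rV[R]_n := (0, prim psi t *: ei, psi t *: ei).
pose eps (k : nat) : R := k.+1%:R^-1.
have eps0 k : 0 < eps k by rewrite invr_gt0 ltr0n.
have eps1 k : eps k <= 1 by rewrite invf_le1 ?ltr0n// ler1n.
have pvE t s : p t + s *: v t = (t, X t + s *: (prim psi t *: ei), g t + s *: (psi t *: ei)).
  by rewrite /p /v tripleZ tripleD mulr0 addr0.
pose f k t := (F (p t + eps k *: v t) - F (p t)) / eps k.
have mpp : measurable_fun I01 (prim psi).
  exact: (within_continuous_measurable (prim_continuous psii)).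
have mshift (s : R) : measurable_fun I01 (fun t => F (p t + s *: v t)).
  rewrite (_ : (fun t => _) = (fun t => F (t, X t + s *: (prim psi t *: ei),
    g t + s *: (psi t *: ei)))); last first.
    by apply/funext => t; rewrite pvE.
  apply: (along_measurable (lagrangian_continuous hF)) => j.
    rewrite (_ : (fun t => _) = (fun t => X t 0 j + (s * ei 0 j) * prim psi t)); last first.
      by apply/funext => t; rewrite !mxE; ring.
    apply: measurable_funD; first exact: vprim_measurable.
    by apply: measurable_funM => //; exact: measurable_cst.
  rewrite (_ : (fun t => _) = (fun t => g t 0 j + (s * ei 0 j) * psi t)); last first.
    by apply/funext => t; rewrite !mxE; ring.
  apply: measurable_funD; first exact: g_measurable.
  by apply: measurable_funM => //; exact: measurable_cst.
have mp0 : measurable_fun I01 (fun t => F (p t)) := intg01_measurable Li.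
have mf k : measurable_fun I01 (f k).
  apply: measurable_funM; last exact: measurable_cst.
  exact: measurable_funB (mshift _) mp0.
have [XB XB0 hXB] := vprim_bounded.
pose r : R := 1 + XB + Phi * `|ei| + N%:R + M * `|ei|.
have [K1 hK1] := compact_bound r (dL_continuous (v := (0, ei, 0)) hF).
have [K2 hK2] := compact_bound r (dL_continuous (v := (0, 0, ei)) hF).
pose K : R := Phi * `|K1| + M * `|K2|.
pose C := Phi * xi * expR (xi * Phi).
have C0 : 0 <= C by rewrite /C !mulr_ge0 ?expR_ge0// ltW.
have K0 : 0 <= K by rewrite addr_ge0// mulr_ge0.
pose G t := K + C * (L t (X t) (g t) + delta / xi).
have Gi : intg01 G.
  apply: intg01D; first exact: intg01_cst.
  by apply: intg01Z; apply: intg01D => //; exact: intg01_cst.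
have Ld t : 0 <= L t (X t) (g t) + delta / xi by apply: addr_ge0; [exact: ltW|apply: divr_ge0;
  exact: ltW].
have vsplit t : v t = prim psi t *: ((0, ei, 0) : R * 'rV[R]_n * 'rV[R]_n) +
    psi t *: ((0, 0, ei) : R * 'rV[R]_n * 'rV[R]_n).
  by rewrite /v !tripleZ tripleD !scaler0 !mulr0 !addr0 add0r.
have dLbound t s : 0 <= t <= 1 -> 0 <= s <= 1 -> `|dL L (p t + s *: v t) (v t)| <= G t.
  move=> t01 /andP[s0 s1]; have [Et|nEt] := pselect (slow N t).
    apply: (@le_trans _ _ K); last by rewrite lerDl mulr_ge0.
    rewrite {2}vsplit dLD !dLZ (le_trans (ler_normD _ _))// !normrM pvE.
    have b1 : `|t| <= r.
      by move/andP: t01 => [t0 t1];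
        rewrite ger0_norm// /r (le_trans t1)// -!addrA lerDl !addr_ge0// mulr_ge0.
    have b2 : `|X t + s *: (prim psi t *: ei)| <= r.
      rewrite (le_trans (ler_normD _ _))// (@le_trans _ _ (XB + Phi * `|ei|))//.
        rewrite lerD ?hXB// !normrZ (ger0_norm s0) mulrA ler_wpM2r//.
        by rewrite (le_trans _ (phiP t t01))// ler_piMl.
      rewrite /r; have : 0 <= M * `|ei| by rewrite mulr_ge0.
      have : (0 : R) <= N%:R by [].
      by lra.
    have b3 : `|g t + s *: (psi t *: ei)| <= r.
      rewrite (le_trans (ler_normD _ _))// (@le_trans _ _ (N%:R + M * `|ei|))//.
        rewrite lerD ?Et.2// !normrZ (ger0_norm s0) mulrA ler_wpM2r//.
        by rewrite (le_trans _ (psiM t t01))// ler_piMl.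
      rewrite /r; have : 0 <= Phi * `|ei| by rewrite mulr_ge0.
      by lra.
    rewrite lerD// ler_pM// ?phiP// ?psiM//.
      by rewrite (le_trans (hK1 _ _ _ b1 b2 b3))// ler_norm.
    by rewrite (le_trans (hK2 _ _ _ b1 b2 b3))// ler_norm.
  have vE : v t = (0, prim psi t *: ei, 0) by rewrite /v psi0// scale0r.
  rewrite {2}vE pvE psi0// scale0r scaler0 addr0.
  apply: (le_trans (shifted_L_le _ _ _ _ (phiP t t01) _)); first by rewrite s0.
  by rewrite /G !mulrA lerDr.
have fG k t : 0 <= t <= 1 -> `|f k t| <= G t.
  move=> t01; rewrite /f normrM normfV (gtr0_norm (eps0 k)) ler_pdivrMr//.
  apply: (line_bound hF) => [|s /andP[s0 sk]]; first exact: ltW.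
  by apply: dLbound => //; rewrite ltW//= (le_trans (ltW sk)).
have G0 t : 0 <= G t by rewrite addr_ge0// mulr_ge0.
have fi k : intg01 (f k).
  by apply: (intg01_le (mf k) Gi) => t t01; rewrite (ger0_norm (G0 t)) fG.
have f0 k : 0 <= prim (f k) 1.
  pose g2 t := g t + eps k *: (psi t *: ei).
  have g2E j : (fun t => g2 t 0 j) = (fun t => g t 0 j + eps k * ei 0 j * psi t).
    by apply/funext => t; rewrite !mxE; ring.
  have g2i : vintg01 g2.
    by move=> j; rewrite g2E; apply: intg01D; [exact: (gi j)|exact: intg01Z].
  have vE t : 0 <= t <= 1 -> vprim g2 t = X t + eps k *: (prim psi t *: ei).
    move=> t01; apply/rowP => j; have h1 := gi j; have h2 := intg01Z (eps k * ei 0 j) psii.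
    rewrite !mxE g2E primD// primZ// /ei mxE; ring.
  have end1 : vprim g2 1 = vprim g 1 by rewrite vE// p0 scale0r scaler0 addr0.
  have := opt g2i end1.
  have L2i : intg01 (fun t => F (p t + eps k *: v t)).
    rewrite (_ : (fun t => _) = (fun t => L t (X t) (g t) + eps k * f k t)).
      by apply: intg01D => //; exact: intg01Z.
    by apply/funext => t; rewrite /f mulrC divfK ?gt_eqF//; rewrite /F/=; ring.
  rewrite [X in (_ <= X)%E -> _](_ : _ = \int[mu]_(t in I01) (F (p t + eps k *: v t))%:E)%E;
    last first.
    apply: eq_integral => t; rewrite inE/= in_itv/= => t01.
    by rewrite pvE /F/= vE.
  move=> le12.
  have : prim (fun t => F (p t)) 1 <= prim (fun t => F (p t + eps k *: v t)) 1.
    apply: fine_le; [exact: (integrable_fin_num (@measurable_I01 R) Li)|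
      exact: (integrable_fin_num (@measurable_I01 R) L2i)|exact: le12].
  rewrite -subr_ge0 -primB// => H.
  rewrite (_ : f k = (fun t => (eps k)^-1 * (F (p t + eps k *: v t) - F (p t)))); last first.
    by apply/funext => t; rewrite /f mulrC.
  rewrite primZ//; last by apply: intg01B => //.
  by rewrite mulr_ge0// invr_ge0 ltW.
pose fl t := dL L (p t) (v t).
have flE t : fl t = grad_x L t (X t) (g t) 0 i * prim psi t + grad_u L t (X t) (g t) 0 i * psi t.
  by rewrite /fl (dL_split hF) mul0r add0r !dotvZr !dotv_delta mulrC [X in _ + X]mulrC.
have -> : (fun t => grad_x L t (X t) (g t) 0 i * prim psi t + grad_u L t (X t) (g t) 0 i * psi t)
  = fl.
  by apply/funext => t; rewrite flE.
have cvgf t : f k t @[k --> \oo] --> fl t.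
  have := line_is_derive hF (p t) (v t) 0.
  rewrite scale0r addr0 => -[dv dE].
  have : (fun h : R => h^-1 *: (((fun s => F (p t + s *: v t)) \o shift 0) (h *: 1) - F (p t + 0
    *: v t))) @ 0^' --> fl t.
    by rewrite /fl -dE; exact: dv.
  move=> /cvgr_dnbhsP -/(_ eps) H.
  have E : (fun k => (eps k)^-1 *: (((fun s => F (p t + s *: v t)) \o shift 0) (eps k)%:A -
     F (p t + 0 *: v t))) = (fun k => f k t).
    by apply/funext => k; rewrite /f /= addr0 [(eps k)%:A]mulr1 scale0r addr0 mulrC.
  rewrite E in H; apply: H; split; first by move=> k; rewrite gt_eqF.
  exact: cvg_harmonic.
have mfl : measurable_fun I01 fl.
  rewrite (_ : fl = (fun t => grad_x L t (X t) (g t) 0 i * prim psi t + grad_u L t (X t) (g t) 0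
    i * psi t)); last by apply/funext => t; rewrite flE.
  apply: measurable_funD; apply: measurable_funM => //.
    apply: (@along_measurable (fun q => grad_x L q.1.1 q.1.2 q.2 0 i));
      [exact: grad_x_continuous|exact: vprim_measurable|exact: g_measurable].
  apply: (@along_measurable (fun q => grad_u L q.1.1 q.1.2 q.2 0 i));
    [exact: grad_u_continuous|exact: vprim_measurable|exact: g_measurable].
have [||iH _ H] := @dominated_convergence _ _ _ mu I01 (@measurable_I01 R) (fun k => EFin \o f k)
  (EFin \o fl) (EFin \o G)
  (fun k => measurable_int _ (fi k)) ((measurable_EFinP _ _).2 mfl) _ Gi _.
- by apply: aeW => t _; apply/cvg_EFin; [near=> k|exact: cvgf].
- by apply: aeW => t k /=; rewrite in_itv/= => t01; rewrite lee_fin fG.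
split; first exact: iH.
rewrite /prim /Rintegral fine_ge0//.
have -> : (\int[mu]_(x in I01) (fl x)%:E)%E = limn (fun k => \int[mu]_(x in I01) (f k x)%:E)%E.
  by apply/esym/cvg_lim => //; exact: H.
apply: lime_ge; first by apply/cvg_ex; eexists; exact: H.
apply: nearW => k.
have fk := integrable_fin_num (@measurable_I01 R) (fi k).
by rewrite -(fineK fk) lee_fin; exact: f0.
Unshelve. all: by end_near. Qed.

(** Both [psi] and [- psi] are admissible variations. *)
Lemma euler_lagrange_test i N (psi : R -> R) (M : R) :
  measurable_fun I01 psi -> (forall t, 0 <= t <= 1 -> `|psi t| <= M) ->
  (forall t, ~ slow N t -> psi t = 0) -> prim psi 1 = 0 ->
  prim (fun t => grad_x L t (X t) (g t) 0 i * prim psi t + grad_u L t (X t) (g t) 0 i * psi t) 1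
    = 0.
Proof.
move=> mpsi psiM psi0 p0.
have T1 : (0 : R) <= (1 : R) <= 1 by rewrite ler01 lexx.
have psii : intg01 psi by exact: intg01_bounded psiM.
have [hi h0] := first_variation_ge0 i mpsi psiM psi0 p0.
have pN t : 0 <= t <= 1 -> prim (fun s => -1 * psi s) t = - prim psi t.
  by move=> t01; rewrite primZ// mulN1r.
have := @first_variation_ge0 i N (fun s => -1 * psi s) M.
case.
- by apply: measurable_funM => //; exact: measurable_cst.
- by move=> t t01; rewrite mulN1r normrN psiM.
- by move=> t nt; rewrite psi0// mulr0.
- by rewrite pN// p0 oppr0.
move=> _; rewrite [X in 0 <= X -> _](_ : _ =
  prim (fun t => -1 * (grad_x L t (X t) (g t) 0 i * prim psi t + grad_u L t (X t) (g t) 0 i * psi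
    t)) 1).
  by rewrite primZ// mulN1r oppr_ge0 => h1; apply/eqP; rewrite eq_le h1.
apply: eq_Rintegral => t; rewrite inE/= in_itv/= => t01; rewrite pN//; ring.
Qed.

(** Each coordinate of [grad_u L] and of [grad_x L] along the minimizer enters
    [du_bois_reymond] through [euler_lagrange_test]. *)
Lemma euler_lagrange : exists m : 'rV[R]_n, vintg01 (fun t => grad_x L t (X t) (g t)) /\
  {ae mu, forall t, I01 t ->
    grad_u L t (X t) (g t) = m + vprim (fun s => grad_x L s (X s) (g s)) t}.
Proof.
have [xi0 delta0 H3] := C3.
have aeF : Filter (almost_everywhere mu) by exact: (ae_filter_ringOfSetsType mu).
have li : vintg01 (fun t => grad_x L t (X t) (g t)).
  move=> i; apply: (@intg01_le _ _ (fun t => xi * L t (X t) (g t) + delta)).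
  - by apply: (@along_measurable (fun q => grad_x L q.1.1 q.1.2 q.2 0 i));
      [exact: grad_x_continuous|exact: vprim_measurable|exact: g_measurable].
  - by apply: intg01D; [exact: intg01Z|exact: intg01_cst].
  - move=> t _; rewrite [leRHS]ger0_norm; last by rewrite addr_ge0 ?mulr_ge0// ltW.
    exact: le_trans (coord_le_enorm _ _) (le_trans (grad_x_le _ _ _ _) (H3 _ _ _)).
have [XB XB0 hXB] := vprim_bounded.
have /choice[m mP] : forall i, exists m, {ae mu, forall t, I01 t ->
    grad_u L t (X t) (g t) 0 i = m + prim (fun s => grad_x L s (X s) (g s) 0 i) t}.
  move=> i; apply: (@du_bois_reymond _ _ _ slow).
  - exact: li.
  - by apply: (@along_measurable (fun q => grad_u L q.1.1 q.1.2 q.2 0 i));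
      [exact: grad_u_continuous|exact: vprim_measurable|exact: g_measurable].
  - exact: slow_measurable.
  - by move=> N N' NN t [It gN]; split => //; rewrite (le_trans gN)// ler_nat.
  - move=> t t01; exists (Num.truncn `|g t|).+1; split; first by rewrite /= in_itv.
    by rewrite ltW// truncnS_gt.
  - by move=> N t [].
  - move=> N; have [K hK] := compact_bound (1 + XB + N%:R) (grad_u_continuous (i := i) hF).
    exists K => t [It gN]; apply: hK => /=.
    + move: It; rewrite /= in_itv/= => /andP[t0 t1]; rewrite ger0_norm// (le_trans t1)//.
      by rewrite -addrA lerDl addr_ge0.
    + have t01 : 0 <= t <= 1 by move: It; rewrite /= in_itv.
      by rewrite (le_trans (hXB t t01))// -addrA addrCA lerDl addr_ge0.
    + by rewrite (le_trans gN)// lerDr addr_ge0.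
  - exact: euler_lagrange_test.
exists (\row_i m i); split => //.
have : {ae mu, forall t, forall i, I01 t ->
    grad_u L t (X t) (g t) 0 i = m i + prim (fun s => grad_x L s (X s) (g s) 0 i) t}.
  by apply: filter_forall => i; exact: mP.
by apply: filterS => t Ht It; apply/rowP => i; rewrite Ht// !mxE.
Qed.

End euler_lagrange.

(** * Continuity of curves and derivatives of their primitives *)

Section vector_continuity.
Variables (R : realType) (n : nat).

Lemma ac01_clamp_continuous (f : R -> R) : ac01 f -> continuous (fun t => f (clamp t)).
Proof.
move=> acf t; apply/cvgrPdist_le => e e0; have [d d0 H] := acf e e0.
have key s s' : s <= s' -> s' - s < d -> `|f (clamp s') - f (clamp s)| < e.
  move=> ss' sd; have := H 'I_1 (fun=> clamp s) (fun=> clamp s').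
  rewrite !big_ord1; apply.
  - by move=> _; rewrite clamp_ge0 clamp_le1 le_clamp.
  - by move=> i j _ _ _; rewrite !ord1.
  - exact: le_lt_trans (clamp_sub ss') sd.
near=> s; have sd : `|t - s| < d by near: s; exact: cvgr_dist_lt.
have [ts|st] := leP t s.
  by rewrite distrC ltW// key// (le_lt_trans (ler_norm _))// distrC.
by rewrite ltW// key ?(ltW st)// (le_lt_trans (ler_norm _)).
Unshelve. all: by end_near. Qed.

Lemma row_subE (u v : 'rV[R]_n) i : (u - v) 0 i = u 0 i - v 0 i.
Proof. by rewrite !mxE. Qed.

Lemma dotv_continuous_at (T : topologicalType) (f h : T -> 'rV[R]_n) (z : T) :
  (forall i, {for z, continuous (fun w => f w 0 i)}) ->
  (forall i, {for z, continuous (fun w => h w 0 i)}) ->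
  {for z, continuous (fun w => dotv (f w) (h w))}.
Proof.
move=> cf ch.
have H (s : seq 'I_n) : {for z, continuous (fun w => \sum_(i <- s) f w 0 i * h w 0 i)}.
  elim: s => [|i s IHs].
    rewrite (_ : (fun _ => _) = (fun=> 0)); last by apply/funext => w; rewrite big_nil.
    exact: cst_continuous.
  rewrite (_ : (fun _ => _) = (fun w => f w 0 i * h w 0 i + \sum_(i <- s) f w 0 i * h w 0 i));
    last first.
    by apply/funext => w; rewrite big_cons.
  exact: (cvgD (cvgM (cf i) (ch i)) IHs).
exact: H.
Qed.

Lemma dotv_continuous (q : 'rV[R]_n) : continuous (dotv q).
Proof.
move=> v; apply: dotv_continuous_at => i; first exact: cst_continuous.
exact: coord_continuous.
Qed.

Lemma rV_continuous (f : R -> 'rV[R]_n) : (forall i, continuous (fun t => f t 0 i)) -> continuous f.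
Proof.
move=> cf t; apply/cvgrPdist_le => e e0.
have H0 i : \forall s \near t, `|f t 0 i - f s 0 i| <= e.
  by move: (cf i t) => /cvgrPdist_le; exact.
have := @filter_forall _ _ (fun i s => `|f t 0 i - f s 0 i| <= e) _ (nbhs_filter t) H0.
apply: filterS => s H; rewrite [leLHS]mx_normrE; apply/bigmax_leP; split; first exact: ltW.
by move=> [i j] _ /=; rewrite (ord1 i) !mxE.
Qed.

Lemma triple_continuous (T : topologicalType) (H : R * 'rV[R]_n * 'rV[R]_n -> R)
  (r : T -> R) (x u : T -> 'rV[R]_n) :
  continuous H -> continuous r -> continuous x -> continuous u ->
  continuous (fun t => H (r t, x t, u t)).
Proof.
move=> cH cr cx cu t.
have c1 : (fun s => (r s, x s, u s)) @ t --> (r t, x t, u t).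
  apply: (@cvg_pair _ _ _ (nbhs t) (nbhs (r t, x t)) (nbhs (u t)) _ _ _ (fun s => (r s, x s)) u);
    last exact: cu.
  apply: (@cvg_pair _ _ _ (nbhs t) (nbhs (r t)) (nbhs (x t)) _ _ _ r x).
    exact: cr.
  exact: cx.
exact: (continuous_comp c1 (cH _)).
Qed.

Lemma prim_is_derive (w : R -> R) (t : R) : continuous w ->
  0 < t < 1 -> is_derive t 1 (prim w) (w t).
Proof.
move=> cw /andP[t0 t1].
have wi : intg01 w by exact/intg01_continuous/continuous_subspaceT/cw.
have [dp pE] := @continuous_FTC1 R w (BLeft 0) t 1 t1 wi t0 (cw t).
by apply: DeriveDef; [exact: dp|rewrite -derive1E; exact: pE].
Qed.

Lemma vprim_is_derive (u : R ->
  'rV[R]_n) (i : 'I_n) (t : R) : (forall i, continuous (fun t => u t 0 i)) ->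
  0 < t < 1 -> is_derive t 1 (fun s => vprim u s 0 i) (u t 0 i).
Proof.
move=> cu t01.
rewrite (_ : (fun s => _) = prim (fun s => u s 0 i)); last by apply/funext => s; rewrite mxE.
exact: (prim_is_derive (cu i) t01).
Qed.

End vector_continuity.

(** * Differentiating a maximum *)

Section envelope.
Variable R : realType.

Lemma is_derive_of_bound (p : R -> R) (t d : R) :
  (forall e : R, 0 < e -> \forall s \near t, `|p s - p t - d * (s - t)| <= e * `|s - t|) ->
  is_derive t 1 p d.
Proof.
move=> H.
have cvg : (fun h : R => h^-1 *: ((p \o shift t) (h *: 1) - p t)) @ 0^' --> d.
  apply/cvgrPdist_le => e e0.
  have [r /= r0 rH] := (nbhs_ballP _ _).1 (H e e0).
  near=> h.
  have h0 : h != 0 by near: h; exact: nbhs_dnbhs_neq.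
  have hr : `|h| < r by near: h; exact: dnbhs0_lt.
  have := rH (h + t).
  rewrite /= [h *: 1]mulr1 addrK /ball/= opprD addrCA subrr addr0 normrN => /(_ hr) Hh.
  rewrite distrC -(ler_pM2r (_ : 0 < `|h|)) ?normr_gt0//.
  rewrite -normrM mulrBl /GRing.scale/= mulrAC mulVf// mul1r.
  exact: Hh.
by apply: DeriveDef; [apply/cvg_ex; exists d|exact/cvg_lim].
Unshelve. all: by end_near. Qed.

(** If [E s r <= p s] with equality for [r = s], then
    [E s t - E t t <= p s - p t <= E s s - E t s], and by the mean value theorem
    both bounds are [d * (s - t)] up to a small multiple of [|s - t|] when the
    partial derivative [D] is close to [d] near [(t, t)]. This suits competitors
    indexed by a curve that is merely continuous in [r]. *)
Lemma envelope (p : R -> R) (E D : R -> R -> R) (a b t d : R) : a < t < b ->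
  (forall s r, a < s < b -> a < r < b -> E s r <= p s) ->
  (forall s, a < s < b -> E s s = p s) ->
  (forall s r, a < s < b -> a < r < b -> is_derive s 1 (fun s => E s r) (D s r)) ->
  (forall e : R, 0 < e -> exists2 eta : R, 0 < eta & forall s r,
     `|s - t| < eta -> `|r - t| < eta -> `|D s r - d| <= e) ->
  is_derive t 1 p d.
Proof.
move=> tab Ep EE ED Dc; apply: is_derive_of_bound => e e0.
have [eta eta0 H] := Dc e e0.
have key s r : a < s < b -> a < r < b -> `|s - t| < eta -> `|r - t| < eta ->
    `|E s r - E t r - d * (s - t)| <= e * `|s - t|.
  move=> sab rab st rt.
  pose f s := E s r - d * s.
  have fd x : a < x < b -> is_derive x 1 f (D x r - d).
    move=> xab; have d1 := ED x r xab rab.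
    have d2 : is_derive x (1:R) (fun s : R => d * s) d.
      exact: is_derive_scale.
    exact: is_deriveB d1 d2.
  have fc x y : a < x < b -> a < y < b -> {within `[x, y], continuous f}.
    move=> /andP[ax xb] /andP[ay yb]; apply: continuous_in_subspaceT => z.
    rewrite inE/= in_itv/= => /andP[xz zy]; apply: is_derive_continuous (fd z _).
    by rewrite (lt_le_trans ax)//= (le_lt_trans zy).
  have gen x y : a < x < b -> a < y < b -> x <= y -> `|x - t| < eta -> `|y - t| < eta ->
      `|f y - f x| <= e * (y - x).
    move=> xab yab xy xt yt; apply: (derive_norm_le xy _ (fc _ _ xab yab)).
      move=> z /andP[xz zy]; apply: fd; move: xab yab => /andP[ax _] /andP[_ yb].
      by rewrite (lt_trans ax)//= (lt_trans zy).
    move=> z /andP[xz zy]; apply: H => //.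
    move: xt yt; rewrite !ltr_norml => /andP[? ?] /andP[? ?]; apply/andP; split; lra.
  have tt : `|t - t| < eta by rewrite subrr normr0.
  have -> : E s r - E t r - d * (s - t) = f s - f t by rewrite /f; ring.
  have [ts|st'] := leP t s.
    by rewrite (ger0_norm (_ : 0 <= s - t)) ?subr_ge0//; exact: gen.
  rewrite distrC (distrC s) (gtr0_norm (_ : 0 < t - s)) ?subr_gt0//.
  by apply: gen => //; exact: ltW.
near=> s.
have sab : a < s < b.
  by apply/andP; split; near: s; [apply: lt_nbhsr|apply: lt_nbhsl]; by case/andP: tab.
have st : `|s - t| < eta.
  by rewrite distrC; near: s; exact: cvgr_dist_lt.
have tt : `|t - t| < eta by rewrite subrr normr0.
have k1 := key s t sab tab st tt; have k2 := key s s sab sab st st.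
have e1 := Ep s t sab tab; have e2 := Ep t s tab sab.
move: k1 k2; rewrite !EE// !ler_norml => /andP[? ?] /andP[? ?]; apply/andP; split; lra.
Unshelve. all: by end_near. Qed.

End envelope.

(** * The inverse of the velocity gradient *)

Section regularity.
Variables (R : realType) (n : nat) (L : R -> 'rV[R]_n -> 'rV[R]_n -> R).
Let F := fun p : R * 'rV[R]_n * 'rV[R]_n => L p.1.1 p.1.2 p.2.
Hypothesis hF : continuously_differentiable F.
Variables (kappa : R).
Hypothesis C2 : condC2 L kappa.

(** Add the strong convexity inequalities for [(u, v)] and [(v, u)] and apply
    Cauchy-Schwarz. *)
Lemma strong_monotone t x u v :
  kappa * enorm (u - v) <= enorm (grad_u L t x u - grad_u L t x v).
Proof.
have [k0 H] := C2.
have h1 := H t x u v; have h2 := H t x v u.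
have vu : v - u = - (u - v) by rewrite opprB.
have e1 : enorm (v - u) = enorm (u - v).
  by rewrite vu enormN.
rewrite e1 in h1.
have [d0|d0] := eqVneq (enorm (u - v)) 0; first by rewrite d0 mulr0 enorm_ge0.
have dp : 0 < enorm (u - v) by rewrite lt_def d0 enorm_ge0.
rewrite -(ler_pM2r dp); apply: le_trans (dotv_le _ _).
rewrite dotvBl vu -scaleN1r dotvZr in h1 *; rewrite -mulrA -expr2.
lra.
Qed.

Lemma grad_u_inj t x u v : grad_u L t x u = grad_u L t x v -> u = v.
Proof.
move=> E; have := strong_monotone t x u v; rewrite E subrr enorm0.
have [k0 _] := C2; rewrite pmulr_rle0// => h.
have : enorm (u - v) = 0 by apply/eqP; rewrite eq_le h enorm_ge0.
move=> /(congr1 (fun z => z ^+ 2)); rewrite enorm_sqr expr0n/= => /dotv_eq0 /eqP.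
by rewrite subr_eq0 => /eqP.
Qed.

(** [f v = L t x v - <q, v>] grows quadratically, so it has a minimum, where
    its gradient vanishes. *)
Lemma grad_u_surj t x q : exists u, grad_u L t x u = q.
Proof.
have [k0 H] := C2.
pose f v := L t x v - dotv q v.
pose A := enorm (q - grad_u L t x 0).
pose r := 2 * A / kappa + 1.
have A0 : 0 <= A by exact: enorm_ge0.
have r0 : 0 < r by rewrite ltr_wpDl// divr_ge0 ?mulr_ge0// ltW.
have far v : r < `|v| -> f 0 < f v.
  move=> rv; have vr : r < enorm v by exact: lt_le_trans rv (norm_le_enorm _).
  have := H t x 0 v; rewrite subr0 => h.
  have := dotv_le (q - grad_u L t x 0) v; rewrite dotvBl -/A => h'.
  rewrite /f dotv0r subr0.
  set y := enorm v in vr h h' *.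
  have y0 : 0 < y by exact: lt_trans vr.
  suff : A * y < kappa / 2 * y ^+ 2 by lra.
  rewrite expr2 mulrA ltr_pM2r//.
  have : 2 * A / kappa < y by rewrite (lt_trans _ vr)// ltrDl.
  rewrite ltr_pdivrMr//; lra.
pose B := [set v : 'rV[R]_n | `|v| <= r].
have cB : compact B.
  apply: bounded_closed_compact.
    by exists r; split; [exact: num_real|move=> M rM v /= vr; exact: le_trans vr (ltW rM)].
  have -> : B = (fun v : 'rV[R]_n => `|v|) @^-1` [set y : R | y <= r] by [].
  by apply: closed_comp => [v _|]; [exact: norm_continuous|exact: closed_le].
have lineF v w (s : R) : is_derive s 1 (fun s => f (v + s *: w)) (dotv (grad_u L t x (v + s *: w)
  - q) w).
  have d1 := line_is_derive hF (t, x, v) (0, 0, w) s.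
  rewrite (_ : (fun _ => _) = (fun s : R => L t x (v + s *: w))) in d1; last first.
    by apply/funext => z; rewrite tripleZ tripleD mulr0 scaler0 !addr0.
  rewrite tripleZ tripleD mulr0 scaler0 !addr0 (dL_u hF) in d1.
  have d2 : is_derive s (1 : R) (fun s : R => dotv q v + s * dotv q w) (dotv q w).
    have c1 : is_derive s (1 : R) (fun=> dotv q v) 0 by exact: is_derive_cst.
    have c2 : is_derive s (1 : R) (fun s : R => dotv q w * s) (dotv q w).
      exact: is_derive_scale.
    have := is_deriveD c1 c2; rewrite add0r.
    by rewrite (_ : (_ + _) = (fun s : R => dotv q v + s * dotv q w))//; apply/funext => z /=;
      rewrite mulrC.
  have := is_deriveB d1 d2; rewrite -dotvBl.
  rewrite (_ : (_ - _) = (fun s => f (v + s *: w)))//.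
  by apply/funext => z; rewrite /f fctE /= dotvDr dotvZr.
have cf : continuous f.
  have cd : continuous (fun p : R * 'rV[R]_n * 'rV[R]_n => F p).
    exact: lagrangian_continuous.
  have cL : continuous (L t x).
    move=> v.
    have c1 : (fun w => ((t, x), w)) @ v --> ((t, x), v).
      by apply: (@cvg_pair _ _ _ (nbhs v) (nbhs (t, x)) (nbhs v) _ _ _ (fun=> (t, x)) id);
        [exact: cvg_cst|exact: cvg_id].
    exact: (@continuous_comp _ _ _ (fun w => ((t, x), w)) F v c1 (cd _)).
  move=> v.
  have c1 : {for v, continuous (L t x)} by exact: cL.
  have c2 : {for v, continuous (dotv q)} by exact: dotv_continuous.
  exact: (@continuousB R R _ (L t x) (dotv q) v c1 c2).
have [||c cinB cmin] := @EVT_min_rV R n f B _ cB.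
- by exists 0; rewrite /B/= normr0 ltW.
- exact: (continuous_subspaceT cf).
have gmin v : f c <= f v.
  have [vr|vr] := leP `|v| r; first by apply: cmin; rewrite inE.
  apply: le_trans (ltW (far v vr)); apply: cmin; rewrite inE /B/= normr0.
  exact: ltW.
exists c; apply/eqP; rewrite -subr_eq0; apply/eqP/dotv_eq0.
pose w := grad_u L t x c - q.
have d0 : is_derive (0 : R) (1 : R) (fun s => f (c + s *: w)) 0.
  apply: (@derive1_at_min _ _ (-1) 1 0).
  - lra.
  - by move=> s _; have [] := lineF c w s.
  - by rewrite in_itv/=; apply/andP; split; lra.
  - by move=> s _; rewrite scale0r addr0.
have [_ <-] := d0; have [_ ->] := lineF c w 0.
by rewrite scale0r addr0.
Qed.

(** By [strong_monotone] at time [s], [kappa * |u s - u t|] is at most the norm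
    of [q s - grad_u L s (X s) (u t)], which is continuous in [s] and vanishes
    at [t]. *)
Lemma grad_u_inverse_continuous (X q u : R -> 'rV[R]_n) :
  (forall i, continuous (fun t => X t 0 i)) -> (forall i, continuous (fun t => q t 0 i)) ->
  (forall t, grad_u L t (X t) (u t) = q t) -> forall i, continuous (fun t => u t 0 i).
Proof.
move=> cX cq uE i t; have [k0 _] := C2; apply/cvgrPdist_le => e e0.
pose G s j := q s 0 j - grad_u L s (X s) (u t) 0 j.
have cG j : continuous (G^~ j).
  move=> s; apply: cvgB; first exact: cq.
  apply: (@triple_continuous _ _ _ (fun p => grad_u L p.1.1 p.1.2 p.2 0 j) id X (fun=> u t)).
  - exact: grad_u_continuous.
  - by move=> ?; exact: cvg_id.
  - exact: rV_continuous.
  - by move=> ?; exact: cvg_cst.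
have Gt j : G t j = 0 by rewrite /G uE subrr.
have n0 : 0 < n%:R + 1 :> R by rewrite ltr_wpDl.
have H0 j : \forall s \near t, `|G s j| <= e * kappa / (n%:R + 1).
  have := cG j t => /cvgrPdist_le.
  move=> /(_ (e * kappa / (n%:R + 1))); rewrite divr_gt0 ?mulr_gt0// => /(_ isT).
  by apply: filterS => s; rewrite Gt sub0r normrN.
have := @filter_forall _ _ (fun j s => `|G s j| <= e * kappa / (n%:R + 1)) _ (nbhs_filter t) H0.
apply: filterS => s Gs.
have := coord_le_enorm (u t - u s) i; rewrite row_subE => /le_trans; apply.
rewrite -(ler_pM2l k0).
have := strong_monotone s (X s) (u s) (u t).
have -> : enorm (u s - u t) = enorm (u t - u s).
  by rewrite -opprB enormN.
move=> /le_trans; apply; rewrite (le_trans (enorm_le_sum _))//.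
apply: (@le_trans _ _ (\sum_(j < n) e * kappa / (n%:R + 1))).
  by apply: ler_sum => j _; rewrite row_subE uE; exact: Gs.
rewrite sumr_const card_ord -[_ *+ n]mulr_natl mulrA ler_pdivrMr//.
rewrite [X in _ <= X]mulrC (mulrC kappa) ler_wpM2r ?lerDl//.
by rewrite mulr_ge0// ltW.
Qed.

(** The chain rule for [s |-> (s, X s, v)]. *)
Lemma curve_is_derive (X : R -> 'rV[R]_n) (v w : 'rV[R]_n) (s : R) :
  (forall i, is_derive s 1 (fun s => X s 0 i) (w 0 i)) ->
  is_derive s 1 (fun s => L s (X s) v) (deriv_t L s (X s) v + dotv (grad_x L s (X s) v) w).
Proof.
move=> dX.
have dXv : derivable X s 1 by apply/derivable_mxP => i j; rewrite (ord1 i); have [] := dX j.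
have DX : derive1 X s = w.
  rewrite derive1E derive_mx//; apply/rowP => i; rewrite mxE.
  by have [_] := dX i.
have diffX : differentiable X s by exact/derivable1_diffP.
pose gam := fun s : R => (s, X s, v).
have is1 : is_diff s (fun s : R => s) (fun h : R => h) by exact: is_diff_id.
have is2 : is_diff s X ('d X s) by apply: DiffDef.
have is3 : is_diff s (fun=> v) (fun=> 0) by exact: is_diff_cst.
have isg : is_diff s gam (fun h => (h, 'd X s h, 0)) by apply: is_diff_pair; exact: is_diff_pair.
have [dg dgE] := isg.
have dF : differentiable F (gam s) by exact: hF.1.
have dFg : differentiable (F \o gam) s by exact: differentiable_comp.
apply: DeriveDef; first exact/derivable1_diffP.
rewrite -/(F \o gam) deriveE// diff_comp//= dgE.
rewrite -[LHS]/(dL L (gam s) (1, 'd X s 1, 0)) (dL_split hF).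
by rewrite mul1r dotv0r addr0 diff1E// scale1r DX.
Qed.

End regularity.

(** * Extremals and their Hamiltonian *)

Section extremal.
Variables (R : realType) (n : nat) (L : R -> 'rV[R]_n -> 'rV[R]_n -> R).
Notation mu := (@lebesgue_measure R).
Notation I01 := (`[0%R, 1%R]%classic : set R).
Let F := fun p : R * 'rV[R]_n * 'rV[R]_n => L p.1.1 p.1.2 p.2.
Hypothesis hF : continuously_differentiable F.
Variable kappa : R.
Hypothesis C2 : condC2 L kappa.

Lemma vprim_eq_ae (g u : R -> 'rV[R]_n) t : vintg01 g -> vintg01 u ->
  {ae mu, forall s, I01 s -> g s = u s} -> I01 t -> vprim g t = vprim u t.
Proof.
move=> gi ui gu /=; rewrite in_itv/= => /andP[t0 t1].
have aeF : Filter (almost_everywhere mu) by exact: (ae_filter_ringOfSetsType mu).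
apply/rowP => i; rewrite !mxE /prim /Rintegral; congr fine.
have S : `[0%R, t]%classic `<=` I01 by apply: subset_itvl; rewrite bnd_simp.
apply: ae_eq_integral.
- exact: measurable_itv.
- exact: (measurable_int mu (intg01S (gi i) S)).
- exact: (measurable_int mu (intg01S (ui i) S)).
- by apply: filterS gu => s H It /=; rewrite H//; exact: S.
Qed.

Lemma clamp_is_derive (f : R -> R) (t d : R) : 0 < t < 1 ->
  is_derive t 1 f d -> is_derive t 1 (fun s => f (clamp s)) d.
Proof.
move=> /andP[t0 t1]; apply: near_eq_is_derive.

near=> s; rewrite clamp_id//; apply/andP; split; near: s.
  by near do apply: ltW; exact: lt_nbhsr.
by near do apply: ltW; exact: lt_nbhsl.
Unshelve. all: by end_near. Qed.

Definition hamiltonian (x u q : R -> 'rV[R]_n) t := dotv (q t) (u t) - L t (x t) (u t).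

(** The canonical equations [x' = u], [q' = L_x] with [q = L_u]. The functions
    are continuous on the whole line, so that one-sided notions at the end
    points are avoided; the differential equations are only asked inside
    (0,1). *)
Record extremal (x u q : R -> 'rV[R]_n) : Prop := Extremal {
  extremal_x : forall i, continuous (fun t => x t 0 i);
  extremal_u : forall i, continuous (fun t => u t 0 i);
  extremal_q : forall i, continuous (fun t => q t 0 i);
  extremal_eq : forall t, grad_u L t (x t) (u t) = q t;
  extremal_dx : forall t : R, 0 < t < 1 -> forall i, is_derive t 1 (fun s => x s 0 i) (u t 0 i);
  extremal_dq : forall t : R, 0 < t < 1 -> forall i,
    is_derive t 1 (fun s => q s 0 i) (grad_x L t (x t) (u t) 0 i) }.

(** Solve [grad_u L t (x t) (u t) = q t] for a continuous [u]. By injectivity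
    [u] equals [g] almost everywhere, so [x] and [q] are also primitives of the
    continuous functions [u] and [grad_x L] along [(x, u)]. *)
Lemma regular_extremal (g : R -> 'rV[R]_n) (m : 'rV[R]_n) : vintg01 g ->
  vintg01 (fun t => grad_x L t (vprim g t) (g t)) ->
  {ae mu, forall t, I01 t ->
    grad_u L t (vprim g t) (g t) = m + vprim (fun s => grad_x L s (vprim g s) (g s)) t} ->
  exists x u q, [/\ extremal x u q, forall t, I01 t -> x t = vprim g t &
    {ae mu, forall t, I01 t -> g t = u t}].
Proof.
move=> gi Gi EL.
have aeF : Filter (almost_everywhere mu) by exact: (ae_filter_ringOfSetsType mu).
pose G t := grad_x L t (vprim g t) (g t).
pose x t := vprim g (clamp t); pose q t := m + vprim G (clamp t).
have /choice[u uE] : forall t, exists v, grad_u L t (x t) v = q t.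
  by move=> t; exact: (grad_u_surj hF C2).
have vcont (h : R -> 'rV[R]_n) i : vintg01 h -> continuous (fun t => vprim h (clamp t) 0 i).
  move=> hi; rewrite (_ : (fun _ => _) = (fun t => prim (fun s => h s 0 i) (clamp t))).
    by apply: ac01_clamp_continuous; exact: prim_ac01.
  by apply/funext => t; rewrite mxE.
have cx i : continuous (fun t => x t 0 i) by exact: vcont.
have qE t i : q t 0 i = m 0 i + vprim G (clamp t) 0 i by rewrite [q t 0 i]mxE.
have cq i : continuous (fun t => q t 0 i).
  rewrite (_ : (fun _ => _) = (fun t => m 0 i + vprim G (clamp t) 0 i)).
    by move=> t; apply: cvgD; [exact: cvg_cst|exact: vcont].
  by apply/funext => t; exact: qE.
have cu i : continuous (fun t => u t 0 i) by exact: (grad_u_inverse_continuous hF C2 cx cq uE).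
have xE t : I01 t -> x t = vprim g t by rewrite /= in_itv/= => t01; rewrite /x clamp_id.
have gu : {ae mu, forall t, I01 t -> g t = u t}.
  apply: filterS EL => t H It; apply: (grad_u_inj C2 (t := t) (x := x t)).
  by rewrite uE xE// H// /q clamp_id.
have ui : vintg01 u by move=> i; apply/intg01_continuous/continuous_subspaceT/cu.
have cH i : continuous (fun t => grad_x L t (x t) (u t) 0 i).
  apply: (@triple_continuous _ _ _ (fun p => grad_x L p.1.1 p.1.2 p.2 0 i) id).
  - exact: grad_x_continuous.
  - by move=> ?; exact: cvg_id.
  - exact: rV_continuous.
  - exact: rV_continuous.
have Hi : vintg01 (fun t => grad_x L t (x t) (u t)).
  by move=> i; apply/intg01_continuous/continuous_subspaceT/cH.
exists x, u, q; split => //; split => //.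
- move=> t t01 i.
  rewrite (_ : (fun s => _) = (fun s => vprim u (clamp s) 0 i)); last first.
    apply/funext => s; rewrite /x (vprim_eq_ae gi ui)//= in_itv/=.
    by rewrite clamp_ge0 clamp_le1.
  exact: (clamp_is_derive (f := fun s => vprim u s 0 i) t01 (vprim_is_derive i cu t01)).
- move=> t t01 i.
  rewrite (_ : (fun s => _) = (fun s => m 0 i + vprim (fun t => grad_x L t (x t) (u t)) (clamp s)
    0 i)); last first.
    apply/funext => s; rewrite qE (vprim_eq_ae Gi Hi)//;
      last by rewrite /= in_itv/= clamp_ge0 clamp_le1.
    by apply: filterS gu => r H Ir; rewrite xE// H.
  have d1 : is_derive t (1 : R) (fun=> m 0 i) 0 by exact: is_derive_cst.
  have d2 : is_derive t (1 : R) (fun s => vprim (fun t => grad_x L t (x t) (u t)) (clamp s) 0 i)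
      (grad_x L t (x t) (u t) 0 i).
    exact: (clamp_is_derive (f := fun s => vprim _ s 0 i) t01 (vprim_is_derive i cH t01)).
  by have := is_deriveD d1 d2; rewrite add0r; exact.
Qed.

(** By convexity [hamiltonian] at [s] is the maximum over [r] of
    [E s r = <q s, u r> - L(s, x s, u r)], attained at [r = s]. With
    [q' = L_x] and [x' = u] the terms of its derivative in [s] at [r = s] other
    than [- L_t] cancel, and [envelope] applies. *)
Lemma extremal_hamiltonian x u q (t : R) : extremal x u q -> 0 < t < 1 ->
  is_derive t 1 (hamiltonian x u q) (- deriv_t L t (x t) (u t)).
Proof.
move=> ex t01; have [cx cu cq uE dx dq] := ex.
pose D (s r : R) := dotv (grad_x L s (x s) (u s)) (u r) -
  (deriv_t L s (x s) (u r) + dotv (grad_x L s (x s) (u r)) (u s)).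
apply: (@envelope _ _ (fun s r => dotv (q s) (u r) - L s (x s) (u r)) D 0 1) => //.
- move=> s r s01 r01; have [k0 H] := C2.
  have := H s (x s) (u s) (u r); rewrite uE dotvBr /hamiltonian.
  have : 0 <= kappa / 2 * enorm (u r - u s) ^+ 2 by rewrite mulr_ge0 ?sqr_ge0// divr_ge0// ltW.
  lra.
- move=> s r s01 r01; apply: is_deriveB.
    rewrite (_ : (fun s => _) = \sum_(i < n) (fun s => u r 0 i * q s 0 i)); last first.
      by apply/funext => z; rewrite fct_sumE /dotv; apply: eq_bigr => i _; rewrite mulrC.
    rewrite dotvC; apply: is_derive_sum => i.
    by apply: is_deriveZ; exact: dq.
  by apply: (curve_is_derive hF) => i; exact: dx.
have -> : - deriv_t L t (x t) (u t) = D t t by rewrite /D; lra.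
have cD : {for (t, t), continuous (fun z : R * R => D z.1 z.2)}.
  have c1 : continuous (fun z : R * R => z.1) by move=> z; exact: cvg_fst.
  have c2 : continuous (fun z : R * R => z.2) by move=> z; exact: cvg_snd.
  have cc (f : R -> 'rV[R]_n) (p : R * R -> R) : (forall i, continuous (fun t => f t 0 i)) ->
      continuous p -> continuous (fun z => f (p z)).
    move=> cf cp z; apply: continuous_comp; first exact: cp.
    exact: rV_continuous.
  have cc0 (f : R -> 'rV[R]_n) (p : R * R -> R) i : (forall i, continuous (fun t => f t 0 i)) ->
      continuous p -> continuous (fun z => f (p z) 0 i).
    move=> cf cp z; apply: (@continuous_comp _ _ _ p (fun t => f t 0 i)); first exact: cp.
    exact: cf.
  have cx1 := cc _ _ cx c1; have cu1 := cc _ _ cu c1; have cu2 := cc _ _ cu c2.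
  have cg (v : R * R -> 'rV[R]_n) i : continuous v ->
    continuous (fun z => grad_x L z.1 (x z.1) (v z) 0 i).
    move=> cv; exact: (@triple_continuous _ _ _ (fun p => grad_x L p.1.1 p.1.2 p.2 0 i) _ _ _
      (grad_x_continuous (i := i) hF) c1 cx1 cv).
  have e1 : {for (t, t), continuous (fun z : R * R => dotv (grad_x L z.1 (x z.1) (u z.1)) (u z.2))}.
    apply: dotv_continuous_at => i; last exact: cc0.
    exact: (cg _ i cu1 (t, t)).
  have e2 : {for (t, t), continuous (fun z : R * R => deriv_t L z.1 (x z.1) (u z.2))}.
    exact: (@triple_continuous _ _ _ (fun p => deriv_t L p.1.1 p.1.2 p.2) _ _ _
      (deriv_t_continuous hF) c1 cx1 cu2).
  have e3 : {for (t, t), continuous (fun z : R * R => dotv (grad_x L z.1 (x z.1) (u z.2)) (u z.1))}.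
    apply: dotv_continuous_at => i; last exact: cc0.
    exact: (cg _ i cu2 (t, t)).
  exact: (cvgB e1 (cvgD e2 e3)).
move=> e e0; move: cD => /cvgrPdist_le /(_ e e0) /nbhs_ballP[eta /= eta0 H].
exists eta => // s r st rt; rewrite distrC; apply: (H (s, r)).
by split; rewrite /ball/= distrC.
Qed.

End extremal.

(** * Growth of the Hamiltonian against the momentum *)

Section growth.
Variables (R : realType) (n : nat).
Implicit Types (f k K p : R -> R) (q : R -> 'rV[R]_n).

Lemma is_derive_reverse f (s d : R) :
  is_derive (- s) 1 f d -> is_derive s 1 (fun s => f (- s)) (- d).
Proof.
move=> fd.
have dN : is_derive s (1 : R) (fun s : R => - s) (- 1) by apply: is_deriveN; exact: is_derive_id.
by have := @is_derive1_comp _ f (fun s : R => - s) s _ _ fd dN; rewrite mulrN1.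
Qed.

Lemma is_derive_expRM K (s r k : R) : is_derive s 1 K k ->
  is_derive s 1 (fun s => expR (r * K s)) (r * k * expR (r * K s)).
Proof.
move=> Kd; have d1 : is_derive s (1 : R) (fun s => r * K s) (r * k).
  exact: (@is_deriveZ _ _ _ K r s 1 k Kd).
by rewrite mulrC; exact: (@is_derive1_comp _ expR (fun s : R => r * K s) s _ _ (is_derive_expR _)
  d1).
Qed.

Lemma derive_ge0_le (f df : R -> R) (a b : R) : a <= b ->
  (forall s, a <= s <= b -> is_derive s 1 f (df s)) ->
  (forall s, a < s < b -> 0 <= df s) -> f a <= f b.
Proof.
move=> ab fd d0; rewrite -lerN2.
apply: (@derive_le0_le _ (fun s => - f s) (fun s => - df s)) => //.
- by move=> s /andP[? ?]; apply: is_deriveN; apply: fd; rewrite !ltW.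
- apply: continuous_in_subspaceT => s; rewrite inE/= in_itv/= => sab.
  by apply: cvgN; exact: is_derive_continuous (fd s sab).
- by move=> s sab; rewrite oppr_le0 d0.
Qed.

Lemma dotv_is_derive q (dq : 'rV[R]_n) (s : R) :
  (forall i, is_derive s 1 (fun s => q s 0 i) (dq 0 i)) ->
  is_derive s 1 (fun s => dotv (q s) (q s)) (2 * dotv (q s) dq).
Proof.
move=> qd; rewrite (_ : (fun s => _) = \sum_(i < n) (fun s => q s 0 i * q s 0 i)); last first.
  by apply/funext => z; rewrite fct_sumE.
rewrite /dotv mulr_sumr; apply: is_derive_sum => i.
have := is_deriveM (qd i) (qd i); rewrite -mulr2n -[_ *+ 2]mulr_natl; exact.
Qed.

(** Since [|q'| <= k |q|] and [K' = k], the function [|q|^2 e^(2K)] is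
    nondecreasing, hence [|q s| <= |q b| e^(K b - K s)]. So
    [p' <= k |q b| e^(K b - K s)], that is [p + |q b| e^(K b - K)] is
    nonincreasing; compare its values at [a] and [b]. *)
Lemma escape_forward q p K (dq : R -> 'rV[R]_n) (dp k : R -> R) (a b : R) : a <= b ->
  (forall s, a <= s <= b -> forall i, is_derive s 1 (fun s => q s 0 i) (dq s 0 i)) ->
  (forall s, a <= s <= b -> is_derive s 1 p (dp s)) ->
  (forall s, a <= s <= b -> is_derive s 1 K (k s)) ->
  (forall s, a < s < b -> 0 <= k s /\ enorm (dq s) <= k s * enorm (q s) /\ dp s <= k s * enorm (q
    s)) ->
  p b - p a <= (expR (K b - K a) - 1) * enorm (q b).
Proof.
move=> ab qd pd Kd H.
have grow s : a < s < b -> enorm (q s) <= enorm (q b) * expR (K b - K s).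
  move=> /andP[as_ sb].
  have : dotv (q s) (q s) * expR (2 * K s) <= dotv (q b) (q b) * expR (2 * K b).
    apply: (@derive_ge0_le (fun s => dotv (q s) (q s) * expR (2 * K s))
      (fun s => dotv (q s) (q s) * (2 * k s * expR (2 * K s)) + expR (2 * K s) * (2 * dotv (q s)
        (dq s)))).
    - exact: ltW.
    - move=> r /andP[sr rb]; have rab : a <= r <= b by rewrite (le_trans (ltW as_) sr).
      exact: is_deriveM (dotv_is_derive (qd r rab)) (is_derive_expRM _ (Kd r rab)).
    - move=> r /andP[sr rb]; have rab : a < r < b by rewrite (lt_trans as_ sr).
      have [k0 [dqk _]] := H r rab.
      rewrite (_ : _ + _ = 2 * expR (2 * K r) * (k r * dotv (q r) (q r) + dotv (q r) (dq r)));
        last by ring.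
      rewrite mulr_ge0 ?mulr_ge0 ?expR_ge0//.
      have := dotv_le (- q r) (dq r).
      rewrite enormN dotvNl -enorm_sqr expr2 => h.
      have := ler_wpM2l (enorm_ge0 (q r)) dqk.
      lra.
  have E r : expR (2 * K r) = expR (K r) ^+ 2 by rewrite -expRM_natl mulr_natl.
  rewrite -!enorm_sqr !E -!exprMn ler_pXn2r ?nnegrE ?mulr_ge0 ?enorm_ge0 ?expR_ge0//.
  by rewrite expRB mulrA ler_pdivlMr ?expR_gt0.
set C := enorm (q b) * expR (K b).
have : p b + C * expR (- 1 * K b) <= p a + C * expR (- 1 * K a).
  rewrite -lerN2.
  apply: (@derive_ge0_le (fun s => - (p s + C * expR (- 1 * K s)))
     (fun s => - (dp s + C * (- 1 * k s * expR (- 1 * K s))))) => //.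
    move=> s sab; apply: is_deriveN; apply: is_deriveD; first exact: pd.
    by apply: is_deriveZ; apply: is_derive_expRM; exact: Kd.
  move=> s sab; have [k0 [_ dpk]] := H s sab.
  rewrite oppr_ge0; have := ler_wpM2l k0 (grow s sab).
  rewrite expRB -expRN !mulN1r.
  have -> : C * (- k s * expR (- K s)) = - (k s * (enorm (q b) * (expR (K b) * expR (- K s)))).
    by rewrite /C; ring.
  lra.
rewrite /C !mulN1r -!mulrA -!expRD subrr expR0.
rewrite mulrBl mul1r mulrC; lra.
Qed.

(** [escape_forward] for the time-reversed functions. *)
Lemma escape_backward q p K (dq : R -> 'rV[R]_n) (dp k : R -> R) (a b : R) : a <= b ->
  (forall s, a <= s <= b -> forall i, is_derive s 1 (fun s => q s 0 i) (dq s 0 i)) ->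
  (forall s, a <= s <= b -> is_derive s 1 p (dp s)) ->
  (forall s, a <= s <= b -> is_derive s 1 K (k s)) ->
  (forall s, a < s < b -> 0 <= k s /\ enorm (dq s) <= k s * enorm (q s) /\ - dp s <= k s * enorm
    (q s)) ->
  p a - p b <= (expR (K b - K a) - 1) * enorm (q a).
Proof.
move=> ab qd pd Kd H.
have ba : - b <= - a by rewrite lerN2.
have rev s : (- b <= s <= - a) = (a <= - s <= b) by rewrite andbC lerNr lerNl.
have rev' s : (- b < s < - a) = (a < - s < b) by rewrite andbC ltrNr ltrNl.
have := @escape_forward (fun s => q (- s)) (fun s => p (- s)) (fun s => - K (- s))
  (fun s => - dq (- s)) (fun s => - dp (- s)) (fun s => k (- s)) (- b) (- a) ba.
rewrite !opprK [- K a + _]addrC; apply.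
- move=> s; rewrite rev => sab i; rewrite mxE; apply: (@is_derive_reverse (fun s => q s 0 i));
  exact: qd.
- by move=> s; rewrite rev => sab; apply: is_derive_reverse; exact: pd.
- move=> s; rewrite rev => sab; rewrite -[k _]opprK; apply: is_deriveN.
  by apply: is_derive_reverse; exact: Kd.
- move=> s; rewrite rev' => sab; have [? [? ?]] := H _ sab; split => //; split => //.
  by rewrite enormN.
Qed.

Lemma last_below p (beta a b : R) : continuous p -> a <= b -> p a <= beta -> beta < p b ->
  exists t0, [/\ a <= t0 < b, p t0 <= beta & forall s, t0 < s <= b -> beta < p s].
Proof.
move=> cp ab pa pb.
pose S := `[a, b]%classic `&` p @^-1` [set y | y <= beta].
have Sa : S a by split; rewrite //= in_itv/= lexx.
have ubS : has_ubound S by exists b => s [] /=; rewrite in_itv/= => /andP[].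
have hS : has_sup S by split; [exists a|].
have clS : closed S.
  apply: closedI; first exact: itv_closed.
  by apply: closed_comp => [s _|]; [exact: cp|exact: closed_le].
have [/= t0ab pt0] : S (sup S) by apply: clS; apply: closure_sup => //; exists a.
move: t0ab; rewrite in_itv/= => /andP[at0 t0b].
exists (sup S); split => //.
  by rewrite at0/= lt_neqAle t0b andbT; apply/eqP => E; move: pt0; rewrite E leNgt pb.
move=> s /andP[t0s sb]; rewrite ltNge; apply/negP => ps.
have : s <= sup S by apply: sup_upper_bound => //; split;
  rewrite //= in_itv/= sb (le_trans at0 (ltW t0s)).
by rewrite leNgt t0s.
Qed.

Lemma first_below p (beta a b : R) : continuous p -> a <= b -> p b <= beta -> beta < p a ->
  exists t0, [/\ a < t0 <= b, p t0 <= beta & forall s, a <= s < t0 -> beta < p s].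
Proof.
move=> cp ab pb pa.
have cpN : continuous (fun s => p (- s)).
  by move=> s; apply: (@continuous_comp _ _ _ (fun s : R => - s) p);
    [exact: opp_continuous|exact: cp].
have [|||t0 [/andP[t1 t2] t3 t4]] := @last_below (fun s => p (- s)) beta (- b) (- a) cpN.
- by rewrite lerN2.
- by rewrite opprK.
- by rewrite opprK.
exists (- t0); split => //; first by rewrite ltrNr t2 lerNl.
move=> s /andP[as_ st0]; rewrite -[s]opprK; apply: t4.
by rewrite ltrNr st0 lerN2.
Qed.

End growth.

(** * Comparing increments with integrals *)

Section integral_comparison.
Variable R : realType.

Lemma increment_le_prim (w f df : R -> R) (a b : R) : continuous w ->
  0 <= a -> a <= b -> b <= 1 ->
  (forall s, a < s < b -> is_derive s 1 f (df s)) -> {within `[a, b], continuous f} ->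
  (forall s, a < s < b -> df s <= w s) -> f b - f a <= prim w b - prim w a.
Proof.
move=> cw a0 ab b1 fd fc dfw.
have wi : intg01 w by exact/intg01_continuous/continuous_subspaceT/cw.
have : f b - prim w b <= f a - prim w a; last by lra.
apply: (@derive_le0_le _ (fun s => f s - prim w s) (fun s => df s - w s)) => //.
- move=> s sab; apply: is_deriveB; first exact: fd.
  apply: prim_is_derive => //.
  by case/andP: sab => as_ sb; rewrite (le_lt_trans a0)//= (lt_le_trans sb).
- have pc : {within `[a, b], continuous (prim w)}.
    apply: continuous_subspaceW (prim_continuous wi).
    by move=> s /=; rewrite !in_itv/= => /andP[as_ sb]; rewrite (le_trans a0)//= (le_trans sb).
  by move=> s; apply: cvgB; [exact: fc|exact: pc].
- by move=> s sab; rewrite subr_le0 dfw.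
Qed.

Lemma prim_lower_bound (w : R -> R) (M a b : R) : continuous w ->
  0 <= a -> a <= b -> b <= 1 ->
  (forall s, a < s < b -> M <= w s) -> M * (b - a) <= prim w b - prim w a.
Proof.
move=> cw a0 ab b1 Mw.
have d s : is_derive s (1 : R) (fun s => M * s) M.
  exact: is_derive_scale.
rewrite mulrBr; apply: (@increment_le_prim w (fun s => M * s) (fun=> M)) => //.
by apply: continuous_in_subspaceT => s _; exact: is_derive_continuous (d s).
Qed.

Lemma prim_increment_le (w : R -> R) (a b : R) : continuous w -> (forall s, 0 <= w s) ->
  0 <= a -> a <= b -> b <= 1 -> prim w b - prim w a <= prim w 1.
Proof.
move=> cw w0 a0 ab b1.
have h1 := @prim_lower_bound w 0 b 1 cw (le_trans a0 ab) b1 (lexx _) (fun s _ => w0 s).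
have h2 := @prim_lower_bound w 0 0 a cw (lexx _) a0 (le_trans ab b1) (fun s _ => w0 s).
move: h1 h2; rewrite prim0; lra.
Qed.

End integral_comparison.

(** * The bound on the speed of an extremal *)

Section speed_bound.
Variables (R : realType) (n : nat) (L : R -> 'rV[R]_n -> 'rV[R]_n -> R).
Variables (theta : R -> R) (mu xi delta : R).
Hypotheses (C1 : condC1 L theta) (C2 : condC2 L mu) (C3 : condC3 L xi delta).
Variables x u q : R -> 'rV[R]_n.
Hypotheses (ex : extremal L x u q) (x0 : x 0 = 0).
Variables r0 c : R.
Hypotheses (hr0 : 0 < r0) (hr0theta : forall r : R, r0 <= r -> 1 <= theta r / r).
Local Notation ell := (fun s => L s (x s) (u s)).
Local Notation speed := (fun s => enorm (u s)).
Local Notation p := (hamiltonian L x u q).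
Hypothesis cost_le : prim ell 1 <= c - r0.

Let hF : continuously_differentiable (fun p : R * 'rV[R]_n * 'rV[R]_n => L p.1.1 p.1.2 p.2).
Proof. by case: C1. Qed.

Lemma lagrangian_gt0 t y v : 0 < L t y v.
Proof. by have [_ H _] := C1; have [h1 h2] := H t y v; exact: lt_le_trans h1. Qed.

Lemma ell_continuous : continuous ell.
Proof.
have [cx cu _ _ _ _] := ex.
apply: (@triple_continuous _ _ _ (fun p => L p.1.1 p.1.2 p.2) id).
- exact: lagrangian_continuous.
- by move=> ?; exact: cvg_id.
- exact: rV_continuous.
- exact: rV_continuous.
Qed.

Lemma speed_continuous : continuous speed.
Proof.
have [cx cu _ _ _ _] := ex; move=> s.
apply: (@continuous_comp _ _ _ (fun s => dotv (u s) (u s)) Num.sqrt); last exact: sqrt_continuous.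
by apply: dotv_continuous_at => i; exact: cu.
Qed.

Lemma hamiltonian_continuous : continuous p.
Proof.
have [cx cu cq _ _ _] := ex => s.
have c1 : {for s, continuous (fun s => dotv (q s) (u s))}.
  by apply: dotv_continuous_at => i; [exact: cq|exact: cu].
have c2 : {for s, continuous ell} by exact: ell_continuous.
exact: (@continuousB R R _ (fun s => dotv (q s) (u s)) ell s c1 c2).
Qed.

(** [theta r >= r] as soon as [r >= r0]. *)
Lemma speed_le_ell s : enorm (u s) <= r0 + ell s.
Proof.
have [ur|ru] := leP (enorm (u s)) r0.
  by rewrite (le_trans ur)// lerDl ltW// lagrangian_gt0.
have [_ H _] := C1; have [h1 h2] := H s (x s) (u s).
have := hr0theta (ltW ru); rewrite ler_pdivlMr ?mul1r ?(lt_trans hr0)// => h.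
by rewrite (le_trans h)// (le_trans h1)// lerDr ltW.
Qed.

Lemma prim_speed_le : prim speed 1 <= c.
Proof.
have si : intg01 speed by exact/intg01_continuous/continuous_subspaceT/speed_continuous.
have : (prim speed 1 - r0 * 1) - (prim speed 0 - r0 * 0) <= prim ell 1 - prim ell 0.
  have d s : is_derive s (1 : R) (fun s => r0 * s) r0.
    exact: is_derive_scale.
  apply: (@increment_le_prim _ ell (fun s => prim speed s - r0 * s) (fun s => speed s - r0)) => //.
  - exact: ell_continuous.
  - by move=> s s01; apply: is_deriveB => //; apply: prim_is_derive => //; exact: speed_continuous.
  - have cr : {within `[0, 1], continuous (fun s => r0 * s)}.
      by apply: continuous_in_subspaceT => s _; exact: is_derive_continuous (d s).
    by move=> s; apply: cvgB; [exact: (prim_continuous si)|exact: cr].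
  - by move=> s _; rewrite lerBlDl speed_le_ell.
rewrite !prim0; have := cost_le; lra.
Qed.

(** [<x t, x s>] has derivative at most [|x t| |u s|] in [s], so
    [|x t|^2 <= |x t| \int |u|]. *)
Lemma extremal_in_ball (t : R) : 0 <= t <= 1 -> enorm (x t) <= c.
Proof.
move=> /andP[t0 t1]; have [cx cu _ _ dx _] := ex.
have si : intg01 speed by exact/intg01_continuous/continuous_subspaceT/speed_continuous.
have h1 : prim speed t <= c.
  apply: le_trans prim_speed_le.
  have := @prim_increment_le _ speed 0 t speed_continuous (fun s => enorm_ge0 _) (lexx _) t0 t1.
  by rewrite prim0 subr0.
apply: le_trans h1; have [->|xt0] := eqVneq (enorm (x t)) 0.
  have := @prim_lower_bound _ speed 0 0 t speed_continuous (lexx _) t0 t1 (fun s _ => enorm_ge0 _).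
  by rewrite prim0 mul0r subr0.
have xtp : 0 < enorm (x t) by rewrite lt_def xt0 enorm_ge0.
rewrite -(ler_pM2l xtp) -expr2 enorm_sqr.
have ws : continuous (fun s => enorm (x t) * speed s).
  by move=> s; apply: cvgM; [exact: cvg_cst|exact: speed_continuous].
have := @increment_le_prim _ (fun s => enorm (x t) * speed s) (fun s => dotv (x t) (x s))
  (fun s => dotv (x t) (u s)) 0 t ws (lexx _) t0 t1.
rewrite prim0 subr0 x0 dotv0r subr0 primZ ?t0//; apply.
- move=> s /andP[s0 st]; rewrite (_ : (fun s => _) = \sum_(i < n) (fun s => x t 0 i * x s 0 i));
  last first.
    by apply/funext => z; rewrite fct_sumE.
  apply: is_derive_sum => i; apply: is_deriveZ; apply: dx.
  by rewrite s0 (lt_le_trans st).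
- apply: continuous_subspaceT => s; apply: dotv_continuous_at => i;
  [exact: cst_continuous|exact: cx].
- by move=> s _; exact: dotv_le.
Qed.

Lemma extremal_in_Omega (t : R) : 0 <= t <= 1 -> Omega c (t, x t).
Proof. by move=> t01; split; [rewrite /= in_itv|exact: extremal_in_ball]. Qed.

Variables (T0 beta : R) (sigma : R -> R).
Hypothesis hsigma : forall r : R, 0 <= r ->
     is_max [set dotv (grad_u L p.1 p.2 u) u - L p.1 p.2 u |
               p in Omega c & u in [set u | enorm u <= r]] (sigma r).
Hypotheses (hT0 : 0 < T0 < 1) (hbeta : beta = sigma ((c + 1) / T0)).
Hypotheses (hbeta_gt : delta / xi < beta).

Lemma c_gt0 : 0 < c.
Proof.
apply: lt_le_trans hr0 _; rewrite -subr_ge0; apply: le_trans cost_le.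
have := @prim_lower_bound _ ell 0 0 1 ell_continuous (lexx _) ler01 (lexx _)
  (fun s _ => ltW (lagrangian_gt0 s (x s) (u s))).
by rewrite prim0 mul0r subr0.
Qed.

Lemma T0_gt0 : 0 < T0. Proof. by case/andP: hT0. Qed.

Lemma beta_gt0 : 0 < beta.
Proof. by have [xi0 delta0 _] := C3; rewrite (lt_trans _ hbeta_gt)// divr_gt0. Qed.

Lemma fast_of_hamiltonian_gt (t : R) : 0 <= t <= 1 -> beta < p t -> (c + 1) / T0 < enorm (u t).
Proof.
move=> t01 pt; rewrite ltNge; apply/negP => ut.
have c0 := c_gt0.
have [] := hsigma (r := (c + 1) / T0); first by rewrite divr_ge0 ?ltW ?T0_gt0// addr_gt0.
move=> _ /(_ (p t)); rewrite -hbeta leNgt pt; case/(_ _)/Bool.diff_false_true => //.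
exists (t, x t); first exact: extremal_in_Omega.
exists (u t) => //=; rewrite /hamiltonian.
by have [_ _ _ -> _ _] := ex.
Qed.

(** Otherwise the speed would exceed [(c + 1) / T0 > c] throughout, contradicting
    [prim_speed_le]. *)
Lemma exists_hamiltonian_le : exists2 t : R, 0 < t < 1 & p t <= beta.
Proof.
apply: contrapT => H.
have H' (t : R) : 0 < t < 1 -> (c + 1) / T0 <= enorm (u t).
  move=> t01; apply/ltW/fast_of_hamiltonian_gt.
    by case/andP: t01 => /ltW -> /ltW ->.
  by rewrite ltNge; apply/negP => pt; apply: H; exists t.
have := @prim_lower_bound _ speed ((c + 1) / T0) 0 1 speed_continuous (lexx _) ler01 (lexx _) H'.
rewrite prim0 !subr0 mulr1 => h.
have := le_trans h prim_speed_le; rewrite ler_pdivrMr ?T0_gt0//.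
have c0 := c_gt0; case/andP: hT0 => t0 t1.
have : c * T0 <= c by rewrite ler_piMr// ltW.
lra.
Qed.

(** A speed above [(c + 1) / T0] for longer than [T0] would make the length of
    the path exceed [c + 1]. *)
Lemma excursion_length (a b : R) : 0 <= a -> a <= b -> b <= 1 ->
  (forall s, a < s < b -> beta < p s) -> b - a <= T0.
Proof.
move=> a0 ab b1 H.
have c0 := c_gt0; have t0 := T0_gt0.
have H' (s : R) : a < s < b -> (c + 1) / T0 <= enorm (u s).
  move=> sab; apply/ltW/fast_of_hamiltonian_gt; last exact: H.
  by case/andP: sab => as_ sb; rewrite (le_trans a0 (ltW as_)) (le_trans (ltW sb)).
have h1 := @prim_lower_bound _ speed _ a b speed_continuous a0 ab b1 H'.
have h2 := @prim_increment_le _ speed a b speed_continuous (fun s => enorm_ge0 _) a0 ab b1.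
have := le_trans h1 (le_trans h2 prim_speed_le).
rewrite mulrAC ler_pdivrMr// => h.
have : (c + 1) * (b - a) <= (c + 1) * T0.
  by rewrite (le_trans h)// ler_wpM2r ?(ltW t0)// lerDl.
by rewrite ler_pM2l// addr_gt0.
Qed.

Variable eta : R.
Hypothesis heta : eta = sup [set r / (theta r + beta) | r in `[0, +oo[].
Hypothesis unit_vector : exists v : 'rV[R]_n, 0 < enorm v.

(** Every [r >= 0] is the length of some velocity, in dimension at least one. *)
Lemma theta_gt0 r : 0 <= r -> 0 < theta r.
Proof.
move=> hr; have [v v0] := unit_vector; have [_ H _] := C1.
have [_] := H 0 0 ((r / enorm v) *: v).
by rewrite enormZ ger0_norm ?divr_ge0 ?enorm_ge0// divfK// gt_eqF.
Qed.

(** The supremum defining [eta] is finite: [r / theta r] tends to 0 for large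
    [r], and on bounded sets the denominator is at least [beta]. *)
Lemma theta_ratio_le r : 0 <= r -> r / (theta r + beta) <= eta.
Proof.
move=> hr; rewrite heta; apply: sup_upper_bound; last by exists r => //=; rewrite in_itv/= andbT.
split; first by exists (r / (theta r + beta)); exists r => //=; rewrite in_itv/= andbT.
have b0 := beta_gt0.
have [_ _ /cvgrPdist_le/(_ 1 ltr01)] := C1.
move=> [M [_ HM]].
exists (Num.max 1 (M / beta)) => y [s /=]; rewrite in_itv/= andbT => s0 <-.
have ts := theta_gt0 s0; have tb : 0 < theta s + beta by exact: addr_gt0.
have [Ms|sM] := ltP M s.
  rewrite le_max; apply/orP; left; have := HM s Ms.
  rewrite sub0r normrN ger0_norm; last by rewrite divr_ge0// ltW.
  rewrite ler_pdivrMr// mul1r => h; rewrite ler_pdivrMr// mul1r (le_trans h)// lerDl ltW//.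
rewrite le_max; apply/orP; right; apply: (@le_trans _ _ (s / beta)).
  by rewrite ler_wpM2l// lef_pV2 ?posrE// lerDr ltW.
by rewrite ler_wpM2r// invr_ge0 ltW.
Qed.

Lemma eta_ge0 : 0 <= eta.
Proof. by apply: le_trans (theta_ratio_le (lexx 0)); rewrite mul0r. Qed.

Lemma speed_le_eta t : enorm (u t) <= eta * (ell t + beta).
Proof.
have [_ H _] := C1; have [h1 h2] := H t (x t) (u t).
have := theta_ratio_le (enorm_ge0 (u t)); rewrite ler_pdivrMr ?addr_gt0 ?beta_gt0// => h.
by rewrite (le_trans h)// ler_wpM2l ?eta_ge0// lerD2r.
Qed.

Variable gamma : R.
Hypothesis hgamma : gamma = expR (eta * xi * (c + T0 * beta)).

Local Notation rate := (fun s => eta * xi * (ell s + beta)).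
Local Notation drift := (fun s => eta * xi * (prim ell s + beta * s)).

Lemma drift_is_derive (s : R) : 0 < s < 1 -> is_derive s 1 drift (rate s).
Proof.
move=> s01.
have d : is_derive s (1 : R) (fun s => beta * s) beta.
  exact: is_derive_scale.
apply: is_deriveZ; apply: is_deriveD => //.
exact: (prim_is_derive ell_continuous s01).
Qed.

(** Where [p > beta], [L + beta <= <q, u> <= |q| |u| <= eta |q| (L + beta)],
    and [xi L + delta <= xi (L + beta)] because [delta / xi < beta]. *)
Lemma rate_bound s : beta < p s -> [/\ 0 <= rate s,
  enorm (grad_x L s (x s) (u s)) <= rate s * enorm (q s) &
  `|deriv_t L s (x s) (u s)| <= rate s * enorm (q s)].
Proof.
move=> ps; have [xi0 delta0 H] := C3; have b0 := beta_gt0.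
have l0 : 0 < ell s by exact: lagrangian_gt0.
have k0 : 0 <= rate s by rewrite mulr_ge0 ?mulr_ge0 ?eta_ge0 ?ltW// addr_gt0.
suff D : enorm (grad_tx L s (x s) (u s)) <= rate s * enorm (q s).
  by split => //; apply: le_trans D; [exact: grad_x_le|exact: deriv_t_le].
have h1 : enorm (grad_tx L s (x s) (u s)) <= xi * (ell s + beta).
  apply: le_trans (H _ _ _) _; rewrite mulrDr lerD2l mulrC -ler_pdivrMr//.
  exact: ltW.
apply: le_trans h1 _.
have h2 : ell s + beta <= enorm (q s) * enorm (u s).
  by apply: le_trans (dotv_le _ _); move: ps; rewrite /hamiltonian; lra.
have h3 := ler_wpM2l (enorm_ge0 (q s)) (speed_le_eta s).
have := ler_wpM2l (ltW xi0) (le_trans h2 h3).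
rewrite (_ : xi * (enorm (q s) * _) = rate s * enorm (q s)) //; ring.
Qed.

(** On an excursion the drift grows by at most
    [eta xi (\int L + T0 beta) <= eta xi (c + T0 beta) = ln gamma]. *)
Lemma drift_increment (a b : R) : 0 <= a -> a <= b -> b <= 1 ->
  (forall s, a < s < b -> beta < p s) -> expR (drift b - drift a) <= gamma.
Proof.
move=> a0 ab b1 H; rewrite hgamma ler_expR -mulrBr.
have [xi0 _ _] := C3; have b0 := beta_gt0.
rewrite ler_wpM2l ?mulr_ge0 ?eta_ge0 ?(ltW xi0)//.
have h1 := @prim_increment_le _ ell a b ell_continuous
  (fun s => ltW (lagrangian_gt0 s (x s) (u s))) a0 ab b1.
have h2 := ler_wpM2r (ltW b0) (excursion_length a0 ab b1 H).
have h3 := cost_le; have h4 := hr0.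
lra.
Qed.

(** Start from the nearest time where [p <= beta] on the side of a time
    provided by [exists_hamiltonian_le], and apply the growth lemma of the
    corresponding direction. *)
Lemma hamiltonian_excursion (t : R) : 0 < t < 1 -> beta < p t ->
  p t - beta <= (gamma - 1) * enorm (q t).
Proof.
move=> /andP[t0 t1] pt.
have [_ _ _ _ _ dq] := ex.
have [s /andP[s0 s1] ps] := exists_hamiltonian_le.
have dp (r : R) (r01 : 0 < r < 1) := extremal_hamiltonian hF C2 ex r01.
have [st|ts] := leP s t.
  have [a [/andP[sa at_] pa H]] := last_below hamiltonian_continuous st ps pt.
  have in01 r : a <= r <= t -> 0 < r < 1.
    by move=> /andP[ar rt]; rewrite (lt_le_trans s0 (le_trans sa ar)) (le_lt_trans rt).
  have H' r : a < r < t -> beta < p r by move=> /andP[ar /ltW rt]; apply: H; rewrite ar.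
  have := @escape_forward _ _ q p drift (fun s => grad_x L s (x s) (u s))
    (fun s => - deriv_t L s (x s) (u s)) rate a t (ltW at_).
  move=> /(_ (fun r rab => dq r (in01 r rab)) (fun r rab => dp r (in01 r rab))
    (fun r rab => drift_is_derive (in01 r rab))) h.
  have {}h : p t - p a <= (expR (drift t - drift a) - 1) * enorm (q t).
    apply: h => r rab; have [k0 k1 k2] := rate_bound (H' r rab); split => //; split => //.
    by apply: le_trans k2; rewrite -normrN ler_norm.
  apply: (@le_trans _ _ (p t - p a)); first by rewrite lerD2l lerN2.
  apply: le_trans h _; rewrite ler_wpM2r ?enorm_ge0// lerD2r.
  apply: drift_increment => //; [exact: le_trans (ltW s0) sa|exact: ltW|exact: ltW].
have [b [/andP[tb bs] pb H]] := first_below hamiltonian_continuous (ltW ts) ps pt.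
have in01 r : t <= r <= b -> 0 < r < 1.
  by move=> /andP[tr rb]; rewrite (lt_le_trans t0 tr) (le_lt_trans (le_trans rb bs)).
have H' r : t < r < b -> beta < p r by move=> /andP[/ltW tr rb]; apply: H; rewrite tr.
have := @escape_backward _ _ q p drift (fun s => grad_x L s (x s) (u s))
  (fun s => - deriv_t L s (x s) (u s)) rate t b (ltW tb).
move=> /(_ (fun r rab => dq r (in01 r rab)) (fun r rab => dp r (in01 r rab))
  (fun r rab => drift_is_derive (in01 r rab))) h.
have {}h : p t - p b <= (expR (drift b - drift t) - 1) * enorm (q t).
  apply: h => r rab; have [k0 k1 k2] := rate_bound (H' r rab); split => //; split => //.
  by rewrite opprK; apply: le_trans k2; rewrite ler_norm.
apply: (@le_trans _ _ (p t - p b)); first by rewrite lerD2l lerN2.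
apply: le_trans h _; rewrite ler_wpM2r ?enorm_ge0// lerD2r.
apply: drift_increment => //; [exact: ltW|exact: ltW|exact: le_trans bs (ltW s1)].
Qed.

Variable Lambda2 : R.
Hypothesis hLambda2 : is_max [set L p.1 p.2 u |
     p in Omega c & u in [set u | enorm u = gamma + 1]] Lambda2.

Lemma gamma_gt0 : 0 < gamma. Proof. by rewrite hgamma expR_gt0. Qed.

Lemma Lambda2_gt0 : 0 < Lambda2.
Proof. by have [[[s y] _ [v _ <-]] _] := hLambda2; exact: lagrangian_gt0. Qed.

(** With [v] of length [gamma + 1] along [q], convexity gives
    [(gamma + 1) |q| - p <= L(t, x, v) <= Lambda2]; insert
    [p <= beta + (gamma - 1) |q|]. *)
Lemma momentum_le (t : R) : 0 < t < 1 -> beta < p t -> enorm (q t) <= Lambda2 + beta.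
Proof.
move=> t01 pt; have pb := hamiltonian_excursion t01 pt.
have g0 := gamma_gt0; have b0 := beta_gt0; have L0 := Lambda2_gt0.
have [->|q0] := eqVneq (enorm (q t)) 0; first by rewrite addr_ge0// ltW.
have qp : 0 < enorm (q t) by rewrite lt_def q0 enorm_ge0.
pose v := ((gamma + 1) / enorm (q t)) *: q t.
have vE : enorm v = gamma + 1.
  by rewrite enormZ ger0_norm ?divfK// divr_ge0 ?enorm_ge0// addr_ge0// ltW.
have h1 : L t (x t) v <= Lambda2.
  have [_] := hLambda2; apply; exists (t, x t).
    by apply: extremal_in_Omega; case/andP: t01 => /ltW -> /ltW ->.
  by exists v.
have [m0 H] := C2; have := H t (x t) (u t) v.
have [_ _ _ -> _ _] := ex.
have : 0 <= mu / 2 * enorm (v - u t) ^+ 2 by rewrite mulr_ge0 ?sqr_ge0// divr_ge0// ltW.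
have -> : dotv (q t) (v - u t) = (gamma + 1) * enorm (q t) - dotv (q t) (u t).
  by rewrite dotvBr /v dotvZr -enorm_sqr expr2 mulrA divfK.
move: pb; rewrite /hamiltonian; lra.
Qed.

Variables (Lambda0 Lambda1 rho : R).
Hypothesis hLambda0 : is_max [set L p.1 p.2 0 | p in Omega c] Lambda0.
Hypothesis hLambda1 : is_max [set enorm (grad_u L p.1 p.2 0) | p in Omega c] Lambda1.
Hypotheses (hrho : 0 < rho) (hrho_lt : forall r : R, rho <= r ->
     r / ((mu / 2 * r ^+ 2 - Lambda1 * r - Lambda0) + beta)
       < 1 / (Lambda2 + beta)).

Local Notation den := (fun r : R => mu / 2 * r ^+ 2 - Lambda1 * r - Lambda0 + beta).

Lemma den_continuous : continuous den.
Proof.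
move=> r; apply: cvgD; last exact: cvg_cst.
apply: cvgB; last exact: cvg_cst.
apply: cvgB; apply: cvgM; try exact: cvg_cst; last exact: cvg_id.
by apply: (@continuous_comp _ _ _ id (fun r : R => r ^+ 2));
  [exact: cvg_id|exact: exprn_continuous].
Qed.

(** Beyond [rho] the hypothesis on [rho] only allows [den r <= 0], where the
    quotient is nonpositive by sign or by the convention for division by 0, or
    [den r > (Lambda2 + beta) r]. The first case is excluded: [den] tends to
    infinity, so from a value [<= 0] it would pass through
    [kap = (Lambda2 + beta) rho / 2], which belongs to neither case. *)
Lemma den_gt r : rho <= r -> (Lambda2 + beta) * r < den r.
Proof.
move=> rr; have [m0 _] := C2; have b0 := beta_gt0; have L0 := Lambda2_gt0.
have lb : 0 < Lambda2 + beta by exact: addr_gt0.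
have dich s : rho <= s -> den s <= 0 \/ (Lambda2 + beta) * s < den s.
  move=> rs; have [d0|d0] := leP (den s) 0; [by left|right].
  by have := hrho_lt rs; rewrite ltr_pdivrMr// mulrAC mul1r ltr_pdivlMr// mulrC.
have [d0|//] := dich r rr.
have r0' : 0 < r by exact: lt_le_trans rr.
pose kap := (Lambda2 + beta) * rho / 2.
have kap0 : 0 < kap by rewrite divr_gt0// mulr_gt0.
(* At [B], [B (mu / 2 B - Lambda1)] is at least [M], so [den B >= kap]. *)
pose M := `|Lambda0| + kap; pose B := r + (2 * (`|Lambda1| + M) / mu + 1).
have M0 : 0 < M by rewrite ltr_wpDl.
have m2 : 0 <= 2 * (`|Lambda1| + M) / mu by rewrite divr_ge0 ?mulr_ge0 ?addr_ge0// ltW.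
have rB : r <= B by rewrite lerDl addr_ge0.
have B1 : 1 <= B by rewrite /B; lra.
have hB : kap <= den B.
  have h1 : `|Lambda1| + M <= mu / 2 * B.
    have : 2 * (`|Lambda1| + M) / mu <= B by rewrite /B; lra.
    by rewrite ler_pdivrMr//; lra.
  have h2 : M <= (mu / 2 * B - Lambda1) * B.
    have h3 : M <= mu / 2 * B - Lambda1 by have := ler_norm Lambda1; lra.
    by apply: (le_trans h3); rewrite ler_peMr// (le_trans (ltW M0) h3).
  have := ler_norm Lambda0.
  move: h2; rewrite /M expr2; lra.
have [||s] := @IVT _ den r B kap rB.
- by apply: continuous_subspaceT; exact: den_continuous.
- by rewrite minEle (le_trans d0 (le_trans (ltW kap0) hB)) (le_trans d0 (ltW kap0))/=
    maxEle (le_trans d0 (le_trans (ltW kap0) hB)).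
rewrite in_itv/= => /andP[rs sB] sE.
have rs' : rho <= s by exact: le_trans rs.
have [|] := dich s rs'; rewrite sE; first by rewrite leNgt kap0.
have : (Lambda2 + beta) * rho <= (Lambda2 + beta) * s by rewrite ler_pM2l.
rewrite /kap; have : 0 < (Lambda2 + beta) * rho by exact: mulr_gt0.
lra.
Qed.

(** [L + beta <= |q| |u| <= (Lambda2 + beta) |u|], while strong convexity at 0
    bounds [L + beta] below by [den |u|]. *)
Lemma speed_le_high (t : R) : 0 < t < 1 -> beta < p t -> enorm (u t) <= rho.
Proof.
move=> t01 pt; have q1 := momentum_le t01 pt.
rewrite leNgt; apply/negP => /ltW /den_gt.
have tO : Omega c (t, x t) by apply: extremal_in_Omega; case/andP: t01 => /ltW -> /ltW ->.
have h1 : ell t + beta <= (Lambda2 + beta) * enorm (u t).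
  apply: (@le_trans _ _ (enorm (q t) * enorm (u t))); last by rewrite ler_wpM2r// enorm_ge0.
  by apply: le_trans (dotv_le _ _); move: pt; rewrite /hamiltonian; lra.
have [_ H] := C2; have := H t (x t) 0 (u t); rewrite subr0 => h2.
have h3 : enorm (grad_u L t (x t) 0) <= Lambda1.
  by have [_] := hLambda1; apply; exists (t, x t).
have h4 := dotv_le (- grad_u L t (x t) 0) (u t); rewrite dotvNl in h4.
rewrite enormN in h4.
have h5 := ler_wpM2r (enorm_ge0 (u t)) h3.
have h6 := lagrangian_gt0 t (x t) 0.
have h7 : 0 <= Lambda0.
  by apply: (le_trans (ltW h6)); have [_] := hLambda0; apply; exists (t, x t).
lra.
Qed.

(** Strong convexity between [u] and 0 reads
    [mu / 2 |u|^2 <= L(t, x, 0) + p]. *)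
Lemma speed_le_low (t : R) : 0 < t < 1 -> p t <= beta ->
  enorm (u t) <= Num.sqrt (2 / mu * (Lambda0 + beta)).
Proof.
move=> t01 pt.
have tO : Omega c (t, x t) by apply: extremal_in_Omega; case/andP: t01 => /ltW -> /ltW ->.
have h1 : L t (x t) 0 <= Lambda0 by have [_] := hLambda0; apply; exists (t, x t).
have [m0 H] := C2; have := H t (x t) (u t) 0.
have [_ _ _ -> _ _] := ex.
rewrite sub0r -scaleN1r dotvZr enormZ normrN normr1 mul1r => h2.
have h3 : enorm (u t) ^+ 2 <= 2 / mu * (Lambda0 + beta).
  rewrite mulrAC ler_pdivlMr//; move: pt; rewrite /hamiltonian; lra.
by rewrite -[leLHS]ger0_norm ?enorm_ge0// -sqrtr_sqr ler_wsqrtr.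
Qed.

End speed_bound.

(** * From the minimizer to an extremal *)

Section cost_of_path.
Variables (R : realType) (n : nat) (L : R -> 'rV[R]_n -> 'rV[R]_n -> R).
Notation mu := (@lebesgue_measure R).
Notation I01 := (`[0%R, 1%R]%classic : set R).
Hypothesis hF : continuously_differentiable (fun p : R * 'rV[R]_n * 'rV[R]_n => L p.1.1 p.1.2 p.2).
Hypothesis Lpos : forall t x u, 0 < L t x u.

Lemma cost_vprim (g x : R -> 'rV[R]_n) : vintg01 g -> (forall t, 0 <= t <= 1 -> x t = vprim g t) ->
  cost L x = (\int[mu]_(t in I01) (L t (vprim g t) (g t))%:E)%E.
Proof.
move=> gi xE; apply: ge0_integral_eq_ae.
- by move=> t _; rewrite lee_fin ltW.
- by move=> t _; rewrite lee_fin ltW.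
have aeF : Filter (almost_everywhere mu) by exact: (ae_filter_ringOfSetsType mu).
have xE' t : 0 <= t <= 1 -> x t = 0 + vprim g t by rewrite add0r; exact: xE.
apply: filterS2 (ae_I01_oo R) (vprim_derive_ae gi xE') => t t01 dx It.
by rewrite dx ?t01// xE.
Qed.

Lemma vprim_cst (a : 'rV[R]_n) t : 0 <= t -> vprim (fun=> a) t = t *: a.
Proof.
move=> t0; apply/rowP => i; rewrite !mxE /prim Rintegral_cst//=.
by rewrite lebesgue_measure_itv/= lte_fin; case: ltgtP t0 => // [t0|<-] _;
  rewrite ?sube0 ?mul0r ?mulr0//= mulrC.
Qed.

Lemma segment_cost (a : 'rV[R]_n) :
  cost L (fun t => t *: a) = (\int[mu]_(t in `[0, 1]) L t (t *: a) a)%:E.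
Proof.
have ai : vintg01 (fun=> a) by move=> i; exact: intg01_cst.
rewrite (cost_vprim ai); last by move=> t /andP[t0 _]; rewrite vprim_cst.
transitivity (\int[mu]_(t in I01) (L t (t *: a) a)%:E)%E.
  by apply: eq_integral => t; rewrite inE/= in_itv/= => /andP[t0 _]; rewrite vprim_cst.
rewrite /Rintegral fineK//.
have cl : continuous (fun t => L t (t *: a) a).
  apply: (@triple_continuous _ _ _ (fun p => L p.1.1 p.1.2 p.2) id).
  - exact: lagrangian_continuous.
  - by move=> ?; exact: cvg_id.
  - by move=> t; apply: cvgZl; exact: cvg_id.
  - by move=> t; exact: cvg_cst.
have li : intg01 (fun t => L t (t *: a) a) by exact/intg01_continuous/continuous_subspaceT/cl.
exact: integrable_fin_num li.
Qed.

End cost_of_path.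

Section minimizer.
Variables (R : realType) (m n : nat) (L : R -> 'rV[R]_n -> 'rV[R]_n -> R).
Variables (theta : R -> R) (kappa xi delta : R).
Hypotheses (C1 : condC1 L theta) (C2 : condC2 L kappa) (C3 : condC3 L xi delta).
Variables (A : 'M[R]_(m, n)) (b : 'cV[R]_m) (x : R -> 'rV[R]_n).
Hypothesis hx : solution L A b x.
Notation mu := (@lebesgue_measure R).
Notation I01 := (`[0%R, 1%R]%classic : set R).

Lemma vprim_admissible (g : R -> 'rV[R]_n) : vintg01 g -> polyhedron A b (vprim g 1) ->
  admissible A b (vprim g).
Proof.
move=> gi p1; split => //; last exact: vprim0.
by apply: (@vprim_ac _ _ g 0) => // t _; rewrite add0r.
Qed.

(** The minimizer competes with every primitive having its end point, which
    gives [euler_lagrange], and with the segment from 0 to [a], which bounds its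
    cost. *)
Lemma minimizer_extremal (a : 'rV[R]_n) : polyhedron A b a ->
  exists y u q, [/\ extremal L y u q, y 0 = 0,
    prim (fun s => L s (y s) (u s)) 1 <= \int[mu]_(t in `[0, 1]) L t (t *: a) a &
    {ae mu, forall t : R, I01 t -> derive1 x t = u t}].
Proof.
move=> Pa; have [hF _ _] := C1.
have Lpos : forall t x u, 0 < L t x u by exact: lagrangian_gt0 C1.
have [[acx x0 Px] opt] := hx.
have aeF : Filter (almost_everywhere mu) by exact: (ae_filter_ringOfSetsType mu).
have [g gi xg'] := ac_vprim acx.
have xg t : 0 <= t <= 1 -> x t = vprim g t by move=> t01; rewrite xg'// x0 add0r.
have xE := cost_vprim Lpos gi xg.
have ai : vintg01 (fun=> a) by move=> i; exact: intg01_cst.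
have cost_le : (cost L x <= (\int[mu]_(t in `[0, 1]) L t (t *: a) a)%:E)%E.
  rewrite -(segment_cost hF Lpos); apply: opt; split; rewrite ?scale0r ?scale1r//.
  by apply: (vprim_ac (v0 := 0) ai) => t /andP[t0 _]; rewrite add0r vprim_cst.
have Li : intg01 (fun t => L t (vprim g t) (g t)).
  have Lm : measurable_fun I01 (fun t => L t (vprim g t) (g t)).
    apply: (@along_measurable _ _ (fun p => L p.1.1 p.1.2 p.2)).
    - exact: lagrangian_continuous.
    - exact: vprim_measurable.
    - exact: g_measurable.
  apply/integrableP; split; first exact/measurable_EFinP.
  apply: (@le_lt_trans _ _ (cost L x)); last by rewrite (le_lt_trans cost_le)// ltry.
  rewrite xE le_eqVlt; apply/orP; left; apply/eqP/eq_integral => t _ /=.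
  by rewrite ger0_norm// ltW.
have opt' (g2 : R -> 'rV[R]_n) : vintg01 g2 -> vprim g2 1 = vprim g 1 ->
    (\int[mu]_(t in I01) (L t (vprim g t) (g t))%:E <=
     \int[mu]_(t in I01) (L t (vprim g2 t) (g2 t))%:E)%E.
  move=> g2i E; have E2 := cost_vprim Lpos g2i (fun t _ => erefl (vprim g2 t)).
  rewrite -xE -E2; apply: opt; apply: vprim_admissible => //.
  by rewrite E -xg// ler01 lexx.
have [mm [Gi EL]] := euler_lagrange hF C3 Lpos gi Li opt'.
have [y [u [q [ex yE gu]]]] := regular_extremal hF C2 gi Gi EL.
exists y, u, q; split => //.
- by rewrite yE ?vprim0//= in_itv/= lexx ler01.
- have E : (\int[mu]_(t in I01) (L t (y t) (u t))%:E = cost L x)%E.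
    rewrite xE; apply: ge0_integral_eq_ae.
    + by move=> t _; rewrite lee_fin ltW.
    + by move=> t _; rewrite lee_fin ltW.
    + by apply: filterS gu => t gut It; rewrite yE// gut.
  have fin : cost L x \is a fin_num by rewrite xE; exact: integrable_fin_num Li.
  by rewrite /prim {1}/Rintegral E -lee_fin fineK.
- apply: filterS3 (ae_I01_oo R) (vprim_derive_ae gi xg') gu => t t01 dx gut It.
  by rewrite dx ?t01// gut.
Qed.

End minimizer.

Theorem theorem2 (R : realType) (m n : nat)
  (L : R -> 'rV[R]_n -> 'rV[R]_n -> R) (theta : R -> R) (mu xi delta : R)
  (hC1 : condC1 L theta) (hC2 : condC2 L mu) (hC3 : condC3 L xi delta)
  (A : 'M[R]_(m, n)) (b : 'cV[R]_m)
  (x : R -> 'rV[R]_n) (hx : solution L A b x)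
  (r0 : R) (hr0 : 0 < r0) (hr0theta : forall r : R, r0 <= r -> 1 <= theta r / r)
  (a : 'rV[R]_n) (ha : polyhedron A b a)
  (c : R)
  (hc : c = r0 + \int[@lebesgue_measure R]_(t in `[0, 1]) L t (t *: a) a)
  (Lambda0 : R) (hLambda0 : is_max [set L p.1 p.2 0 | p in Omega c] Lambda0)
  (Lambda1 : R)
  (hLambda1 : is_max [set enorm (grad_u L p.1 p.2 0) | p in Omega c] Lambda1)
  (sigma : R -> R)
  (hsigma : forall r : R, 0 <= r ->
     is_max [set dotv (grad_u L p.1 p.2 u) u - L p.1 p.2 u |
               p in Omega c & u in [set u | enorm u <= r]] (sigma r))
  (T0 : R) (hT0 : 0 < T0 < 1)
  (beta : R) (hbeta : beta = sigma ((c + 1) / T0)) (hbeta_gt : delta / xi < beta)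
  (eta : R) (heta : eta = sup [set r / (theta r + beta) | r in `[0, +oo[])
  (gamma : R) (hgamma : gamma = expR (eta * xi * (c + T0 * beta)))
  (Lambda2 : R)
  (hLambda2 : is_max [set L p.1 p.2 u |
     p in Omega c & u in [set u | enorm u = gamma + 1]] Lambda2)
  (rho : R) (hrho : 0 < rho)
  (hrho_lt : forall r : R, rho <= r ->
     r / ((mu / 2 * r ^+ 2 - Lambda1 * r - Lambda0) + beta)
       < 1 / (Lambda2 + beta)) :
  {ae @lebesgue_measure R, forall t : R, t \in `[0, 1] ->
     enorm (derive1 x t) <=
       Num.max rho
         (Num.max (Num.sqrt (2 / mu * (Lambda0 + beta)))
                  ((Lambda1 + Num.sqrt (Lambda1 ^+ 2 + 4 * mu * Lambda0)) / 2))}.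
Proof.
have [y [u [q [ex y0 cost_le dxu]]]] := minimizer_extremal hC1 hC2 hC3 hx ha.
have cost_le' : prim (fun s => L s (y s) (u s)) 1 <= c - r0 by rewrite hc addrC addKr.
have unit_vector : exists v : 'rV[R]_n, 0 < enorm v.
  have [[[s z] _ [v /= vE _]] _] := hLambda2; exists v; rewrite vE hgamma.
  by rewrite addr_gt0 ?expR_gt0.
have aeF : Filter (almost_everywhere (@lebesgue_measure R)).
  exact: (ae_filter_ringOfSetsType (@lebesgue_measure R)).
apply: filterS2 (ae_I01_oo R) dxu => t t01 dx It.
rewrite dx// !le_max.
have [pt|pt] := leP (hamiltonian L y u q t) beta.
  apply/orP; right; apply/orP; left.
  exact: (speed_le_low hC1 hC2 ex y0 hr0 hr0theta cost_le' hLambda0 (t01 It) pt).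
apply/orP; left.
exact: (speed_le_high hC1 hC2 hC3 ex y0 hr0 hr0theta cost_le' hsigma hT0 hbeta hbeta_gt heta
  unit_vector hgamma hLambda2 hLambda0 hLambda1 hrho hrho_lt (t01 It) pt).
Qed.
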